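(* Let $T=T_1\oplus\cdots\oplus T_n$ be a cluster tilting object in the cluster category $\mathcal{C}_{\mathbb{A}_n}$ of the linearly oriented quiver $\mathbb{A}_n:n\to n-1\to\cdots\to1$. The map $T\mapsto Q_T$ commutes with mutation, that is, for every $r\in\{1,\dots,n\}$, $$\mu_r(Q_T)=Q_{\mu_r(T)}.$$
   Context: Let $k$ be an algebraically closed field. **Ice quivers.** A cluster quiver is a finite quiver without loops and 2-cycles. An ice quiver of type $(n,m)$ is a cluster quiver with vertices $\{1,\dots,m\}$ whose vertices $n+1,\dots,m$ are frozen; its principal part is the full subquiver on the non-frozen vertices. Mutation $\mu_r$ at a non-frozen vertex $r$: (i) for each path $i\to r\to j$ add an arrow $i\to j$; (ii) reverse all arrows with source or target $r$; (iii) delete the 2-cycles created. Arrows between two frozen vertices are disregarded. **Cluster tilting objects and mutation.** $\mathcal{C}_Q$ is the orbit category of $\mathcal{D}^b(\mathrm{mod}\,kQ)$ by $\tau^{-1}[1]$. An object $T=T_1\oplus\cdots\oplus T_n$ with pairwise nonisomorphic indecomposable $T_r$ and $\mathrm{Ext}^1_{\mathcal{C}_Q}(T,T)=0$ is called cluster tilting. For each $r$ there is a unique indecomposable $T_r'\not\cong T_r$ such that $\mu_r(T):=T/T_r\oplus T_r'$ is cluster tilting (with $T/T_r=\bigoplus_{j\ne r}T_j$; in $\mu_r(T)$ the summand $T_r'$ takes index $r$ and the other summands keep their index). There are exchange triangles, given by minimal right $\mathrm{add}(T/T_r)$-approximations of $T_r'$ and $T_r$, $$T_r\to B\to T_r'\to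 T_r[1],\qquad T_r'\to B'\to T_r\to T_r'[1].$$ Let $H^0=\mathrm{Hom}_{\mathcal{C}_Q}(\bigoplus_iP_i,-):\mathcal{C}_Q\to\mathrm{mod}\,kQ$, with $P_i$ the indecomposable projective modules. $\dim$ denotes the dimension vector. **The ice quiver $Q_T$** (type $(n,3n)$) of a cluster tilting object $T$ of $\mathcal{C}_Q$, $Q$ Dynkin: 1. The principal part of $Q_T$ is the opposite of the quiver of the endomorphism algebra $\mathrm{End}_{\mathcal{C}}T$ (vertex $r$ corresponding to $T_r$). 2. Arrows between $r$ and frozen vertices, using the exchange triangles above: (a) Suppose $T_r$ and $T_r'$ are modules. Write $H^0(B)=B_1\oplus B_2$, with $B_1$ the direct sum of all summands that are successors of $T_r$ in $\mathrm{mod}\,kQ$ and $B_2$ its complement; write $H^0(B')=B_1'\oplus B_2'$, with $B_1'$ the direct sum of all summands that are successors of $T_r'$ in $\mathrm{mod}\,kQ$ and $B_2'$ its complement. (Successor/predecessor: connected by a chain of nonzero nonisomorphisms between indecomposable modules.) If $T_r$ is a predecessor of $T_r'$, the number of arrows $r\to n+j$ is the $j$th coordinate of $\dim T_r'-\dim B_1'$ and the number of arrows $r\to 2n+j$ is the $j$th coordinate of $\dim T_r-\dim B_2'$. If $T_r$ is a successor of $T_r'$, the number of arrows $n+j\to r$ is the $j$th coordinate of $\dim T_r-\dim B_1$ and the number of arrows $2n+j\to r$ is the $j$th coordinate of $\dim T_r'-\dim B_2$. (b) If $T_r'=P[1]$ with $P$ projective, the number of arrows $n+j\to r$ is the $j$th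 coordinate of $\dim T_r-\dim H^0(B)$ and the number of arrows $r\to2n+j$ is the $j$th coordinate of $\dim T_r-\dim H^0(B')$. If $T_r=P[1]$ with $P$ projective, the number of arrows $r\to n+j$ is the $j$th coordinate of $\dim T_r'-\dim H^0(B')$ and the number of arrows $2n+j\to r$ is the $j$th coordinate of $\dim T_r'-\dim H^0(B)$. *)

(* Defs.v *)
From Stdlib Require Import Relation_Operators.
From mathcomp Require Import all_boot all_order all_algebra.
From mathcomp Require Import zify.

Set Implicit Arguments.
Unset Strict Implicit.
Unset Printing Implicit Defensive.

Import Order.TTheory GRing.Theory Num.Theory.
Local Open Scope ring_scope.

(* Modules over the path algebra kQ are finite-dimensional representations of *)
(* Q: M_i is the space of row vectors 'rV_(rdim i), and linear maps act by    *)
(* multiplication on the right.                                               *)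

Record quiver := Quiver {
  vert : finType;
  arrow : finType;
  src : arrow -> vert;
  tgt : arrow -> vert }.

Record rep (k : fieldType) (Q : quiver) := Rep {
  rdim : vert Q -> nat;
  rmap : forall a : arrow Q, 'M[k]_(rdim (src a), rdim (tgt a)) }.

Section Representations.
Variables (k : fieldType) (Q : quiver).
Implicit Types M N P : rep k Q.

Record rhom M N := RHom {
  rcomp :> forall i : vert Q, 'M[k]_(rdim M i, rdim N i);
  rhomP : forall a : arrow Q,
    rmap M a *m rcomp (tgt a) = rcomp (src a) *m rmap N a }.

Definition rep0 : rep k Q := @Rep k Q (fun=> 0%N) (fun=> 0).

Fact rhom0_subproof M N (a : arrow Q) :
  rmap M a *m (0 : 'M[k]_(rdim M (tgt a), rdim N (tgt a)))
  = (0 : 'M[k]_(rdim M (src a), rdim N (src a))) *m rmap N a.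
Proof. by rewrite mulmx0 mul0mx. Qed.
Definition rhom0 M N : rhom M N := @RHom M N (fun=> 0) (rhom0_subproof M N).

Fact rhom1_subproof M (a : arrow Q) :
  rmap M a *m (1%:M : 'M[k]_(rdim M (tgt a))) = 1%:M *m rmap M a.
Proof. by rewrite mulmx1 mul1mx. Qed.
Definition rhom1 M : rhom M M := @RHom M M (fun=> 1%:M) (@rhom1_subproof M).

Fact rhom_opp_subproof M N (f : rhom M N) (a : arrow Q) :
  rmap M a *m (- f (tgt a)) = (- f (src a)) *m rmap N a.
Proof. by rewrite mulmxN mulNmx rhomP. Qed.
Definition rhom_opp M N (f : rhom M N) : rhom M N :=
  @RHom M N (fun i => - f i) (rhom_opp_subproof f).

Fact rhom_mul_subproof M N P (f : rhom M N) (g : rhom N P) (a : arrow Q) :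
  rmap M a *m (f (tgt a) *m g (tgt a)) = (f (src a) *m g (src a)) *m rmap P a.
Proof. by rewrite mulmxA rhomP -mulmxA rhomP mulmxA. Qed.
(* first f, then g *)
Definition rhom_mul M N P (f : rhom M N) (g : rhom N P) : rhom M P :=
  @RHom M P (fun i => f i *m g i) (rhom_mul_subproof f g).

Definition rhom_iso M N (f : rhom M N) : Prop :=
  exists g : rhom N M, forall i, f i *m g i = 1%:M /\ g i *m f i = 1%:M.

Definition rzero M : Prop := forall i, rdim M i = 0%N.

Definition rdsum (I : finType) (N : I -> rep k Q) M : Prop :=
  exists (u : forall l, rhom (N l) M) (v : forall l, rhom M (N l)),
    forall i : vert Q,
      [/\ forall l, u l i *m v l i = 1%:M,
          forall l l', l != l' -> u l i *m v l' i = 0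
        & \sum_l v l i *m u l i = 1%:M].

Definition rindec M : Prop :=
  ~ rzero M /\
  forall N : bool -> rep k Q, rdsum N M -> exists b, rzero (N b).

Definition rprojective P : Prop :=
  forall M N (g : rhom M N) (f : rhom P N), (forall i, row_full (g i)) ->
    exists h : rhom P M, forall i, h i *m g i = f i.

Definition rstep M N : Prop :=
  [/\ rindec M, rindec N &
      exists f : rhom M N, (exists i, f i != 0) /\ ~ rhom_iso f].

(* N is a successor of M (and M a predecessor of N) *)
Definition rsucc : rep k Q -> rep k Q -> Prop := clos_trans _ rstep.

(* H = B1 (+) B2, where B1 is the sum of the indecomposable summands of H     *)
(* satisfying S and B2 the sum of the other ones                              *)
Definition rsplit (S : rep k Q -> Prop) (H B1 B2 : rep k Q) : Prop :=
  exists (m : nat) (N : 'I_m -> rep k Q) (b : pred 'I_m),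
    (forall l, rindec (N l)) /\ (forall l, b l <-> S (N l)) /\
    [/\ rdsum N H,
        rdsum (fun l : {l | b l} => N (val l)) B1
      & rdsum (fun l : {l | ~~ b l} => N (val l)) B2].

Record cplx := Cplx {
  term :> int -> rep k Q;
  diff : forall p : int, rhom (term p) (term (p + 1));
  diff_sq : forall p i, diff p i *m diff (p + 1) i = 0;
  cplx_bounded : exists b : nat, forall p : int, (b < `|p|)%N -> rzero (term p) }.

Implicit Types X Y Z : cplx.

Record chain X Y := Chain {
  cmap :> forall p : int, rhom (X p) (Y p);
  chainP : forall p i, cmap p i *m diff Y p i = diff X p i *m cmap (p + 1) i }.

Fact chain1_subproof X p i :
  rhom1 (X p) i *m diff X p i = diff X p i *m rhom1 (X (p + 1)) i.
Proof. by rewrite mulmx1 mul1mx. Qed.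
Definition chain1 X : chain X X :=
  @Chain X X (fun p => rhom1 (X p)) (@chain1_subproof X).

Fact chain_mul_subproof X Y Z (f : chain X Y) (g : chain Y Z) p i :
  rhom_mul (f p) (g p) i *m diff Z p i
  = diff X p i *m rhom_mul (f (p + 1)) (g (p + 1)) i.
Proof. by rewrite /= -mulmxA chainP mulmxA chainP mulmxA. Qed.
(* first f, then g *)
Definition chain_mul X Y Z (f : chain X Y) (g : chain Y Z) : chain X Z :=
  @Chain X Z (fun p => rhom_mul (f p) (g p)) (chain_mul_subproof f g).

(* indexing the homotopy by h p : X (p + 1) -> Y p avoids transports; p + 1   *)
(* ranges over all degrees                                                    *)
Definition null_homotopic X Y (f : chain X Y) : Prop :=
  exists h : forall p : int, rhom (X (p + 1)) (Y p), forall p i,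
    f (p + 1) i = diff X (p + 1) i *m h (p + 1) i + h p i *m diff Y p i.

(* f is injective and surjective on the cohomology in each degree p + 1       *)
Definition quasi_iso X Y (f : chain X Y) : Prop :=
  forall (p : int) (i : vert Q),
    (forall (x : 'rV_(rdim (X (p + 1)) i)) (y : 'rV_(rdim (Y p) i)),
       x *m diff X (p + 1) i = 0 -> x *m f (p + 1) i = y *m diff Y p i ->
       exists x' : 'rV_(rdim (X p) i), x = x' *m diff X p i) /\
    (forall y : 'rV_(rdim (Y (p + 1)) i), y *m diff Y (p + 1) i = 0 ->
       exists (x : 'rV_(rdim (X (p + 1)) i)) (y' : 'rV_(rdim (Y p) i)),
         x *m diff X (p + 1) i = 0 /\
         y = x *m f (p + 1) i + y' *m diff Y p i).

Fact shift_sq_subproof X (p : int) i :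
  rhom_opp (diff X (p + 1)) i *m rhom_opp (diff X (p + 1 + 1)) i = 0.
Proof. by rewrite /= mulNmx mulmxN opprK diff_sq. Qed.
Fact shift_bounded_subproof X : exists b : nat, forall p : int,
  (b < `|p|)%N -> rzero (X (p + 1)).
Proof.
have [b bX] := cplx_bounded X; exists b.+1 => p ltbp; apply: bX; lia.
Qed.
Definition shift X : cplx :=
  @Cplx (fun p => X (p + 1)) (fun p => rhom_opp (diff X (p + 1)))
        (@shift_sq_subproof X) (shift_bounded_subproof X).

Fact chain_shift_subproof X Y (f : chain X Y) (p : int) i :
  f (p + 1) i *m diff (shift Y) p i = diff (shift X) p i *m f (p + 1 + 1) i.
Proof. by rewrite /= mulmxN mulNmx chainP. Qed.
Definition chain_shift X Y (f : chain X Y) : chain (shift X) (shift Y) :=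
  @Chain (shift X) (shift Y) (fun p => f (p + 1)) (chain_shift_subproof f).

(* modules as complexes concentrated in degree 0 *)
Definition stalk_term M (p : int) : rep k Q := if p == 0 then M else rep0.
Fact stalk_sq_subproof M p i :
  rhom0 (stalk_term M p) (stalk_term M (p + 1)) i
  *m rhom0 (stalk_term M (p + 1)) (stalk_term M (p + 1 + 1)) i = 0.
Proof. exact: mul0mx. Qed.
Fact stalk_bounded_subproof M : exists b : nat, forall p : int,
  (b < `|p|)%N -> rzero (stalk_term M p).
Proof. by exists 0%N => p; rewrite absz_gt0 /stalk_term => /negPf-> i. Qed.
Definition stalk M : cplx :=
  @Cplx (stalk_term M) (fun p => rhom0 _ _)
        (@stalk_sq_subproof M) (stalk_bounded_subproof M).

Definition stalk_rhom M N (f : rhom M N) (p : int) :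
    rhom (stalk_term M p) (stalk_term N p) :=
  if p == 0 as b return rhom (if b then M else rep0) (if b then N else rep0)
  then f else rhom1 rep0.
Fact stalk_chain_subproof M N (f : rhom M N) p i :
  stalk_rhom f p i *m diff (stalk N) p i
  = diff (stalk M) p i *m stalk_rhom f (p + 1) i.
Proof. by rewrite /= mulmx0 mul0mx. Qed.
Definition stalk_chain M N (f : rhom M N) : chain (stalk M) (stalk N) :=
  @Chain (stalk M) (stalk N) (stalk_rhom f) (stalk_chain_subproof f).

End Representations.

(* The collection of objects of a k-linear category and the action of a       *)
(* functor on objects are parameters, since the categories below all have the *)
(* bounded complexes as objects.                                              *)

Record lincat (k : fieldType) (O : Type) := LinCat {
  Hom : O -> O -> lmodType k;
  idm : forall X, Hom X X;
  comp : forall X Y Z, Hom Y Z -> Hom X Y -> Hom X Z;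
  compmA : forall X Y Z W (h : Hom Z W) (g : Hom Y Z) (f : Hom X Y),
    comp h (comp g f) = comp (comp h g) f;
  comp1m : forall X Y (f : Hom X Y), comp (idm Y) f = f;
  compm1 : forall X Y (f : Hom X Y), comp f (idm X) = f;
  comp_linl : forall X Y Z c (g g' : Hom Y Z) (f : Hom X Y),
    comp (c *: g + g') f = c *: comp g f + comp g' f;
  comp_linr : forall X Y Z c (g : Hom Y Z) (f f' : Hom X Y),
    comp g (c *: f + f') = c *: comp g f + comp g f' }.

Arguments Hom {k O} C X Y : rename.
Arguments idm {k O C} X : rename.
Arguments comp {k O C X Y Z} g f : rename.
Notation "g \oc f" := (comp g f) (at level 40, left associativity).

Section Categories.
Variables (k : fieldType).

Record lfunctor (O O' : Type) (C : lincat k O) (D : lincat k O') (o : O -> O')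
  := LFunctor {
  fmap : forall X Y, Hom C X Y -> Hom D (o X) (o Y);
  fmap_lin : forall X Y c (f g : Hom C X Y),
    fmap (c *: f + g) = c *: fmap f + fmap g;
  fmap1 : forall X, fmap (idm X) = idm (o X);
  fmap_comp : forall X Y Z (g : Hom C Y Z) (f : Hom C X Y),
    fmap (g \oc f) = fmap g \oc fmap f }.

Definition lfunctor_id O (C : lincat k O) : lfunctor C C (fun X => X) :=
  @LFunctor O O C C (fun X => X) (fun _ _ f => f)
    (fun _ _ _ _ _ => erefl) (fun=> erefl) (fun _ _ _ _ _ => erefl).

Section Composition.
Variables (O1 O2 O3 : Type).
Variables (C1 : lincat k O1) (C2 : lincat k O2) (C3 : lincat k O3).
Variables (oG : O2 -> O3) (oF : O1 -> O2).
Variables (G : lfunctor C2 C3 oG) (F : lfunctor C1 C2 oF).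

Fact lfunctor_comp_lin X Y c (f g : Hom C1 X Y) :
  fmap G (fmap F (c *: f + g))
  = c *: fmap G (fmap F f) + fmap G (fmap F g).
Proof. by rewrite !fmap_lin. Qed.
Fact lfunctor_comp1 X : fmap G (fmap F (idm X)) = idm (oG (oF X)).
Proof. by rewrite !fmap1. Qed.
Fact lfunctor_comp_comp X Y Z (g : Hom C1 Y Z) (f : Hom C1 X Y) :
  fmap G (fmap F (g \oc f)) = fmap G (fmap F g) \oc fmap G (fmap F f).
Proof. by rewrite !fmap_comp. Qed.

Definition lfunctor_comp : lfunctor C1 C3 (fun X => oG (oF X)) :=
  @LFunctor O1 O3 C1 C3 (fun X => oG (oF X)) (fun _ _ f => fmap G (fmap F f))
    lfunctor_comp_lin lfunctor_comp1 lfunctor_comp_comp.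
End Composition.

Record natiso (O O' : Type) (C : lincat k O) (D : lincat k O')
    (oF oG : O -> O') (F : lfunctor C D oF) (G : lfunctor C D oG) := NatIso {
  ni : forall X, Hom D (oF X) (oG X);
  ni_inv : forall X, Hom D (oG X) (oF X);
  niK : forall X, ni_inv X \oc ni X = idm (oF X);
  ni_invK : forall X, ni X \oc ni_inv X = idm (oG X);
  ni_nat : forall X Y (f : Hom C X Y), ni Y \oc fmap F f = fmap G f \oc ni X }.

Section InCategory.
Variables (O : Type) (C : lincat k O).
Implicit Types X Y Z : O.

Definition invertible X Y (f : Hom C X Y) : Prop :=
  exists g : Hom C Y X, g \oc f = idm X /\ f \oc g = idm Y.

Definition isomorphic X Y : Prop := exists f : Hom C X Y, invertible f.

Definition zero_obj X : Prop := idm X = 0 :> Hom C X X.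

Record dsum (I : finType) := DSum {
  total : O;
  summand :> I -> O;
  inj : forall i, Hom C (summand i) total;
  prj : forall i, Hom C total (summand i);
  prj_inj : forall i, prj i \oc inj i = idm (summand i);
  prj_inj0 : forall i j, i != j -> prj j \oc inj i = 0;
  inj_prj : \sum_i inj i \oc prj i = idm total }.

Definition indecomposable X : Prop :=
  ~ zero_obj X /\
  forall S : dsum bool, isomorphic (total S) X -> exists b, zero_obj (S b).

(* X lies in add (S / S_r): it is a direct summand of a finite direct sum of  *)
(* copies of the S_j with j != r                                              *)
Definition in_add_rest (I : finType) (S : dsum I) (r : I) X : Prop :=
  exists (m : nat) (c : 'I_m -> I) (Y : dsum 'I_m) (Z : dsum bool),
    [/\ forall l, c l != r, forall l, Y l = S (c l),
        isomorphic (total Z) (total Y) & isomorphic (Z true) X].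

Definition min_right_approx (I : finType) (S : dsum I) (r : I) B X
    (f : Hom C B X) : Prop :=
  [/\ in_add_rest S r B,
      forall Z, in_add_rest S r Z -> forall g : Hom C Z X,
        exists h : Hom C Z B, f \oc h = g
    & forall h : Hom C B B, f \oc h = f -> invertible h].

Definition rad X (f : Hom C X X) : Prop :=
  forall g : Hom C X X, invertible (idm X - g \oc f).

Definition rad2 X (f : Hom C X X) : Prop :=
  exists (m : nat) (u v : 'I_m -> Hom C X X),
    [/\ forall l, rad (u l), forall l, rad (v l) & f = \sum_l u l \oc v l].

Definition idem (I : finType) (S : dsum I) (i : I) : Hom C (total S) (total S) :=
  inj S i \oc prj S i.

(* U / (U :&: W) has dimension m *)
Definition quot_dim (V : lmodType k) (U W : V -> Prop) (m : nat) : Prop :=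
  exists b : 'I_m -> V, (forall l, U (b l)) /\
    forall v, U v -> exists! c : 'rV[k]_m, W (v - \sum_l c 0 l *: b l).

(* There are m arrows i -> j in the quiver of the algebra End S: m is the     *)
(* dimension of e_j (rad / rad^2) e_i, so that arrows i -> j are irreducible  *)
(* maps S_i -> S_j in add S.                                                  *)
Definition end_quiver (I : finType) (S : dsum I) (i j : I) (m : nat) : Prop :=
  quot_dim (fun f : Hom C (total S) (total S) =>
              rad f /\ f = idem S j \oc f \oc idem S i)
           (@rad2 (total S)) m.

End InCategory.

Section Orbit.
Variables (O : Type) (D : lincat k O).

Record autoequiv := AutoEquiv {
  fw_obj : O -> O;
  fw : lfunctor D D fw_obj;
  bw_obj : O -> O;
  bw : lfunctor D D bw_obj;
  ae_unit : natiso (lfunctor_comp bw fw) (lfunctor_id D);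
  ae_counit : natiso (lfunctor_comp fw bw) (lfunctor_id D) }.

Variable F : autoequiv.

(* F^i on objects, for i in Z *)
Definition ae_pow (i : int) (Y : O) : O :=
  match i with
  | Posz m => iter m (fw_obj F) Y
  | Negz m => iter m.+1 (bw_obj F) Y
  end.

Section Trivialisation.
Variables (C : lincat k O) (pi : lfunctor D C (fun X => X)).
Variable phi : natiso (lfunctor_comp pi (fw F)) pi.

Fixpoint triv_pos (m : nat) (Y : O) : Hom C (iter m (fw_obj F) Y) Y :=
  match m with
  | 0 => idm Y
  | m'.+1 => triv_pos m' Y \oc ni phi (iter m' (fw_obj F) Y)
  end.

Definition triv_inv (Y : O) : Hom C (bw_obj F Y) Y :=
  (fmap pi (ni (ae_counit F) Y) : Hom C (fw_obj F (bw_obj F Y)) Y)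
  \oc ni_inv phi (bw_obj F Y).

Fixpoint triv_neg (m : nat) (Y : O) : Hom C (iter m (bw_obj F) Y) Y :=
  match m with
  | 0 => idm Y
  | m'.+1 => triv_neg m' Y \oc triv_inv (iter m' (bw_obj F) Y)
  end.

(* the isomorphism F^i Y -> Y in C induced by phi *)
Definition triv (i : int) (Y : O) : Hom C (ae_pow i Y) Y :=
  match i with
  | Posz m => triv_pos m Y
  | Negz m => triv_neg m.+1 Y
  end.

Definition orbit_mor (i : int) X Y (f : Hom D X (ae_pow i Y)) : Hom C X Y :=
  triv i Y \oc fmap pi f.

End Trivialisation.

(* The orbit category D / F has the objects of D, and                         *)
(*   Hom_(D/F)(X, Y) = (+)_(i in Z) Hom_D(X, F^i Y).                          *)
(* It is given by the projection D -> D / F and its natural isomorphism       *)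
(* phi : pi F -> pi; the last two fields say that the map from the direct sum *)
(* induced by phi is surjective and injective.  Naturality of phi forces the  *)
(* usual composition law.                                                     *)
Record orbit_category := OrbitCategory {
  orb_cat : lincat k O;
  orb_proj : lfunctor D orb_cat (fun X => X);
  orb_triv : natiso (lfunctor_comp orb_proj (fw F)) orb_proj;
  orb_surj : forall X Y (h : Hom orb_cat X Y),
    exists (s : seq int) (f : forall i, Hom D X (ae_pow i Y)),
      uniq s /\ h = \sum_(i <- s) orbit_mor orb_triv (f i);
  orb_inj : forall X Y (s : seq int) (f : forall i, Hom D X (ae_pow i Y)),
    uniq s -> \sum_(i <- s) orbit_mor orb_triv (f i) = 0 ->
    forall i, i \in s -> f i = 0 }.

End Orbit.
End Categories.

Section Cluster.
Variables (k : fieldType) (Q : quiver).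
Local Notation cx := (cplx k Q).

(* D^b(mod kQ), the localisation of the category of bounded complexes at the  *)
(* quasi-isomorphisms, through its calculus of fractions: every morphism is a *)
(* fraction loc f \oc (loc s)^-1, and loc f = 0 exactly when f becomes null-  *)
(* homotopic after composition with a quasi-isomorphism.                      *)
Record derived_category := DerivedCategory {
  der_cat : lincat k cx;
  loc : forall X Y : cx, chain X Y -> Hom der_cat X Y;
  loc_lin : forall (X Y : cx) (c : k) (f g h : chain X Y),
    (forall p i, h p i = c *: f p i + g p i) -> loc h = c *: loc f + loc g;
  loc1 : forall X, loc (chain1 X) = idm X;
  loc_mul : forall X Y Z (f : chain X Y) (g : chain Y Z),
    loc (chain_mul f g) = loc g \oc loc f;
  loc_qis : forall X Y (s : chain X Y), quasi_iso s -> invertible (loc s);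
  loc_frac : forall X Y (h : Hom der_cat X Y),
    exists (X' : cx) (s : chain X' X) (f : chain X' Y),
      quasi_iso s /\ h \oc loc s = loc f;
  loc_eq0 : forall X Y (f : chain X Y),
    loc f = 0 <-> exists (X' : cx) (s : chain X' X),
      quasi_iso s /\ null_homotopic (chain_mul s f) }.

Record shift_functor (D : derived_category) := ShiftFunctor {
  sh : lfunctor (der_cat D) (der_cat D) (@shift k Q);
  sh_loc : forall X Y (f : chain X Y), fmap sh (loc D f) = loc D (chain_shift f) }.

(* The Auslander-Reiten translation tau of D^b(mod kQ), characterised (up to  *)
(* natural isomorphism) by the Auslander-Reiten formula                       *)
(*   Hom(X, Y[1]) = D Hom(Y, tau X), naturally in X and Y,                    *)
(* where D is the k-dual.                                                     *)
Record ar_translation (D : derived_category) (S : shift_functor D) :=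
  ARTranslation {
  tau_obj : cx -> cx;
  tau : lfunctor (der_cat D) (der_cat D) tau_obj;
  ar : forall X Y,
    Hom (der_cat D) X (shift Y) -> Hom (der_cat D) Y (tau_obj X) -> k;
  ar_linl : forall X Y c (f f' : Hom (der_cat D) X (shift Y))
      (g : Hom (der_cat D) Y (tau_obj X)),
    ar (c *: f + f') g = c * ar f g + ar f' g;
  ar_linr : forall X Y c (f : Hom (der_cat D) X (shift Y))
      (g g' : Hom (der_cat D) Y (tau_obj X)),
    ar f (c *: g + g') = c * ar f g + ar f g';
  ar_dual : forall X Y (w : {linear Hom (der_cat D) Y (tau_obj X) -> k^o}),
    exists! f : Hom (der_cat D) X (shift Y), forall g, ar f g = w g;
  ar_natl : forall X X' Y (u : Hom (der_cat D) X' X)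
      (f : Hom (der_cat D) X (shift Y)) (g : Hom (der_cat D) Y (tau_obj X')),
    ar (f \oc u) g = ar f (fmap tau u \oc g);
  ar_natr : forall X Y Y' (h : Hom (der_cat D) Y Y')
      (f : Hom (der_cat D) X (shift Y)) (g : Hom (der_cat D) Y' (tau_obj X)),
    ar (fmap (sh S) h \oc f) g = ar f (g \oc h) }.

(* The cluster category C_Q: the orbit category of D^b(mod kQ) by the         *)
(* autoequivalence F = tau^-1 [1], i.e. tau F = [1].                          *)
Record cluster_category := ClusterCategory {
  cl_der : derived_category;
  cl_shift : shift_functor cl_der;
  cl_tau : ar_translation cl_shift;
  cl_F : autoequiv (der_cat cl_der);
  cl_FE : natiso (lfunctor_comp (tau cl_tau) (fw cl_F)) (sh cl_shift);
  cl_orb : orbit_category cl_F }.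

Definition cl_cat (C : cluster_category) : lincat k cx := orb_cat (cl_orb C).

(* the image in C_Q of a morphism of modules *)
Definition cl_mod (C : cluster_category) (M N : rep k Q) (f : rhom M N) :
    Hom (cl_cat C) (stalk M) (stalk N) :=
  fmap (orb_proj (cl_orb C)) (loc (cl_der C) (stalk_chain f)).

Section ClusterTilting.
Variables (C : cluster_category) (I : finType).

(* Ext^1(T, T) is Hom(T, T[1]).                                               *)
Definition cluster_tilting (T : dsum (cl_cat C) I) : Prop :=
  [/\ forall i, indecomposable (cl_cat C) (T i),
      forall i j, i != j -> ~ isomorphic (cl_cat C) (T i) (T j)
    & forall f : Hom (cl_cat C) (total T) (shift (total T)), f = 0].

Definition is_mutation (r : I) (T T' : dsum (cl_cat C) I) : Prop :=
  [/\ forall j, j != r -> T' j = T j,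
      ~ isomorphic (cl_cat C) (T' r) (T r)
    & cluster_tilting T'].

End ClusterTilting.
End Cluster.

(* The linearly oriented quiver n -> n-1 -> ... -> 1; its vertex i + 1 is     *)
(* i : 'I_n, and a : 'I_n.-1 is the arrow from a + 2 to a + 1.                *)

Section LinearAn.
Variables (k : fieldType) (n : nat).

Fact An_src_subproof (a : 'I_n.-1) : (a.+1 < n)%N.
Proof. by rewrite -ltn_predRL. Qed.

Definition linear_An : quiver :=
  @Quiver 'I_n 'I_n.-1 (fun a => Ordinal (An_src_subproof a))
                       (fun a => widen_ord (leq_pred n) a).

(* the indecomposable projective P_i, with (P_i)_j = k for j <= i and 0       *)
(* otherwise, all arrows j+1 -> j with j+1 <= i acting as the identity        *)
Definition Pdim (i j : 'I_n) : nat := (j <= i)%N.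
Definition P_An (i : 'I_n) : rep k linear_An :=
  @Rep k linear_An (Pdim i) (fun=> const_mx 1).

(* the inclusion P_(a+1) -> P_(a+2) corresponding to the arrow a *)
Fact P_incl_subproof (a : arrow linear_An) (b : arrow linear_An) :
  rmap (P_An (tgt a)) b *m const_mx 1
  = const_mx 1 *m rmap (P_An (src a)) b.
Proof.
have const_mx1M m p q :
    (const_mx 1 : 'M[k]_(m, p)) *m (const_mx 1 : 'M_(p, q)) = const_mx p%:R.
  apply/matrixP => x y; rewrite !mxE.
  by under eq_bigr => j _ do rewrite !mxE mulr1; rewrite sumr_const card_ord.
by rewrite !const_mx1M; apply/matrixP => x y; rewrite !mxE; congr (_%:R).
Qed.
Definition P_incl (a : arrow linear_An) :
    rhom (P_An (tgt a)) (P_An (src a)) :=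
  @RHom _ _ (P_An (tgt a)) (P_An (src a)) (fun=> const_mx 1)
        (P_incl_subproof a).

Variable C : cluster_category k linear_An.

(* H^0(X) = Hom_C((+)_i P_i, X); the arrows act by composition with P_incl *)
Definition is_H0 (X : cplx k linear_An) (H : rep k linear_An) : Prop :=
  exists t : forall i : 'I_n,
      Hom (cl_cat C) (stalk (P_An i)) X -> 'rV[k]_(rdim H i),
    [/\ forall i c f g, t i (c *: f + g) = c *: t i f + t i g,
        forall i, bijective (t i)
      & forall (a : arrow linear_An) g,
          t (tgt a) (g \oc cl_mod C (P_incl a)) = t (src a) g *m rmap H a].

Definition is_mod (X : cplx k linear_An) (M : rep k linear_An) : Prop :=
  isomorphic (cl_cat C) X (stalk M).

Definition is_shifted_proj (X : cplx k linear_An) : Prop :=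
  exists P : rep k linear_An,
    rprojective P /\ isomorphic (cl_cat C) X (shift (stalk P)).

End LinearAn.

(* Ice quivers of type (n, m): q i j is the number of arrows i -> j, and the  *)
(* vertices i >= n (counted from 0) are frozen.  Arrows between frozen        *)
(* vertices are disregarded: there are none.                                  *)

Definition ice_quiver (n m : nat) (q : 'M[nat]_m) : Prop :=
  [/\ forall i, q i i = 0%N,
      forall i j, q i j = 0%N \/ q j i = 0%N
    & forall i j : 'I_m, (n <= i)%N -> (n <= j)%N -> q i j = 0%N].

Section QuiverMutation.
Variables (n m : nat) (r : 'I_m).
Implicit Types q : 'M[nat]_m.

Definition add_paths q : 'M[nat]_m := \matrix_(i, j) (q i j + q i r * q r j)%N.
Definition reverse_at q : 'M[nat]_m :=
  \matrix_(i, j) if (i == r) || (j == r) then q j i else q i j.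
Definition delete_2cycles q : 'M[nat]_m := \matrix_(i, j) (q i j - q j i)%N.
Definition forget_frozen q : 'M[nat]_m :=
  \matrix_(i, j) if (n <= i)%N && (n <= j)%N then 0%N else q i j.

Definition mutate q : 'M[nat]_m :=
  forget_frozen (delete_2cycles (reverse_at (add_paths q))).
End QuiverMutation.

Section IceQuiverOfT.
Variables (k : fieldType) (n : nat) (C : cluster_category k (linear_An n)).
Local Notation cx := (cplx k (linear_An n)).
Local Notation rp := (rep k (linear_An n)).

Definition vmut (r : 'I_n) : 'I_(n + (n + n)) := lshift (n + n) r.
Definition vfr1 (j : 'I_n) : 'I_(n + (n + n)) := rshift n (lshift n j).
Definition vfr2 (j : 'I_n) : 'I_(n + (n + n)) := rshift n (rshift n j).

Definition dimv (M : rp) (j : 'I_n) : int := (rdim M j)%:Z.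

(* numbers of arrows n+j -> r, r -> n+j, 2n+j -> r and r -> 2n+j *)
Definition frozen_arrows (q : 'M[nat]_(n + (n + n))) (r : 'I_n)
    (in1 out1 in2 out2 : 'I_n -> int) : Prop :=
  forall j, [/\ (q (vfr1 j) (vmut r))%:Z = in1 j,
                (q (vmut r) (vfr1 j))%:Z = out1 j,
                (q (vfr2 j) (vmut r))%:Z = in2 j
              & (q (vmut r) (vfr2 j))%:Z = out2 j].

(* X and X' stand for T_r and T_r'; the arrows between r and the frozen       *)
(* vertices that are not mentioned in a given case are absent.                *)
Inductive frozen_rule (q : 'M[nat]_(n + (n + n))) (r : 'I_n)
    (X X' B B' : cx) : Prop :=
| RuleModPred (M M' H' B1' B2' : rp) of
    is_mod C X M & is_mod C X' M' & rsucc M M' &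
    is_H0 C B' H' & rsplit (rsucc M') H' B1' B2' &
    frozen_arrows q r (fun=> 0) (fun j => dimv M' j - dimv B1' j)
                      (fun=> 0) (fun j => dimv M j - dimv B2' j)
| RuleModSucc (M M' H B1 B2 : rp) of
    is_mod C X M & is_mod C X' M' & rsucc M' M &
    is_H0 C B H & rsplit (rsucc M) H B1 B2 &
    frozen_arrows q r (fun j => dimv M j - dimv B1 j) (fun=> 0)
                      (fun j => dimv M' j - dimv B2 j) (fun=> 0)
| RuleShiftX' (M H H' : rp) of
    is_mod C X M & is_shifted_proj C X' & is_H0 C B H & is_H0 C B' H' &
    frozen_arrows q r (fun j => dimv M j - dimv H j) (fun=> 0)
                      (fun=> 0) (fun j => dimv M j - dimv H' j)
| RuleShiftX (M' H H' : rp) of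
    is_shifted_proj C X & is_mod C X' M' & is_H0 C B H & is_H0 C B' H' &
    frozen_arrows q r (fun=> 0) (fun j => dimv M' j - dimv H' j)
                      (fun j => dimv M' j - dimv H j) (fun=> 0).

(* q is Q_T.  The middle terms B and B' of the exchange triangles             *)
(*   T_r -> B -> T_r' -> T_r[1]  and  T_r' -> B' -> T_r -> T_r'[1]            *)
(* are the sources of the minimal right add(T/T_r)-approximations of T_r' and *)
(* of T_r.  The principal part is the opposite of the quiver of End T.        *)
Definition is_ice_quiver_of (T : dsum (cl_cat C) 'I_n)
    (q : 'M[nat]_(n + (n + n))) : Prop :=
  [/\ ice_quiver n q,
      forall r s, end_quiver T r s (q (vmut s) (vmut r))
    & forall r, exists (T' : dsum (cl_cat C) 'I_n) (B B' : cx)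
        (f : Hom (cl_cat C) B (T' r)) (f' : Hom (cl_cat C) B' (T r)),
        [/\ is_mutation r T T', min_right_approx T r f,
            min_right_approx T r f' & frozen_rule q r (T r) (T' r) B B']].

End IceQuiverOfT.

(* Main.v *)
From Stdlib Require Import Relation_Operators Classical_Prop.
From mathcomp Require Import all_boot all_order all_algebra.
From mathcomp Require Import zify.
Require Import Defs.

Set Implicit Arguments.
Unset Strict Implicit.
Unset Printing Implicit Defensive.
Import Order.TTheory GRing.Theory Num.Theory.

(** The indecomposable objects of the cluster category of [A_n] are the diagonals of a
    convex polygon with vertices [0, ..., n + 2], its cluster tilting objects are the
    triangulations, and mutation at a summand is the flip of a diagonal in the
    quadrilateral around it. In this model the ice quiver is read off from
    quadrilaterals: the arrows leaving a diagonal go to two opposite sides of its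
    quadrilateral, the arrows arriving at it come from the two other sides, and a
    frozen vertex is an arc joining two edges of the polygon, which has an arrow with
    a diagonal when it crosses two opposite sides of its quadrilateral. A flip
    exchanges the two pairs of opposite sides for the flipped diagonal and moves one
    vertex of the quadrilaterals around its four sides. Comparing the numbers of
    arrows before and after is quiver mutation ([arrows_flip], [mutate_triangulation_quiver]).

    To reach the polygon, indecomposable modules are replaced by their two-term
    projective resolutions, the standard complexes. Maps from them in the derived
    category are chain maps up to homotopy ([Pcx_loc]), so there is at most one up to
    scalars, and composites are known ([hom_lab], [dl_comp]). Any nonzero object has a
    standard summand, split off along a longest string of its cohomology
    ([longest_bar], [D_split]). The functor [F] is characterised by the
    Auslander-Reiten formula alone; this suffices to compute it on standard complexes,
    because an object is determined by where its homomorphisms go ([Serre_label],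
    [fw_Pcx]). The orbits of [F] are the diagonals, homomorphisms between them live in
    the degrees 0 and 1 of the orbit category ([Fpow_diag], [seg_obj_comp]), and an
    extension is a crossing ([hom_seg_tau]). Hence cluster tilting objects and
    triangulations correspond ([ct_tri], [tri_ct]).

    The principal part of the ice quiver counts irreducible maps, and these join a
    diagonal to the sides of its quadrilateral ([end_quiver_irred], [irred_in],
    [irred_out]). The middle terms of the exchange triangles are minimal
    approximations; they are the sums of two opposite sides ([approx_ex]). Under
    [H^0] they become sums of interval modules, and the frozen rule becomes a
    subtraction of intervals that counts the crossings of an arc ([frozen_iff]).
    All data is thus determined by quadrilaterals, which gives existence and
    uniqueness of the ice quiver as well as its behaviour under flips. *)

(** * Homomorphisms between interval representations *)

Section ThinReps.
Local Open Scope ring_scope.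
Variables (k : fieldType) (n : nat).
Local Notation Q := (linear_An n).
Local Notation rp := (rep k Q).
Implicit Types (S : nat -> bool) (M N : rp).

Lemma const_mxM (m p q : nat) (x y : k) :
  (const_mx x : 'M_(m, p)) *m (const_mx y : 'M_(p, q)) = const_mx (x * y *+ p).
Proof.
apply/matrixP => i j; rewrite !mxE.
by under eq_bigr => l _ do rewrite !mxE; rewrite sumr_const card_ord.
Qed.

Lemma mx_empty (p q : nat) (A B : 'M[k]_(p, q)) : (p == 0)%N || (q == 0)%N -> A = B.
Proof.
by case/orP=> /eqP e; subst; apply/matrixP => i j; [case: i | case: j].
Qed.

Lemma bool_mx (p q : nat) (b b' : bool) (A : 'M[k]_(p, q)) : p = b -> q = b' ->
  A = const_mx (\sum_i \sum_j A i j).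
Proof.
move=> e e'; subst p q; case: b b' A => [] [] A;
  try by apply: mx_empty.
by apply/matrixP => i j; rewrite !big_ord1 !mxE !ord1.
Qed.

Lemma const_mx1_bool (p : nat) (b : bool) : p = b -> 1%:M = const_mx 1 :> 'M[k]_p.
Proof.
move=> ->; case: b; last exact: mx_empty.
by apply/matrixP => i j; rewrite !mxE !ord1.
Qed.

Lemma const_mx_inj (p q : nat) (x y : k) : (0 < p)%N -> (0 < q)%N ->
  const_mx x = const_mx y :> 'M_(p, q) -> x = y.
Proof. by case: p => // p; case: q => // q _ _ /matrixP/(_ 0 0); rewrite !mxE. Qed.

(** The support [S] is a predicate on [nat], so that intervals can be compared by
    arithmetic without membership in ['I_n]. *)
Definition is_thin S M : Prop :=
  (forall j : 'I_n, rdim M j = S j) /\ forall a, rmap M a = const_mx 1.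

Definition thin_rep S : rp := @Rep k Q (fun j : 'I_n => S j : nat) (fun=> const_mx 1).

Lemma thin_repP S : is_thin S (thin_rep S). Proof. by []. Qed.

(** Exactly the condition under which the constant matrices commute with the
    arrows, and so form a homomorphism of thin representations. *)
Definition thin_ok S S' : Prop :=
  forall j, (j.+1 < n)%N -> S j.+1 -> S' j -> S j = S' j.+1.

Lemma thin_okP S S' M N (s : k) : is_thin S M -> is_thin S' N -> thin_ok S S' ->
  forall a, rmap M a *m const_mx s = const_mx s *m rmap N a.
Proof.
move=> [dM mM] [dN mN] ok a; rewrite mM mN !const_mxM mul1r mulr1.
have [/andP[h h']|] := boolP (S a.+1 && S' a).
  congr const_mx; congr (_ *+ _); rewrite dM dN /=.
  have lt_a : (a.+1 < n)%N by have := ltn_ord a; lia.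
  exact: (congr1 nat_of_bool (ok _ lt_a h h')).
rewrite negb_and => h; apply: mx_empty; rewrite dM dN /=.
by case/orP: h => /negPf->; rewrite ?orbT.
Qed.

Definition ivl (c d : nat) : nat -> bool := fun j => (c <= j < d)%N.

(** Along an arrow whose source meets [M] and whose target meets [N] the two
    scalars of a homomorphism agree; so a nonzero scalar propagates down to
    the lower end of [N] and up to the upper end of [M]. *)
Lemma ivl_hom (c d c' d' : nat) M N (f : rhom M N) :
  is_thin (ivl c d) M -> is_thin (ivl c' d') N -> (d <= n)%N -> (d' <= n)%N ->
  exists s : k, (forall i, f i = const_mx s) /\
    (s != 0 -> [/\ c <= c', c' < d & d <= d']%N).
Proof.
move=> [dM mM] [dN mN] dn d'n.
pose g (i : 'I_n) := \sum_x \sum_y f i x y.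
have fE i : f i = const_mx (g i) by apply: (bool_mx _ (dM i) (dN i)).
pose t (m : nat) : k := if insub m is Some i then g i else 0.
have tE (i : 'I_n) : t i = g i by rewrite /t valK.
have t0 m : t m != 0 -> ivl c d m && ivl c' d' m.
  rewrite /t; case: insubP => [i _ <- nz|]; last by rewrite eqxx.
  apply: contraR nz; rewrite negb_and => h; apply/eqP; rewrite /g.
  case/orP: h => /negPf h; last under eq_bigr => x _.
  - by have := dM i; rewrite h; case: (rdim M i) (f i) => // A _; rewrite big_ord0.
  - by have := dN i; rewrite h; case: (rdim N i) (f i) => // A _; rewrite big_ord0; over.
  - by rewrite big1.
have step j : ivl c d j.+1 -> ivl c' d' j -> t j = t j.+1.
  move=> h h'.
  have lt_j : (j < n.-1)%N by move: h; rewrite /ivl; lia.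
  pose a : arrow Q := Ordinal lt_j.
  have := rhomP f a; rewrite mM mN !fE !const_mxM.
  move/(const_mx_inj _ _); rewrite dM dN /= h h' mul1r mulr1 => /(_ isT isT).
  have -> : g (widen_ord (leq_pred n) a) = t j by rewrite -tE.
  have -> : g (Ordinal (An_src_subproof a)) = t j.+1 by rewrite -tE.
  rewrite (dM (widen_ord _ _)) (dN (Ordinal _)) /=.
  case: (boolP (ivl c d j)) => hj; case: (boolP (ivl c' d' j.+1)) => hj';
    rewrite ?mulr1n ?mulr0n // => e.
  - by apply/esym/eqP; rewrite e; apply: contraTT isT => /t0; rewrite (negPf hj') andbF.
  - by apply/eqP; rewrite -e; apply: contraTT isT => /t0; rewrite (negPf hj).
  - have /eqP-> : t j == 0 by apply: contraTT isT => /t0; rewrite (negPf hj).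
    by apply/esym/eqP; apply: contraTT isT => /t0; rewrite (negPf hj') andbF.
case: (classic (exists j, t j != 0)) => [[j0 nz]|no]; last first.
  exists 0; split=> [i|]; last by rewrite eqxx.
  rewrite fE -tE; congr const_mx; apply/eqP; apply: contraT => h.
  by case: no; exists i.
have down m : (m <= j0)%N -> (c' <= j0 - m)%N -> t (j0 - m)%N = t j0.
  elim: m => [|m IH] lem h; first by rewrite subn0.
  have e : t (j0 - m)%N = t j0 by apply: IH; lia.
  have := t0 (j0 - m)%N; rewrite e => /(_ nz) /andP[h1 h2].
  have e2 : (j0 - m = (j0 - m.+1).+1)%N by lia.
  rewrite -e e2; apply: step; rewrite -?e2 //.
  by move: h h2; rewrite /ivl; lia.
have up m : (j0 + m < d)%N -> t (j0 + m)%N = t j0.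
  elim: m => [|m IH] h; first by rewrite addn0.
  have e : t (j0 + m)%N = t j0 by apply: IH; lia.
  have := t0 (j0 + m)%N; rewrite e => /(_ nz) /andP[h1 h2].
  rewrite -e addnS; apply/esym/step => //; move: h h1; rewrite /ivl; lia.
have := t0 _ nz; rewrite /ivl => /andP[/andP[h1 h2] /andP[h3 h4]].
exists (t j0); split=> [i|_]; last first.
  have := t0 (j0 - (j0 - c'))%N; rewrite down; [|lia|lia] => /(_ nz).
  have := t0 (j0 + (d.-1 - j0))%N; rewrite up; [|lia] => /(_ nz).
  by rewrite /ivl => *; split; lia.
have [/andP[h h']|h] := boolP (ivl c d i && ivl c' d' i); last first.
  apply: mx_empty; rewrite dM dN.
  by move: h; rewrite negb_and => /orP[] /negPf->; rewrite ?orbT.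
rewrite fE -tE; congr const_mx.
move: h h'; rewrite /ivl => h h'.
case: (leqP i j0) => hi.
  have -> : (i = j0 - (j0 - i) :> nat)%N by lia.
  by rewrite down //; lia.
have -> : (i = j0 + (i - j0) :> nat)%N by lia.
by rewrite up //; lia.
Qed.

End ThinReps.

(** * Thin complexes and their chain maps *)

Section Sections.
Local Open Scope ring_scope.
Variables (k : fieldType) (n : nat).
Local Notation Q := (linear_An n).
Local Notation rp := (rep k Q).
Local Notation cx := (cplx k Q).
Implicit Types (S : int -> nat -> bool) (N : rp) (X Y Z : cx).

Lemma arrow_into (o : 'I_n) : (0 < o)%N -> exists a : arrow Q, o = src a.
Proof.
case: o => m lt_m /= m0; have lt_m' : (m.-1 < n.-1)%N by lia.
exists (Ordinal lt_m'); apply: val_inj => /=; lia.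
Qed.

Lemma arrow_outof (o : 'I_n) : (o.+1 < n)%N -> exists a : arrow Q, o = tgt a.
Proof.
case: o => m lt_m /= m0; have lt_m' : (m < n.-1)%N by lia.
by exists (Ordinal lt_m'); apply: val_inj.
Qed.

(** A vector at a vertex can be pushed down along the arrows: the projectives are
    the representations of the vertices. *)
Lemma section_ext N (o : 'I_n) (x : 'rV_(rdim N o)) :
  exists y : forall j : 'I_n, 'rV[k]_(rdim N j),
    y o = x /\ forall a : arrow Q, (a < o)%N -> y (tgt a) = y (src a) *m rmap N a.
Proof.
have [m] := ubnP (o : nat); elim: m o x => // m IH o x le_om.
have [->|o0] := posnP o.
  by exists (dfwith (fun j => (0 : 'rV[k]_(rdim N j))) x); split; [exact: dfwith_in | lia].
have [a e] := arrow_into o0; subst o.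
have lt_tm : (tgt a < m)%N by move: le_om => /=; lia.
have [y [ya yP]] := IH (tgt a) (x *m rmap N a) lt_tm.
exists (dfwith y x); split=> [|b lt_ba]; first exact: dfwith_in.
have nb : src a != tgt b by apply/eqP => /(congr1 val) /=; move: lt_ba => /=; lia.
rewrite (dfwith_out _ _ nb).
have [e|ne] := eqVneq a b; first by subst b; rewrite dfwith_in.
rewrite dfwith_out; first by apply: yP; move: lt_ba ne => /=; rewrite -val_eqE /=; lia.
by apply: contraNneq ne => /(congr1 val) /= [] e; apply/eqP/val_inj.
Qed.

Lemma cosection_ext N (o : 'I_n) (x : 'cV_(rdim N o)) :
  exists y : forall j : 'I_n, 'cV[k]_(rdim N j),
    y o = x /\ forall a : arrow Q, (o <= a)%N -> y (src a) = rmap N a *m y (tgt a).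
Proof.
have [m] := ubnP (n - o)%N; elim: m o x => // m IH o x le_om.
have [o0|o0] := leqP n o.+1.
  exists (dfwith (fun j => (0 : 'cV[k]_(rdim N j))) x); split=> [|a]; first exact: dfwith_in.
  by have := ltn_ord a; lia.
have [a e] := arrow_outof o0; subst o.
have lt_tm : (n - src a < m)%N by move: le_om o0 => /=; lia.
have [y [ya yP]] := IH (src a) (rmap N a *m x) lt_tm.
exists (dfwith y x); split=> [|b lt_ba]; first exact: dfwith_in.
have nb : tgt a != src b by apply/eqP => /(congr1 val) /=; move: lt_ba => /=; lia.
rewrite (dfwith_out _ _ nb).
have [e|ne] := eqVneq a b; first by subst b; rewrite dfwith_in.
rewrite dfwith_out; first by apply: yP; move: lt_ba ne => /=; rewrite -val_eqE /=; lia.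
by apply: contraNneq ne => /(congr1 val) /= e; apply/eqP/val_inj.
Qed.

Definition is_thin_cx S X : Prop :=
  (forall q, is_thin (S q) (X q)) /\ forall q i, diff X q i = const_mx 1.

Definition isthin X Y (f : chain X Y) : Prop := forall q i, f q i = const_mx 1.

Record cx_ok S : Prop := CxOk {
  cx_ok_hom : forall q, thin_ok n (S q) (S (q + 1));
  cx_ok_sq : forall q j, ~~ [&& S q j, S (q + 1) j & S (q + 1 + 1) j];
  cx_ok_bd : exists b : nat, forall q, (b < `|q|)%N -> forall j, S q j = false }.

Definition thin_diff S (ok : cx_ok S) (q : int) :
    rhom (thin_rep k n (S q)) (thin_rep k n (S (q + 1))) :=
  @RHom _ _ (thin_rep k n (S q)) (thin_rep k n (S (q + 1))) (fun=> const_mx 1)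
    (thin_okP 1 (thin_repP k n (S q)) (thin_repP k n (S (q + 1))) (@cx_ok_hom _ ok q)).

Fact thin_cx_sq S (ok : cx_ok S) q i :
  thin_diff ok q i *m thin_diff ok (q + 1) i = 0.
Proof.
rewrite /= const_mxM; case: (boolP (S q i && S (q + 1 + 1) i)) => [/andP[h h']|].
  by have := @cx_ok_sq _ ok q i; rewrite h h' andbT /= => /negPf->.
by rewrite negb_and => h; apply: mx_empty => /=; case/orP: h => /negPf->; rewrite ?orbT.
Qed.

Fact thin_cx_bd S (ok : cx_ok S) : exists b : nat, forall q,
  (b < `|q|)%N -> rzero (thin_rep k n (S q)).
Proof.
by have [b bP] := cx_ok_bd ok; exists b => q lt_q i /=; rewrite bP.
Qed.

Definition thin_cx S (ok : cx_ok S) : cx := Cplx (thin_cx_sq ok) (thin_cx_bd ok).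

Lemma thin_cxP S (ok : cx_ok S) : is_thin_cx S (thin_cx ok).
Proof. by []. Qed.

Lemma thin_chain S S' X Y (s : k) : is_thin_cx S X -> is_thin_cx S' Y ->
  (forall q, thin_ok n (S q) (S' q)) ->
  (forall q (j : 'I_n), S q j -> S' (q + 1) j -> S' q j = S (q + 1) j) ->
  exists f : chain X Y, forall q i, f q i = const_mx s.
Proof.
move=> [tX dX] [tY dY] ok1 ok2.
pose f q : rhom (X q) (Y q) := @RHom _ _ _ _ (fun=> const_mx s) (thin_okP s (tX q) (tY q) (ok1 q)).
have fP q i : f q i *m diff Y q i = diff X q i *m f (q + 1) i.
  rewrite /= dX dY !const_mxM mul1r mulr1.
  have [/andP[h h']|] := boolP (S q i && S' (q + 1) i).
    congr const_mx; congr (_ *+ _); rewrite (proj1 (tY q)) (proj1 (tX (q + 1))).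
    by rewrite ok2.
  rewrite negb_and => h; apply: mx_empty.
  rewrite (proj1 (tX q)) (proj1 (tY (q + 1))).
  by case/orP: h => /negPf->; rewrite ?orbT.
by exists (Chain fP).
Qed.

Lemma isthin_mul S S' S'' X Y Z (f : chain X Y) (g : chain Y Z) :
  is_thin_cx S X -> is_thin_cx S' Y -> is_thin_cx S'' Z ->
  isthin f -> isthin g ->
  (forall q (j : 'I_n), S q j -> S'' q j -> S' q j) -> isthin (chain_mul f g).
Proof.
move=> [tX _] [tY _] [tZ _] tf target_of h q i; rewrite /= tf target_of const_mxM.
have [/andP[h1 h2]|] := boolP (S q i && S'' q i).
  by rewrite (proj1 (tY q)) (h _ _ h1 h2) mul1r.
rewrite negb_and => h'; apply: mx_empty.
rewrite (proj1 (tX q)) (proj1 (tZ q)).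
by case/orP: h' => /negPf->; rewrite ?orbT.
Qed.

(** At one vertex a thin complex has at most one cohomology class in each degree;
    a nonzero constant map is a quasi-isomorphism as soon as both sides have
    their classes at the same places. *)
Lemma thin_qis S S' X Y (s : k) (f : chain X Y) :
  is_thin_cx S X -> is_thin_cx S' Y -> s != 0 ->
  (forall q i, f q i = const_mx s) ->
  (forall q (j : 'I_n), [&& S (q + 1) j, ~~ S q j & ~~ S (q + 1 + 1) j]
    = [&& S' (q + 1) j, ~~ S' q j & ~~ S' (q + 1 + 1) j]) -> quasi_iso f.
Proof.
move=> [tX dX] [tY dY] s0 fE eS p i.
rewrite !dX !dY !fE; move: (eS p i).
move: (proj1 (tX p) i) (proj1 (tX (p + 1)) i) (proj1 (tX (p + 1 + 1)) i).
move: (proj1 (tY p) i) (proj1 (tY (p + 1)) i) (proj1 (tY (p + 1 + 1)) i).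
move: (S p i) (S (p + 1) i) (S (p + 1 + 1) i).
move: (S' p i) (S' (p + 1) i) (S' (p + 1 + 1) i).
move: (rdim (X p) i) (rdim (X (p + 1)) i) (rdim (X (p + 1 + 1)) i).
move: (rdim (Y p) i) (rdim (Y (p + 1)) i) (rdim (Y (p + 1 + 1)) i).
move=> y0 y1 y2 x0 x1 x2 b0' b1' b2' b0 b1 b2 -> -> -> -> -> -> {y0 y1 y2 x0 x1 x2} e.
have c1 (a : 'rV[k]_1) (t : k) : a *m (const_mx t : 'M_1) = t *: a.
  by apply/rowP => j; rewrite !ord1 !mxE big_ord1 !mxE mulrC.
split=> [x y|y].
  case: b1 e x => e x; last by exists 0; apply: mx_empty; rewrite orbT.
  case: b0 e => e; first by move=> _ _; exists x; rewrite c1 scale1r.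
  case: b2 e => e; first by rewrite c1 scale1r => -> _; exists 0; rewrite mul0mx.
  move=> _ /esym; case: b1' e y => //; case: b0' => //; case: b2' => //= _ y.
  rewrite c1 [y]thinmx0 mul0mx => /esym/eqP; rewrite scaler_eq0 (negPf s0) /= => /eqP->.
  by exists 0; rewrite mul0mx.
case: b1' e y => e y; last by exists 0, 0; split; [rewrite mul0mx | apply: mx_empty; rewrite orbT].
case: b0' e => e.
  by move=> _; exists 0, y; rewrite !mul0mx c1 scale1r add0r.
case: b2' e => e; first by rewrite c1 scale1r => ->; exists 0, 0; rewrite !mul0mx addr0.
move=> _; case: b1 e => //; case: b0 => //; case: b2 => //= _.
by exists (s^-1 *: y), 0; rewrite c1 scalerA divff // scale1r mul0mx addr0; split=> //; apply: mx_empty.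
Qed.

Definition fam Y := forall q (j : 'I_n), 'rV[k]_(rdim (Y q) j).

(** The homomorphisms from a thin representation are the families of vectors
    compatible with the arrows; [const_mx 1] turns such a vector into a matrix with
    one row or none. *)
Lemma fam_hom N M (e : forall j : 'I_n, 'rV[k]_(rdim N j)) (S0 : nat -> bool) :
  is_thin S0 M ->
  (forall a : arrow Q, S0 (src a) ->
     e (src a) *m rmap N a = e (tgt a) *+ S0 (tgt a)) ->
  forall a : arrow Q, rmap M a *m (const_mx 1 *m e (tgt a))
    = (const_mx 1 *m e (src a)) *m rmap N a.
Proof.
move=> [dM mM] eP a; rewrite mM mulmxA const_mxM -mulmxA mulr1.
case: (boolP (S0 (src a))) => h; last by apply: mx_empty; rewrite dM (negPf h).
rewrite eP // (dM (tgt a)); case: (S0 (tgt a)); rewrite ?mulr1n ?mulr0n ?mulmx0 //.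
by rewrite (raddf0 (@const_mx _ _ _)) mul0mx.
Qed.

Lemma fam_chain S X Y (e : fam Y) : is_thin_cx S X ->
  (forall q (a : arrow Q), S q (src a) ->
     e q (src a) *m rmap (Y q) a = e q (tgt a) *+ S q (tgt a)) ->
  (forall q (j : 'I_n), S q j -> e q j *m diff Y q j = e (q + 1) j *+ S (q + 1) j) ->
  exists f : chain X Y, forall q j, f q j = const_mx 1 *m e q j.
Proof.
move=> [tX dX] e1 e2.
pose f q : rhom (X q) (Y q) := @RHom k Q (X q) (Y q) (fun j => const_mx 1 *m e q j) (fam_hom (tX q) (e1 q)).
have fP q i : f q i *m diff Y q i = diff X q i *m f (q + 1) i.
  rewrite /= dX mulmxA const_mxM mulr1 -mulmxA.
  case: (boolP (S q i)) => h; last by apply: mx_empty; rewrite (proj1 (tX q)) (negPf h).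
  rewrite e2 // (proj1 (tX (q + 1))); case: (S (q + 1) i); rewrite ?mulr0n ?mulmx0 //.
  by rewrite (raddf0 (@const_mx _ _ _)) mul0mx.
by exists (Chain fP).
Qed.

Lemma chain_fam S X Y (f : chain X Y) : is_thin_cx S X ->
  exists e : fam Y, [/\ forall q j, f q j = const_mx 1 *m e q j,
    forall q (j : 'I_n), S q j = false -> e q j = 0,
    forall q (a : arrow Q), S q (src a) ->
     e q (src a) *m rmap (Y q) a = e q (tgt a) *+ S q (tgt a) &
    forall q (j : 'I_n), S q j -> e q j *m diff Y q j = e (q + 1) j *+ S (q + 1) j].
Proof.
move=> [tX dX]; exists (fun q j => const_mx 1 *m f q j).
split=> [q j|q j h|q a h|q j h].
- rewrite mulmxA const_mxM mulr1 -{1}[f q j]mul1mx; congr (_ *m _).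
  rewrite (const_mx1_bool _ (proj1 (tX q) j)).
  apply/matrixP => x y; rewrite !mxE; have := proj1 (tX q) j.
  by case: (S q j); case: (rdim (X q) j) x y => [[]|[]].
- have := proj1 (tX q) j; rewrite h; case: (rdim (X q) j) (f q j) => // A _.
  by apply/rowP => y; rewrite !mxE big_ord0.
- rewrite -mulmxA -rhomP (proj2 (tX q)) mulmxA const_mxM (proj1 (tX q) (src a)) h mulr1.
  have := proj1 (tX q) (tgt a); case: (S q (tgt a)) => /= e; first by [].
  by rewrite mulr0n -(mul0mx _ (f q (tgt a))); congr (_ *m _); apply: mx_empty; rewrite e.
rewrite -mulmxA chainP dX mulmxA const_mxM (proj1 (tX q) j) h mulr1.
have := proj1 (tX (q + 1)) j; case: (S (q + 1) j) => /= e; first by [].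
by rewrite mulr0n -(mul0mx _ (f (q + 1) j)); congr (_ *m _); apply: mx_empty; rewrite e.
Qed.

End Sections.

(** A label stands for the module with support [lc, ld), zero if [lc = ld], placed in
    degree [lp + 2]. *)
Record label (n : nat) := Label {
  lc : nat; ld : nat; lp : int; lP : (lc <= ld <= n)%N }.

(** * Standard complexes: the resolutions of intervals *)

Section Standard.
Local Open Scope ring_scope.
Variables (k : fieldType) (n : nat).
Local Notation Q := (linear_An n).
Local Notation rp := (rep k Q).
Local Notation cx := (cplx k Q).
Implicit Types (l : label n) (N : rp) (X Y Z : cx).

Definition Pset l (q : int) (j : nat) : bool :=
  ((q == lp l + 1) && (j < lc l)%N) || ((q == lp l + 1 + 1) && (j < ld l)%N).
Definition Sset l (q : int) (j : nat) : bool :=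
  (q == lp l + 1 + 1) && (lc l <= j < ld l)%N.
Definition Jset l (q : int) (j : nat) : bool :=
  ((q == lp l + 1 + 1) && (lc l <= j)%N) || ((q == lp l + 1 + 1 + 1) && (ld l <= j)%N).

Lemma Pset_ok l : cx_ok n (Pset l).
Proof.
case: l => c d p /= cd; split=> [q|q j|]; rewrite /thin_ok /Pset /=; try lia.
by exists `|p|.+2 => q lt_q j; lia.
Qed.
Lemma Sset_ok l : cx_ok n (Sset l).
Proof.
case: l => c d p /= cd; split=> [q|q j|]; rewrite /thin_ok /Sset /=; try lia.
by exists `|p|.+2 => q lt_q j; lia.
Qed.
Lemma Jset_ok l : cx_ok n (Jset l).
Proof.
case: l => c d p /= cd; split=> [q|q j|]; rewrite /thin_ok /Jset /=; try lia.
by exists `|p|.+3 => q lt_q j; lia.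
Qed.

(** The projective resolution of the interval module with support [lc, ld),
    with this module in degree [lp + 2]. *)
Definition Pcx l : cx := thin_cx k (Pset_ok l).
Definition Scx l : cx := thin_cx k (Sset_ok l).
(** The injective resolution of the same module. *)
Definition Jcx l : cx := thin_cx k (Jset_ok l).

Lemma Pcx_thin l : is_thin_cx (Pset l) (Pcx l). Proof. exact: thin_cxP. Qed.
Lemma Scx_thin l : is_thin_cx (Sset l) (Scx l). Proof. exact: thin_cxP. Qed.
Lemma Jcx_thin l : is_thin_cx (Jset l) (Jcx l). Proof. exact: thin_cxP. Qed.

Lemma Pset1 l j : Pset l (lp l + 1) j = (j < lc l)%N.
Proof. by rewrite /Pset; lia. Qed.
Lemma Pset2 l j : Pset l (lp l + 1 + 1) j = (j < ld l)%N.
Proof. by rewrite /Pset; lia. Qed.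
Lemma Pset3 l j : Pset l (lp l + 1 + 1 + 1) j = false.
Proof. by rewrite /Pset; lia. Qed.
Lemma Pset0 l q j : q != lp l + 1 -> q != lp l + 1 + 1 -> Pset l q j = false.
Proof. by rewrite /Pset; lia. Qed.

Lemma down_ind (R : 'I_n -> Prop) (o : 'I_n) : R o ->
  (forall a : arrow Q, (a < o)%N -> R (src a) -> R (tgt a)) ->
  forall j : 'I_n, (j <= o)%N -> R j.
Proof.
move=> Ro step j; have [m] := ubnP (o - j)%N; elim: m j => // m IH j lt_m le_j.
have [/val_inj-> //|ne] := eqVneq (j : nat) o.
have lt_j : (j.+1 < n)%N by have := ltn_ord o; lia.
have [a e] := arrow_outof lt_j; subst j.
by apply: step; [| apply: IH]; move: lt_m le_j ne => /=; lia.
Qed.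

Lemma up_ind (R : 'I_n -> Prop) (o : 'I_n) : R o ->
  (forall a : arrow Q, (o <= a)%N -> R (tgt a) -> R (src a)) ->
  forall j : 'I_n, (o <= j)%N -> R j.
Proof.
move=> Ro step j; have [m] := ubnP (j - o)%N; elim: m j => // m IH j lt_m le_j.
have [/val_inj-> //|ne] := eqVneq (j : nat) o.
have lt_j : (0 < j)%N by lia.
have [a e] := arrow_into lt_j; subst j.
by apply: step; [| apply: IH]; move: lt_m le_j ne => /=; lia.
Qed.

(** [y] is a homomorphism from the interval module [0, d), given by the images
    of the basis vectors. *)
Definition is_sec d N (y : forall j : 'I_n, 'rV[k]_(rdim N j)) : Prop :=
  forall a : arrow Q, (a.+1 < d)%N -> y (tgt a) = y (src a) *m rmap N a.

Fact top_vertex_subproof d (d0 : (0 < d)%N) (dn : (d <= n)%N) : (d.-1 < n)%N.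
Proof. lia. Qed.
Definition top_vertex d (d0 : (0 < d)%N) (dn : (d <= n)%N) : 'I_n :=
  Ordinal (top_vertex_subproof d0 dn).

Lemma sec_top d N (d0 : (0 < d)%N) (dn : (d <= n)%N)
    (x : 'rV_(rdim N (top_vertex d0 dn))) :
  exists y : forall j : 'I_n, 'rV[k]_(rdim N j),
    y (top_vertex d0 dn) = x /\ is_sec d y.
Proof.
have [y [yt yP]] := section_ext x; exists y; split=> // a h; apply: yP => /=.
lia.
Qed.

(** A section of cycles is determined by its top vector, which lifts since a
    quasi-isomorphism is surjective on cohomology. *)
Lemma lift_cycle X Y (s : chain X Y) (r : int) d
    (x : forall j : 'I_n, 'rV[k]_(rdim (Y (r + 1)) j)) :
  quasi_iso s -> (d <= n)%N -> is_sec d x ->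
  (forall j : 'I_n, (j < d)%N -> x j *m diff Y (r + 1) j = 0) ->
  exists (x' : forall j : 'I_n, 'rV[k]_(rdim (X (r + 1)) j))
         (z : forall j : 'I_n, 'rV[k]_(rdim (Y r) j)),
    [/\ is_sec d x', is_sec d z &
        forall j : 'I_n, (j < d)%N -> x' j *m diff X (r + 1) j = 0 /\
        x j = x' j *m s (r + 1) j + z j *m diff Y r j].
Proof.
move=> qs dn sx xd; have [d0|d0] := posnP d.
  by exists (fun=> 0), (fun=> 0); split=> [a|a|j]; rewrite d0.
have ot : (top_vertex d0 dn < d)%N by rewrite /=; lia.
have [_ /(_ _ (xd _ ot)) [x0 [z0 [x0d e]]]] := qs r (top_vertex d0 dn).
have [x' [x't sx']] := sec_top x0; have [z [zt sz]] := sec_top z0.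
exists x', z; split=> // j lt_j.
pose R (i : 'I_n) := x' i *m diff X (r + 1) i = 0 /\
        x i = x' i *m s (r + 1) i + z i *m diff Y r i.
apply: (@down_ind R (top_vertex d0 dn)); rewrite /R ?x't ?zt //=; last lia.
move=> a lt_a [h1 h2]; rewrite sx' ?sz ?sx; try lia.
rewrite -!mulmxA !rhomP !mulmxA h1 mul0mx; split=> //.
by rewrite h2 mulmxDl.
Qed.

(** A chain map from a two-term complex is given by the images [y] and [x] of its
    basis vectors; [dfwith] extends them to all degrees without transports. *)
Definition fam2 Y (r : int) (y : forall j : 'I_n, 'rV[k]_(rdim (Y r) j))
    (x : forall j : 'I_n, 'rV[k]_(rdim (Y (r + 1)) j)) : fam Y :=
  dfwith (dfwith (fun q (j : 'I_n) => (0 : 'rV[k]_(rdim (Y q) j))) y) x.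

Lemma fam2_0 Y r y x : fam2 (Y := Y) (r := r) y x r = y.
Proof. by rewrite /fam2 dfwith_out ?dfwith_in //; lia. Qed.
Lemma fam2_1 Y r y x : fam2 (Y := Y) (r := r) y x (r + 1) = x.
Proof. by rewrite /fam2 dfwith_in. Qed.
Lemma fam2_out Y r y x q j : q != r -> q != r + 1 ->
  fam2 (Y := Y) (r := r) y x q j = 0.
Proof. by move=> h1 h2; rewrite /fam2 !dfwith_out // eq_sym. Qed.

Lemma Pcx_chain l Y (y : forall j : 'I_n, 'rV[k]_(rdim (Y (lp l + 1)) j))
    (x : forall j : 'I_n, 'rV[k]_(rdim (Y (lp l + 1 + 1)) j)) :
  is_sec (lc l) y -> is_sec (ld l) x ->
  (forall j : 'I_n, (j < lc l)%N -> y j *m diff Y _ j = x j) ->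
  (forall j : 'I_n, (j < ld l)%N -> x j *m diff Y _ j = 0) ->
  exists f : chain (Pcx l) Y, forall q j, f q j = const_mx 1 *m fam2 y x q j.
Proof.
move=> sy sx yd xd; apply: fam_chain (Pcx_thin l) _ _ => [q a|q j].
  have [->|q1] := eqVneq q (lp l + 1).
    rewrite !Pset1 fam2_0 => /= h; have -> : (a < lc l)%N by lia.
    by rewrite sy.
  have [->|q2] := eqVneq q (lp l + 1 + 1); last by rewrite Pset0.
  rewrite !Pset2 fam2_1 => /= h; have -> : (a < ld l)%N by lia.
  by rewrite sx.
have cd := lP l.
have [->|q1] := eqVneq q (lp l + 1).
  rewrite !Pset1 fam2_0 fam2_1 Pset2 => h; rewrite yd //.
  by have -> : (j < ld l)%N by lia.
have [->|q2] := eqVneq q (lp l + 1 + 1); last by rewrite Pset0.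
by rewrite Pset2 Pset3 fam2_1 => h; rewrite xd.
Qed.

Lemma Pcx_chain_data l Y (f : chain (Pcx l) Y) :
  exists (y : forall j : 'I_n, 'rV[k]_(rdim (Y (lp l + 1)) j))
         (x : forall j : 'I_n, 'rV[k]_(rdim (Y (lp l + 1 + 1)) j)),
  [/\ is_sec (lc l) y, is_sec (ld l) x,
   forall j : 'I_n, (j < lc l)%N -> y j *m diff Y _ j = x j,
   forall j : 'I_n, (j < ld l)%N -> x j *m diff Y _ j = 0 &
   forall q j, f q j = const_mx 1 *m fam2 y x q j].
Proof.
have [e [fE e0 e1 e2]] := chain_fam f (Pcx_thin l); have cd := lP l.
exists (e (lp l + 1)), (e (lp l + 1 + 1)); split.
- move=> a h; have /= := e1 (lp l + 1) a; rewrite !Pset1 => /(_ h) ->.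
  by have -> : (a < lc l)%N by lia.
- move=> a h; have /= := e1 (lp l + 1 + 1) a; rewrite !Pset2 => /(_ h) ->.
  by have -> : (a < ld l)%N by lia.
- move=> j h; have := e2 (lp l + 1) j; rewrite Pset1 Pset2 => /(_ h) ->.
  by have -> : (j < ld l)%N by lia.
- by move=> j h; have := e2 (lp l + 1 + 1) j; rewrite Pset2 Pset3 => /(_ h) ->.
move=> q j; rewrite fE; congr (_ *m _).
have [->|q1] := eqVneq q (lp l + 1); first by rewrite fam2_0.
have [->|q2] := eqVneq q (lp l + 1 + 1); first by rewrite fam2_1.
by rewrite fam2_out // e0 // Pset0.
Qed.

(** Up to homotopy, chain maps from a complex of projectives lift along
    quasi-isomorphisms: only the images of the two top basis vectors have to be
    chosen. *)
Lemma lift_qis l X Y (s : chain X Y) (f : chain (Pcx l) Y) : quasi_iso s ->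
  exists (g : chain (Pcx l) X) (h : forall q, rhom (Pcx l (q + 1)) (Y q)),
    forall q i, f (q + 1) i = g (q + 1) i *m s (q + 1) i
      + (diff (Pcx l) (q + 1) i *m h (q + 1) i + h q i *m diff Y q i).
Proof.
move=> qs; have [y [x [sy sx yd xd fE]]] := Pcx_chain_data f.
have /andP[cd dn] := lP l.
have [x' [z [sx' sz xE]]] := lift_cycle qs dn sx xd.
have [y' [w [sy' sw yE]]] : exists (y' : forall j : 'I_n, 'rV[k]_(rdim (X (lp l + 1)) j))
         (w : forall j : 'I_n, 'rV[k]_(rdim (Y (lp l)) j)),
    [/\ is_sec (lc l) y', is_sec (lc l) w &
        forall j : 'I_n, (j < lc l)%N -> y' j *m diff X _ j = x' j /\
        y j = y' j *m s _ j + z j + w j *m diff Y _ j].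
  have [c0|c0] := posnP (lc l).
    by exists (fun=> 0), (fun=> 0); split=> [a|a|j]; rewrite c0.
  have cn := leq_trans cd dn; pose o := top_vertex c0 cn.
  have oc : (o < lc l)%N by rewrite /=; lia.
  have od : (o < ld l)%N by lia.
  have [x'd xo] := xE o od.
  have [inj _] := qs (lp l + 1) o.
  have [|y0 y0E] := inj (x' o) (y o - z o) x'd.
    by rewrite mulmxBl (yd o oc) xo addrK.
  have [_ surj] := qs (lp l) o.
  have [|v [w0 [vd vE]]] := surj (y o - z o - y0 *m s _ o).
    rewrite !mulmxBl (yd o oc) -mulmxA chainP mulmxA -y0E xo.
    by rewrite addrK subrr.
  have [y' [y't sy']] := sec_top (y0 + v); have [w [wt sw]] := sec_top w0.
  exists y', w; split=> // j lt_j.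
  pose R (i : 'I_n) := y' i *m diff X _ i = x' i /\
        y i = y' i *m s _ i + z i + w i *m diff Y _ i.
  apply: (@down_ind R o); rewrite /R; [|move=> a lt_a [h1 h2]|by move: lt_j; rewrite /o /=; lia].
    rewrite y't wt mulmxDl vd addr0 -y0E; split=> //.
    have -> : y o = (y o - z o - y0 *m s _ o) + z o + y0 *m s _ o.
      by rewrite addrAC subrK subrK.
    by rewrite vE mulmxDl [LHS](ACl (4*1*3*2)).
  have [lt1 lt2] : (a.+1 < lc l)%N /\ (a.+1 < ld l)%N by move: lt_a => /=; lia.
  rewrite sy' // sw // sz // sx' // sy // -mulmxA rhomP mulmxA h1; split=> //.
  by rewrite h2 !mulmxDl -!mulmxA !rhomP.
have [||g gE] := Pcx_chain sy' sx'.
- by move=> j /yE[].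
- by move=> j /xE[].
pose hf : fam Y := fam2 w z.
have hP q : forall a : arrow Q, rmap (Pcx l (q + 1)) a *m (const_mx 1 *m hf q (tgt a))
    = (const_mx 1 *m hf q (src a)) *m rmap (Y q) a.
  apply: fam_hom (proj1 (Pcx_thin l) (q + 1)) _ => a.
  have [->|q1] := eqVneq q (lp l).
    rewrite !Pset1 /hf fam2_0 => /= h; have -> : (a < lc l)%N by lia.
    by rewrite sw.
  have [->|q2] := eqVneq q (lp l + 1).
    rewrite !Pset2 /hf fam2_1 => /= h; have -> : (a < ld l)%N by lia.
    by rewrite sz.
  by rewrite Pset0 //; apply: contra_neq q1 || apply: contra_neq q2; lia.
exists g, (fun q => @RHom k Q (Pcx l (q + 1)) (Y q) (fun j => const_mx 1 *m hf q j) (hP q)).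
move=> q i; rewrite fE gE /=.
have [h|h] := boolP (Pset l (q + 1) i); last first.
  exact: mx_empty.
rewrite [X in _ = _ + (X + _)]mulmxA const_mxM mulr1 -!mulmxA.
have -> : const_mx (Pset l (q + 1 + 1) i)%:R *m hf (q + 1) i =
  (const_mx 1 : 'cV_true) *m (hf (q + 1) i *+ Pset l (q + 1 + 1) i).
  by case: (Pset l (q + 1 + 1) i); rewrite ?mulr1n // mulr0n mulmx0 (raddf0 (@const_mx _ _ _)) mul0mx.
rewrite -!mulmxDr; congr (_ *m _); move: h.
have [->|q1] := eqVneq q (lp l).
  rewrite Pset1 Pset2 !fam2_0 /hf fam2_1 fam2_0 => h.
  have -> : (i < ld l)%N by lia.
  by have [_ ->] := yE i h; rewrite addrA mulr1n.
have [->|q2] := eqVneq q (lp l + 1).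
  rewrite Pset2 !fam2_1 /hf fam2_1 Pset3 mulr0n add0r => h.
  by have [_ ->] := xE i h.
by rewrite Pset0 //; apply: contra_neq q1 || apply: contra_neq q2; lia.
Qed.

End Standard.

(** * Summands, bricks and finite sums in linear categories *)

Section LinearCategory.
Local Open Scope ring_scope.
Variables (k : fieldType) (O : Type) (C : lincat k O).
Implicit Types X Y Z W : O.

Lemma comp0l X Y Z (f : Hom C X Y) : (0 : Hom C Y Z) \oc f = 0.
Proof.
by have := comp_linl 1 (0 : Hom C Y Z) 0 f;
  rewrite !scale1r addr0 => /eqP; rewrite -subr_eq subrr => /eqP <-.
Qed.

Lemma comp0r X Y Z (g : Hom C Y Z) : g \oc (0 : Hom C X Y) = 0.
Proof.
by have := comp_linr 1 g (0 : Hom C X Y) 0;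
  rewrite !scale1r addr0 => /eqP; rewrite -subr_eq subrr => /eqP <-.
Qed.

Lemma compDl X Y Z (g g' : Hom C Y Z) (f : Hom C X Y) :
  (g + g') \oc f = g \oc f + g' \oc f.
Proof. by have := comp_linl 1 g g' f; rewrite !scale1r. Qed.
Lemma compDr X Y Z (g : Hom C Y Z) (f f' : Hom C X Y) :
  g \oc (f + f') = g \oc f + g \oc f'.
Proof. by have := comp_linr 1 g f f'; rewrite !scale1r. Qed.
Lemma compZl X Y Z c (g : Hom C Y Z) (f : Hom C X Y) :
  (c *: g) \oc f = c *: (g \oc f).
Proof. by have := comp_linl c g 0 f; rewrite !addr0 comp0l addr0. Qed.
Lemma compZr X Y Z c (g : Hom C Y Z) (f : Hom C X Y) :
  g \oc (c *: f) = c *: (g \oc f).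
Proof. by have := comp_linr c g f 0; rewrite !addr0 comp0r addr0. Qed.
Lemma compNl X Y Z (g : Hom C Y Z) (f : Hom C X Y) : (- g) \oc f = - (g \oc f).
Proof. by rewrite -!scaleN1r compZl. Qed.
Lemma compNr X Y Z (g : Hom C Y Z) (f : Hom C X Y) : g \oc (- f) = - (g \oc f).
Proof. by rewrite -!scaleN1r compZr. Qed.
Lemma compBl X Y Z (g g' : Hom C Y Z) (f : Hom C X Y) :
  (g - g') \oc f = g \oc f - g' \oc f.
Proof. by rewrite compDl compNl. Qed.
Lemma compBr X Y Z (g : Hom C Y Z) (f f' : Hom C X Y) :
  g \oc (f - f') = g \oc f - g \oc f'.
Proof. by rewrite compDr compNr. Qed.
Lemma comp_suml (I : Type) (r : seq I) (P : pred I) X Y Z (g : I -> Hom C Y Z)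
    (f : Hom C X Y) :
  (\sum_(i <- r | P i) g i) \oc f = \sum_(i <- r | P i) (g i \oc f).
Proof.
by apply: (big_morph (fun u => u \oc f)) => [u v|]; rewrite ?compDl ?comp0l.
Qed.
Lemma comp_sumr (I : Type) (r : seq I) (P : pred I) X Y Z (g : Hom C Y Z)
    (f : I -> Hom C X Y) :
  g \oc (\sum_(i <- r | P i) f i) = \sum_(i <- r | P i) (g \oc f i).
Proof.
by apply: (big_morph (fun u => g \oc u)) => [u v|]; rewrite ?compDr ?comp0r.
Qed.

Lemma iso_refl X : isomorphic C X X.
Proof. by exists (idm X), (idm X); rewrite comp1m. Qed.
Lemma iso_sym X Y : isomorphic C X Y -> isomorphic C Y X.
Proof. by case=> f [g [gf fg]]; exists g, f. Qed.
Lemma iso_trans Y X Z : isomorphic C X Y -> isomorphic C Y Z -> isomorphic C X Z.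
Proof.
case=> f [f' [ff1 ff2]] [g [g' [gg1 gg2]]]; exists (g \oc f), (f' \oc g'); split.
  by rewrite -compmA (compmA g') gg1 comp1m.
by rewrite -compmA (compmA f) ff2 comp1m.
Qed.

Lemma zero_objP X : zero_obj C X -> forall Y (f : Hom C X Y), f = 0.
Proof. by move=> X0 Y f; rewrite -[f]compm1 X0 comp0r. Qed.
Lemma zero_objP' X : zero_obj C X -> forall Y (f : Hom C Y X), f = 0.
Proof. by move=> X0 Y f; rewrite -[f]comp1m X0 comp0l. Qed.
Lemma zero_iso X Y : isomorphic C X Y -> zero_obj C X -> zero_obj C Y.
Proof. by case=> f [g [gf fg]] X0; rewrite /zero_obj -fg (zero_objP X0 f) comp0l. Qed.

Definition retract X Y := exists (u : Hom C X Y) (v : Hom C Y X), v \oc u = idm X.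

(** Over a field that is not algebraically closed this is stronger than having a
    division ring of endomorphisms; the objects below satisfy it over any field. *)
Definition brick X : Prop := ~ zero_obj C X /\ forall f : Hom C X X, exists c, f = c *: idm X.

Lemma retract_trans X Y Z : retract X Y -> retract Y Z -> retract X Z.
Proof.
move=> [u [v vu]] [u' [v' vu']]; exists (u' \oc u), (v \oc v').
by rewrite -compmA (compmA v') vu' comp1m.
Qed.
Lemma iso_retract X Y : isomorphic C X Y -> retract X Y.
Proof. by case=> f [g [gf fg]]; exists f, g. Qed.

Lemma brick_iso X Y : isomorphic C X Y -> brick X -> brick Y.
Proof.
move=> iXY [X0 bX]; split; first by move/(zero_iso (iso_sym iXY)).
have [f [g [gf fg]]] := iXY; move=> h; have [c e] := bX (g \oc h \oc f).
exists c; rewrite -[h]comp1m -[idm Y \oc h]compm1 -fg.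
have -> : f \oc g \oc h \oc (f \oc g) = f \oc (g \oc h \oc f) \oc g by rewrite !compmA.
by rewrite e compZr compZl compm1 fg.
Qed.

Lemma brick_indec X : brick X -> indecomposable C X.
Proof.
move=> bX; split=> [|S iS]; first by case: bX.
have [_ bS] := brick_iso (iso_sym iS) bX.
have [c e] := bS (inj S true \oc prj S true).
have [c0|c0] := eqVneq c 0.
  exists true; rewrite /zero_obj -(prj_inj S) -[inj S true]compm1 -(prj_inj S true).
  by rewrite (compmA (inj S true)) e c0 scale0r comp0l comp0r.
exists false; rewrite /zero_obj -(prj_inj S).
have -> : inj S false = c^-1 *: ((c *: idm _) \oc inj S false).
  by rewrite compZl scalerA mulVf // scale1r comp1m.
by rewrite -e -compmA prj_inj0 // comp0r scaler0 comp0r.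
Qed.

Lemma sum_zero_iso (S : dsum C bool) b : zero_obj C (S b) -> isomorphic C (S (~~ b)) (total S).
Proof.
move=> S0; exists (inj S (~~ b)), (prj S (~~ b)); split; first exact: prj_inj.
rewrite -(inj_prj S) (bigD1 (~~ b)) //= big1 ?addr0 // => i ne.
have -> : i = b by case: (b) (i) ne => [] [].
by rewrite (zero_objP S0 (inj S b)) comp0l.
Qed.

Lemma indec_sum_iso (S : dsum C bool) X : indecomposable C X ->
  isomorphic C (total S) X -> ~ zero_obj C (S true) -> isomorphic C X (S true).
Proof.
move=> [_ iX] iS nz; have [[//|S0]] := iX S iS.
by apply: iso_trans (iso_sym iS) _; apply: iso_sym; apply: (sum_zero_iso S0).
Qed.

Lemma mk_sum2 X Y T (i1 : Hom C X T) (i2 : Hom C Y T) (p1 : Hom C T X) (p2 : Hom C T Y) :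
  p1 \oc i1 = idm X -> p2 \oc i2 = idm Y -> p2 \oc i1 = 0 -> p1 \oc i2 = 0 ->
  i1 \oc p1 + i2 \oc p2 = idm T ->
  exists S : dsum C bool, [/\ S true = X, S false = Y & total S = T].
Proof.
move=> e1 e2 e3 e4 e5; pose F (b : bool) := if b then X else Y.
pose ii (b : bool) : Hom C (F b) T := if b as b return Hom C (F b) T then i1 else i2.
pose pp (b : bool) : Hom C T (F b) := if b as b return Hom C T (F b) then p1 else p2.
have k1 b : pp b \oc ii b = idm (F b) by case: b.
have k2 b c : b != c -> pp c \oc ii b = 0 by case: b c => [] [].
have k3 : \sum_b ii b \oc pp b = idm T by rewrite big_bool.
by exists (DSum k1 k2 k3).
Qed.

Lemma sum2_swap (S : dsum C bool) X : isomorphic C X (S false) ->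
  exists S' : dsum C bool, [/\ S' true = X, S' false = S true & total S' = total S].
Proof.
move=> [f [g [gf fg]]].
apply: (@mk_sum2 _ _ _ (inj S false \oc f) (inj S true) (g \oc prj S false) (prj S true)).
- by rewrite -compmA (compmA (prj S false)) prj_inj comp1m.
- exact: prj_inj.
- by rewrite compmA prj_inj0 // comp0l.
- by rewrite -compmA prj_inj0 // comp0r.
by rewrite -compmA (compmA f) fg comp1m addrC -(inj_prj S) big_bool.
Qed.

(** Summands are added one at a time, so the statement is about an enumeration first;
    the index type is recovered at the end. *)
Lemma dsum_seq (has0 : exists X, zero_obj C X)
    (has2 : forall X Y, exists S : dsum C bool, S true = X /\ S false = Y)
    (I : finType) (F : I -> O) : exists S : dsum C I, forall i, S i = F i.
Proof.
suff [T [u [v [h1 h2 h3]]]] : exists T (u : forall i, Hom C (F i) T) (v : forall i, Hom C T (F i)),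
    [/\ forall i, v i \oc u i = idm _, forall i j, i != j -> v j \oc u i = 0 &
     \sum_i u i \oc v i = idm T].
  by exists (DSum h1 h2 h3).
have : uniq (enum I) by exact: enum_uniq.
suff H (s : seq I) : uniq s -> exists T (u : forall i, Hom C (F i) T) (v : forall i, Hom C T (F i)),
    [/\ forall i, i \in s -> v i \oc u i = idm _, forall i j, i != j -> v j \oc u i = 0 &
     \sum_(i <- s) u i \oc v i = idm T].
  move=> /H[T [u [v [h1 h2 h3]]]]; exists T, u, v; split=> //.
    by move=> i; apply: h1; rewrite mem_enum.
  by rewrite -h3 big_enum.
elim: s => [_|x s IH /= /andP[xs us]].
  have [Z Z0] := has0; exists Z, (fun=> 0), (fun=> 0); split=> // [i j _|].
    by rewrite comp0l.
  by rewrite big_nil Z0.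
have [T [u [v [h1 h2 h3]]]] := IH us.
have [S [S1 S2]] := has2 (F x) T; case: S S1 S2 => W s0 i0 p0 pi pi0 /= + S1 S2; rewrite big_bool /= => ip.
move: (i0 true) (p0 true) (i0 false) (p0 false) (pi true) (pi false)
  (pi0 true false isT) (pi0 false true isT) ip.
rewrite S1 S2 => ix px iT pT pix piT pxT pTx ip.
pose d (P : O -> Type) i (a : P (F x)) (b : P (F i)) : P (F i) :=
  match x =P i with ReflectT e => eq_rect x (fun j => P (F j)) a i e | _ => b end.
have dx P a b : d P x a b = a.
  by rewrite /d; case: eqP => // e; rewrite (eq_irrelevance e (erefl x)).
have dn P i a b : x != i -> d P i a b = b by rewrite /d; case: eqP.
pose us' i := if i \in s then u i else 0.
pose vs' i := if i \in s then v i else 0.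
exists W, (fun i => d (fun Z => Hom C Z W) i ix (iT \oc us' i)),
  (fun i => d (fun Z => Hom C W Z) i px (vs' i \oc pT)); split.
- move=> i; rewrite inE; have [->|ne /= ins] := eqVneq i x; first by rewrite !dx.
  rewrite !dn ?(eq_sym x) // /us' /vs' ins -!compmA (compmA pT) piT comp1m; exact: h1.
- move=> i j ne; have [e|ni] := eqVneq x i; have [e'|nj] := eqVneq x j.
  + by rewrite -e e' eqxx in ne.
  + by subst i; rewrite dx dn // -compmA pxT comp0r.
  + by subst j; rewrite dx dn // compmA pTx comp0l.
  rewrite !dn // -!compmA (compmA pT) piT comp1m /us' /vs'.
  by case: ifP; case: ifP; rewrite ?comp0l ?comp0r ?h2.
rewrite big_cons !dx -ip; congr (_ + _).
rewrite -[pT in RHS]comp1m -h3 comp_suml comp_sumr.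
apply: eq_big_seq => i ins; have ne : x != i by apply: contraNneq xs => ->.
by rewrite !dn // /us' /vs' ins !compmA.
Qed.

End LinearCategory.

Section Functors.
Local Open Scope ring_scope.
Variables (k : fieldType) (O O' : Type) (C : lincat k O) (D : lincat k O').
Variables (o : O -> O') (F : lfunctor C D o).

Lemma fmapD X Y (f g : Hom C X Y) : fmap F (f + g) = fmap F f + fmap F g.
Proof. by have := fmap_lin F 1 f g; rewrite !scale1r. Qed.
Lemma fmap0 X Y : fmap F (0 : Hom C X Y) = 0.
Proof.
have := fmapD (0 : Hom C X Y) 0; rewrite addr0 => /eqP.
by rewrite -subr_eq subrr => /eqP <-.
Qed.
Lemma fmapZ X Y c (f : Hom C X Y) : fmap F (c *: f) = c *: fmap F f.
Proof. by have := fmap_lin F c f 0; rewrite !addr0 fmap0 addr0. Qed.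
Lemma fmap_sum (I : Type) (r : seq I) (P : pred I) X Y (f : I -> Hom C X Y) :
  fmap F (\sum_(i <- r | P i) f i) = \sum_(i <- r | P i) fmap F (f i).
Proof. by apply: (big_morph (fun u => fmap F u)) => [u v|]; rewrite ?fmapD ?fmap0. Qed.

Lemma fmap_iso X Y : isomorphic C X Y -> isomorphic D (o X) (o Y).
Proof.
by case=> f [g [gf fg]]; exists (fmap F f), (fmap F g); rewrite -!fmap_comp gf fg !fmap1.
Qed.
Lemma fmap_retract X Y : retract C X Y -> retract D (o X) (o Y).
Proof. by case=> u [v vu]; exists (fmap F u), (fmap F v); rewrite -fmap_comp vu fmap1. Qed.
Lemma fmap_zero X : zero_obj C X -> zero_obj D (o X).
Proof. by move=> X0; rewrite /zero_obj -(fmap1 F) X0 fmap0. Qed.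

Lemma fmap_dsum (I : finType) (S : dsum C I) :
  exists S' : dsum D I, total S' = o (total S) /\ forall i, S' i = o (S i).
Proof.
have h1 i : fmap F (prj S i) \oc fmap F (inj S i) = idm _ by rewrite -fmap_comp prj_inj fmap1.
have h2 i j : i != j -> fmap F (prj S j) \oc fmap F (inj S i) = 0.
  by move=> ne; rewrite -fmap_comp prj_inj0 // fmap0.
have h3 : \sum_i fmap F (inj S i) \oc fmap F (prj S i) = idm _.
  by under eq_bigr => i _ do rewrite -fmap_comp; rewrite -fmap_sum inj_prj fmap1.
by exists (DSum h1 h2 h3).
Qed.
End Functors.

(** * Homomorphisms between standard complexes in the derived category *)

Section Derived.
Local Open Scope ring_scope.
Variables (k : fieldType) (n : nat).
Local Notation Q := (linear_An n).
Local Notation rp := (rep k Q).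
Local Notation cx := (cplx k Q).
Implicit Types (l m : label n) (N : rp) (X Y Z : cx).

Lemma quasi_iso1 X : quasi_iso (chain1 X).
Proof.
move=> p i; split=> [x y _|y yd] /=.
  by rewrite mulmx1 => ->; exists y.
by exists y, 0; rewrite mulmx1 mul0mx addr0.
Qed.

Lemma chain_sub X Y (f g : chain X Y) :
  exists h : chain X Y, forall p i, h p i = f p i - g p i.
Proof.
have hP p (a : arrow Q) : rmap (X p) a *m (f p (tgt a) - g p (tgt a))
    = (f p (src a) - g p (src a)) *m rmap (Y p) a.
  by rewrite mulmxBr mulmxBl !rhomP.
pose h p : rhom (X p) (Y p) := @RHom k Q (X p) (Y p) (fun i => f p i - g p i) (hP p).
have hC p i : h p i *m diff Y p i = diff X p i *m h (p + 1) i.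
  by rewrite /= mulmxBr mulmxBl !chainP.
by exists (Chain hC).
Qed.

Lemma mulmx_empty (p q r : nat) (A : 'M[k]_(p, q)) (B : 'M_(q, r)) : q = 0%N ->
  A *m B = 0.
Proof. by move=> q0; subst q; rewrite [A]thinmx0 mul0mx. Qed.

Lemma homotopy_comp (p0 p1 p2 x1 x2 y0 y1 : nat) (f1 : 'M[k]_(p1, y1))
    (t1 : 'M_(p1, x1)) (s1 : 'M_(x1, p1)) (dP1 : 'M_(p1, p2)) (ht1 : 'M_(p2, p1))
    (ht0 : 'M_(p1, p0)) (dP0 : 'M_(p0, p1)) (dX1 : 'M_(x1, x2)) (h1 : 'M_(x2, y1))
    (h0 : 'M_(x1, y0)) (dY : 'M_(y0, y1)) (t2 : 'M_(p2, x2)) (f0 : 'M_(p0, y0)) :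
  s1 *m f1 = dX1 *m h1 + h0 *m dY -> 1%:M = t1 *m s1 + (dP1 *m ht1 + ht0 *m dP0) ->
  t1 *m dX1 = dP1 *m t2 -> f0 *m dY = dP0 *m f1 ->
  f1 = dP1 *m (t2 *m h1 + ht1 *m f1) + (t1 *m h0 + ht0 *m f0) *m dY.
Proof.
move=> e1 e2 c1 c2; rewrite -{1}[f1]mul1mx e2 !mulmxDl -!mulmxA e1 c2.
by rewrite !mulmxDr !mulmxA c1 !addrA [LHS](ACl (1*3*2*4)).
Qed.

Variable D : derived_category k Q.
Local Notation DC := (der_cat D).

Lemma loc_ext X Y (f g : chain X Y) : (forall p i, f p i = g p i) -> loc D f = loc D g.
Proof.
move=> e; rewrite (@loc_lin _ _ D X Y 0 f g f) ?scale0r ?add0r // => p i.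
by rewrite scale0r add0r.
Qed.

Lemma loc_0 X Y (f : chain X Y) : (forall p i, f p i = 0) -> loc D f = 0.
Proof.
move=> e; have : loc D f = 1 *: loc D f + loc D f.
  by apply: loc_lin => p i; rewrite !e scaler0 addr0.
by rewrite scale1r => /eqP; rewrite -subr_eq subrr => /eqP <-.
Qed.

Lemma loc_scale X Y (f g : chain X Y) s :
  (forall p i, f p i = s *: g p i) -> loc D f = s *: loc D g.
Proof.
move=> e; have [z zE] := chain_sub f f.
rewrite (@loc_lin _ _ D X Y s g z f); last by move=> p i; rewrite zE e subrr addr0.
by rewrite (@loc_0 _ _ z) ?addr0 // => p i; rewrite zE subrr.
Qed.

Lemma loc_null X Y (f : chain X Y) : null_homotopic f -> loc D f = 0.
Proof.
move=> [h hP]; apply/loc_eq0; exists X, (chain1 X); split; first exact: quasi_iso1.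
by exists h => p i; rewrite /= mul1mx.
Qed.

Lemma loc_homotopic X Y (f g : chain X Y) (h : forall q, rhom (X (q + 1)) (Y q)) :
  (forall q i, f (q + 1) i = g (q + 1) i
      + (diff X (q + 1) i *m h (q + 1) i + h q i *m diff Y q i)) ->
  loc D f = loc D g.
Proof.
move=> hP; have [d dE] := chain_sub f g.
rewrite (@loc_lin _ _ D X Y 1 d g f); last by move=> p i; rewrite dE scale1r subrK.
rewrite loc_null ?scaler0 ?add0r //; exists h => p i.
by rewrite dE hP addrAC subrr add0r.
Qed.

(** Complexes of projectives need no fractions. *)
Lemma Pcx_loc l Y (h : Hom DC (Pcx k l) Y) : exists f : chain (Pcx k l) Y, h = loc D f.
Proof.
have [X [s [f [qs e]]]] := loc_frac h.
have [t [ht htP]] := lift_qis (chain1 (Pcx k l)) qs.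
exists (chain_mul t f); rewrite loc_mul -e -compmA -loc_mul.
have <- : loc D (chain1 (Pcx k l)) = loc D (chain_mul t s).
  by apply: (loc_homotopic (h := ht)).
by rewrite loc1 compm1.
Qed.

(** Likewise a quasi-isomorphism that kills [f] up to homotopy has a section up to
    homotopy. *)
Lemma Pcx_loc0 l Y (f : chain (Pcx k l) Y) : loc D f = 0 -> null_homotopic f.
Proof.
move/loc_eq0 => [X [s [qs [h hP]]]].
have [t [ht htP]] := lift_qis (chain1 (Pcx k l)) qs.
have hh q (a : arrow Q) : rmap (Pcx k l (q + 1)) a *m
    (t (q + 1) (tgt a) *m h q (tgt a) + ht q (tgt a) *m f q (tgt a))
  = (t (q + 1) (src a) *m h q (src a) + ht q (src a) *m f q (src a)) *m rmap (Y q) a.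
  by rewrite mulmxDr mulmxDl !mulmxA !rhomP -!mulmxA !rhomP.
exists (fun q => @RHom k Q (Pcx k l (q + 1)) (Y q)
  (fun i => t (q + 1) i *m h q i + ht q i *m f q i) (hh q)) => p i /=.
have e1 : s (p + 1) i *m f (p + 1) i
    = diff X (p + 1) i *m h (p + 1) i + h p i *m diff Y p i := hP p i.
have e2 : 1%:M = t (p + 1) i *m s (p + 1) i
    + (diff (Pcx k l) (p + 1) i *m ht (p + 1) i + ht p i *m diff (Pcx k l) p i) := htP p i.
exact: homotopy_comp e1 e2 (chainP t (p + 1) i) (chainP f p i).
Qed.

(** Two adjacent degrees carry homomorphisms: those of modules, from [l] to [m], and
    the extensions of [l] by [m]. *)
Definition hom_lab l m : bool :=
  ((lp m == lp l) && [&& lc l <= lc m, lc m < ld l & ld l <= ld m]%N) ||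
  ((lp m + 1 == lp l) && [&& lc m < lc l, lc l <= ld m & ld m < ld l]%N).

(** A chain map to the module [Scx] is a single scalar; when there is no homomorphism
    of labels it vanishes or factors through the differential. *)
Lemma loc_PScx l m (f : chain (Pcx k l) (Scx k m)) :
  (~~ hom_lab l m -> loc D f = 0) /\
  (forall g : chain (Pcx k l) (Scx k m), isthin g -> exists s, loc D f = s *: loc D g).
Proof.
have [tP dP] := Pcx_thin k l; have [tS dS] := Scx_thin k m.
have z q (i : 'I_n) : Sset m q i = false -> forall A B : 'M[k]_(rdim (Pcx k l q) i, rdim (Scx k m q) i), A = B.
  by move=> e A B; apply: mx_empty; rewrite (proj1 (tS q) i) e orbT.
have /andP[cd dn] := lP l; have /andP[cd' dn'] := lP m.
have eS : is_thin (ivl (lc m) (ld m)) (Scx k m (lp m + 1 + 1)).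
  by have [h1 h2] := tS (lp m + 1 + 1); split=> // j; rewrite h1 /Sset eqxx.
suff [s [fE sP]] : exists s, (forall q i, f q i = const_mx s) /\
    (~~ hom_lab l m -> s = 0 \/ loc D f = 0).
  split=> [/sP[s0|//]|g target_of]; last first.
    by exists s; apply: loc_scale => q i; rewrite fE target_of; apply/matrixP => x y; rewrite !mxE mulr1.
  by apply: loc_0 => p i; rewrite fE s0; apply/matrixP => x y; rewrite !mxE.
have [e|ne] := eqVneq (lp m) (lp l).
  have eP : is_thin (ivl 0 (ld l)) (Pcx k l (lp m + 1 + 1)).
    by have [h1 h2] := tP (lp m + 1 + 1); split=> // j; rewrite h1 e Pset2.
  have [s [fE sP]] := ivl_hom (f (lp m + 1 + 1)) eP eS dn dn'.
  exists s; split=> [q i|nH].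
    have [->//|nq] := eqVneq q (lp m + 1 + 1); apply: z.
    by rewrite /Sset (negPf nq).
  left; apply/eqP; apply: contraNT nH => /[dup] s0 /sP[_ h1 h2].
  rewrite /hom_lab e eqxx h1 h2 andbT /= andbT; apply/orP; left; rewrite leqNgt.
  apply: contra s0 => h; have hn : (lc m < n)%N by lia.
  have := chainP f (lp m + 1) (Ordinal hn); rewrite fE dP const_mxM mul1r.
  rewrite mulmx_empty; last by rewrite (proj1 (tS (lp m + 1))) /Sset; lia.
  have -> : rdim (Pcx k l (lp m + 1 + 1)) (Ordinal hn) = 1%N.
    by rewrite (proj1 (tP _)) e Pset2 /=; lia.
  rewrite mulr1n -(raddf0 (@const_mx _ _ _)) => /const_mx_inj -> //.
    by rewrite (proj1 (tP _)) e Pset1 /= h.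
  by rewrite (proj1 (tS _)) /Sset /=; lia.
have [e|ne'] := eqVneq (lp m + 1) (lp l); last first.
  exists 0; split=> [q i|_]; last right.
    by apply: mx_empty; rewrite (proj1 (tS q) i) (proj1 (tP q) i) /Sset /Pset; lia.
  by apply: loc_0 => q i; apply: mx_empty; rewrite (proj1 (tS q) i) (proj1 (tP q) i) /Sset /Pset; lia.
have eP : is_thin (ivl 0 (lc l)) (Pcx k l (lp m + 1 + 1)).
  by have [h1 h2] := tP (lp m + 1 + 1); split=> // j; rewrite h1 e Pset1.
have [s [fE sP]] := ivl_hom (f (lp m + 1 + 1)) eP eS (leq_trans cd dn) dn'.
have fE' q i : f q i = const_mx s.
  have [->//|nq] := eqVneq q (lp m + 1 + 1); apply: z.
  by rewrite /Sset (negPf nq).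
exists s; split=> // nH.
have [->|s0] := eqVneq s 0; first by left.
right; have [_ h1 h2] := sP s0; apply: loc_null.
have dd : (ld l <= ld m)%N.
  by rewrite leqNgt; apply: contra nH => h; rewrite /hom_lab; lia.
have ok q : thin_ok n (Pset l (q + 1)) (Sset m q).
  by move=> j; rewrite /Pset /Sset; lia.
exists (fun q => @RHom k Q (Pcx k l (q + 1)) (Scx k m q) (fun=> const_mx s)
  (thin_okP s (tP (q + 1)) (tS q) (@ok q))) => q i /=.
rewrite fE'; have [eq|nq] := eqVneq q (lp m + 1); last first.
  by apply: mx_empty; rewrite /= /Sset; lia.
subst q; rewrite [X in _ = _ + X]mulmx_empty ?addr0; last by rewrite /= /Sset; lia.
have [h|h] := boolP (i < lc l)%N; last first.
  by apply: mx_empty; rewrite /= /Pset; lia.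
rewrite const_mxM mul1r.
have -> // : Pset l (lp m + 1 + 1 + 1) i = true by rewrite /Pset; lia.
Qed.

Lemma sigma l : exists g : chain (Pcx k l) (Scx k l), isthin g /\ quasi_iso g.
Proof.
have cd := lP l.
have [||g gE] := @thin_chain k n _ _ _ _ 1 (Pcx_thin k l) (Scx_thin k l).
- by move=> q j; rewrite /Pset /Sset; lia.
- by move=> q j; rewrite /Pset /Sset; lia.
exists g; split=> //.
apply: (thin_qis (Pcx_thin k l) (Scx_thin k l) (oner_neq0 _) gE) => q j.
by rewrite /Pset /Sset; lia.
Qed.

Lemma Dhom_ex l m : hom_lab l m -> exists e : chain (Pcx k l) (Pcx k m), isthin e.
Proof.
have cd := lP l; have cd' := lP m; rewrite /hom_lab => h.
have [||e eE] := @thin_chain k n _ _ _ _ 1 (Pcx_thin k l) (Pcx_thin k m).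
- by move=> q j; rewrite /Pset; lia.
- by move=> q j; rewrite /Pset; lia.
by exists e.
Qed.

Lemma Dhom0 l m : ~~ hom_lab l m -> forall f : Hom DC (Pcx k l) (Pcx k m), f = 0.
Proof.
move=> nH f; have [g [target_of qg]] := sigma m.
have [g' [g'g _]] := loc_qis D qg.
have [a ea] := Pcx_loc (loc D g \oc f).
have [/(_ nH) a0 _] := loc_PScx a.
by rewrite -[f]comp1m -g'g -compmA ea a0 comp0r.
Qed.

Lemma thin_PScx l m (e : chain (Pcx k l) (Pcx k m)) (g : chain (Pcx k m) (Scx k m)) :
  hom_lab l m -> isthin e -> isthin g -> isthin (chain_mul e g).
Proof.
move=> h te target_of; apply: (isthin_mul (Pcx_thin k l) (Pcx_thin k m) (Scx_thin k m)) => // q j.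
by have := lP l; have := lP m; move: h; rewrite /hom_lab /Pset /Sset; lia.
Qed.

Lemma Dhom_span l m (e : chain (Pcx k l) (Pcx k m)) : hom_lab l m -> isthin e ->
  forall f : Hom DC (Pcx k l) (Pcx k m), exists s, f = s *: loc D e.
Proof.
move=> h te f; have [g [target_of qg]] := sigma m.
have [g' [g'g _]] := loc_qis D qg.
have [a ea] := Pcx_loc (loc D g \oc f).
have [_ /(_ _ (thin_PScx h te target_of)) [s es]] := loc_PScx a.
exists s; rewrite -[f]comp1m -g'g -compmA ea es compZr loc_mul compmA g'g.
by rewrite comp1m.
Qed.

(** Composed with the quasi-isomorphism to the module, a null-homotopy would be a
    homomorphism of intervals that does not exist. *)
Lemma Dhom_nz l m (e : chain (Pcx k l) (Pcx k m)) : hom_lab l m -> isthin e ->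
  loc D e <> 0.
Proof.
move=> h te e0; have [g [target_of _]] := sigma m.
have t := thin_PScx h te target_of.
have [|hh hP] := @Pcx_loc0 _ _ (chain_mul e g); first by rewrite loc_mul e0 comp0r.
have [tP dP] := Pcx_thin k l; have [tS dS] := Scx_thin k m.
have /andP[cd dn] := lP l; have /andP[cd' dn'] := lP m.
have c'n : (lc m < n)%N by move: h; rewrite /hom_lab; lia.
have := hP (lp m + 1) (Ordinal c'n); rewrite t.
rewrite [X in _ = _ + X]mulmx_empty ?addr0; last first.
  by rewrite (proj1 (tS _)) /Sset; lia.
have [e1|ne] := eqVneq (lp m) (lp l).
  rewrite mulmx_empty; last by rewrite (proj1 (tP _)) e1 Pset3.
  rewrite -(raddf0 (@const_mx _ _ _)) => /const_mx_inj /eqP.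
  rewrite oner_eq0 => hf; suff: false by []; apply: hf.
    by rewrite (proj1 (tP _)) /Pset; move: h; rewrite /hom_lab /=; lia.
  by rewrite (proj1 (tS _)) /Sset /=; move: h; rewrite /hom_lab /=; lia.
have e2 : lp m + 1 = lp l by move: h; rewrite /hom_lab; lia.
have eP : is_thin (ivl 0 (ld l)) (Pcx k l (lp m + 1 + 1 + 1)).
  by have [h1 h2] := tP (lp m + 1 + 1 + 1); split=> // j; rewrite h1 e2 Pset2.
have eS : is_thin (ivl (lc m) (ld m)) (Scx k m (lp m + 1 + 1)).
  by have [h1 h2] := tS (lp m + 1 + 1); split=> // j; rewrite h1 /Sset eqxx.
have [s [-> sP]] := ivl_hom (hh (lp m + 1 + 1)) eP eS dn dn'.
have [->|/sP[_ h1 h2]] := eqVneq s 0; last by move: h; rewrite /hom_lab; lia.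
rewrite dP const_mxM mul1r mul0rn.
move=> /const_mx_inj /eqP.
rewrite oner_eq0 => hf; suff: false by []; apply: hf.
  by rewrite (proj1 (tP _)) /Pset; move: h; rewrite /hom_lab /=; lia.
by rewrite (proj1 (tS _)) /Sset /=; move: h; rewrite /hom_lab /=; lia.
Qed.

Lemma Dcomp l1 l2 l3 (e : chain (Pcx k l1) (Pcx k l2)) (f : chain (Pcx k l2) (Pcx k l3)) :
  hom_lab l1 l2 -> hom_lab l2 l3 -> hom_lab l1 l3 -> isthin e -> isthin f ->
  isthin (chain_mul e f).
Proof.
move=> h12 h23 h13 te tf.
apply: (isthin_mul (Pcx_thin k l1) (Pcx_thin k l2) (Pcx_thin k l3)) => // q j.
by move: h12 h23 h13; rewrite /hom_lab /Pset; have := lP l1; have := lP l2; have := lP l3; lia.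
Qed.

End Derived.

(** * Twisted sums and mapping cones *)

Section TwistedSums.
Local Open Scope ring_scope.
Variables (k : fieldType) (Q : quiver).
Local Notation rp := (rep k Q).
Local Notation cx := (cplx k Q).
Implicit Types (M N : rp) (X Y Z : cx).

Definition rep_add M N : rp :=
  @Rep k Q (fun i => rdim M i + rdim N i)%N
    (fun a => block_mx (rmap M a) 0 0 (rmap N a)).

Fact block_hom_subproof M N M' N' (f : rhom M M') (t : rhom M N') (g : rhom N N') a :
  rmap (rep_add M N) a *m block_mx (f (tgt a)) (t (tgt a)) 0 (g (tgt a))
  = block_mx (f (src a)) (t (src a)) 0 (g (src a)) *m rmap (rep_add M' N') a.
Proof.
by rewrite !mulmx_block !mulmx0 !mul0mx !add0r !addr0 !rhomP.
Qed.
Definition block_hom M N M' N' (f : rhom M M') (t : rhom M N') (g : rhom N N') :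
    rhom (rep_add M N) (rep_add M' N') :=
  @RHom k Q (rep_add M N) (rep_add M' N') (fun i => block_mx (f i) (t i) 0 (g i))
        (block_hom_subproof f t g).

Section Tsum.
Variables (X Y : cx) (t : forall q, rhom (X q) (Y (q + 1))).
Hypothesis tP : forall q i, diff X q i *m t (q + 1) i + t q i *m diff Y (q + 1) i = 0.

Fact tsum_sq q i : block_hom (diff X q) (t q) (diff Y q) i
  *m block_hom (diff X (q + 1)) (t (q + 1)) (diff Y (q + 1)) i = 0.
Proof.
by rewrite /= mulmx_block !diff_sq !mulmx0 !mul0mx !addr0 tP block_mx0.
Qed.
Fact tsum_bd : exists b : nat, forall q, (b < `|q|)%N -> rzero (rep_add (X q) (Y q)).
Proof.
have [b bX] := cplx_bounded X; have [c cY] := cplx_bounded Y.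
exists (maxn b c) => q; rewrite gtn_max => /andP[h h'] i /=.
by rewrite (bX _ h) (cY _ h').
Qed.
(** Both the mapping cone and the direct sum of two complexes are of this form. *)
Definition tsum : cx := Cplx tsum_sq tsum_bd.
End Tsum.

Definition zero_twist X Y (q : int) : rhom (X q) (Y (q + 1)) := rhom0 _ _.
Fact zero_twistP X Y q i :
  diff X q i *m zero_twist X Y (q + 1) i + zero_twist X Y q i *m diff Y (q + 1) i = 0.
Proof. by rewrite /= mulmx0 mul0mx addr0. Qed.
Definition cplx_add X Y : cx := tsum (@zero_twistP X Y).

Definition cone_twist X Y (f : chain X Y) (q : int) : rhom (shift X q) (Y (q + 1)) :=
  f (q + 1).
Fact cone_twistP X Y (f : chain X Y) q i :
  diff (shift X) q i *m cone_twist f (q + 1) i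
  + cone_twist f q i *m diff Y (q + 1) i = 0.
Proof. by rewrite /= /cone_twist mulNmx chainP addNr. Qed.
Definition cone X Y (f : chain X Y) : cx := tsum (cone_twistP f).

(** A chain map [f : P -> X] with a retraction [v] up to quasi-isomorphism splits
    off: [X] is the sum of [J] and the cone of [f]. *)
Lemma split_qis P X J (f : chain P X) (v : chain X J) : quasi_iso (chain_mul f v) ->
  exists w : chain X (cplx_add (cone f) J), quasi_iso w.
Proof.
move=> qfv; pose w0 q i : 'M[k]_(rdim (X q) i, rdim (cplx_add (cone f) J q) i) :=
  row_mx (row_mx 0 1%:M) (v q i).
have wh q (a : arrow Q) : rmap (X q) a *m w0 q (tgt a)
    = w0 q (src a) *m rmap (cplx_add (cone f) J q) a.
  rewrite /w0 /= !mul_mx_row !mul_row_block !mul0mx !mulmx0 !addr0 !add0r.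
  by rewrite mulmx1 mul1mx rhomP.
pose w q : rhom (X q) (cplx_add (cone f) J q) := RHom (wh q).
have wC q i : w q i *m diff (cplx_add (cone f) J) q i = diff X q i *m w (q + 1) i.
  rewrite /= /w0 /= !mul_mx_row !mul_row_block !mul0mx !mulmx0 !addr0 !add0r.
  by rewrite mulmx1 mul1mx chainP.
exists (Chain wC) => p i; split=> [x|].
  rewrite /= => y xd; rewrite -[y]hsubmxK -[lsubmx y]hsubmxK.
  move: (lsubmx (lsubmx y)) (rsubmx (lsubmx y)) (rsubmx y) => a x0 j {y}.
  rewrite /w0 /= !mul_mx_row !mul_row_block !mulmx0 !addr0 mulmx1 mulmxN add0r /cone_twist.
  move=> /eq_row_mx[/eq_row_mx[ad xE] jE].
  have [/(_ a (j - x0 *m v p i)) inj _] := qfv p i.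
  have [||a' a'E] := inj.
  - by apply/eqP; rewrite -oppr_eq0 -ad.
  - by rewrite /= mulmxBl -jE xE mulmxDl -!mulmxA chainP addrK.
  exists (a' *m f p i + x0); rewrite xE a'E mulmxDl -!mulmxA chainP.
  by [].
move=> y; rewrite -[y]hsubmxK -[lsubmx y]hsubmxK.
move: (lsubmx (lsubmx y)) (rsubmx (lsubmx y)) (rsubmx y) => a x j {y}.
rewrite /= !mul_row_block !mulmx0 !addr0 add0r mulmxN /cone_twist.
move=> e; have := e; rewrite -[0]hsubmxK => /eq_row_mx[+ jd].
rewrite -[lsubmx 0]hsubmxK => /eq_row_mx[ad xd].
rewrite !raddf0 in ad xd jd.
have ad0 : a *m diff P (p + 1 + 1) i = 0 by apply/eqP; rewrite -oppr_eq0 ad.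
have [/(_ a (- x *m v (p + 1) i)) inj _] := qfv (p + 1) i.
have [//||b bE] := inj.
  rewrite /= !mulNmx -[in RHS]mulmxA chainP !mulmxA; apply/eqP.
  by rewrite -subr_eq0 opprK -mulmxDl xd mul0mx.
have [_ /(_ (j - (x + b *m f (p + 1) i) *m v (p + 1) i)) surj] := qfv p i.
have cyc : (x + b *m f (p + 1) i) *m diff X (p + 1) i = 0.
  by rewrite mulmxDl -mulmxA chainP mulmxA -bE [LHS]addrC.
have [|c [j0 [cd cE]]] := surj.
  by rewrite mulmxBl jd -mulmxA chainP mulmxA cyc mul0mx subr0.
exists (x + b *m f (p + 1) i + c *m f (p + 1) i).
exists (row_mx (row_mx (- b - c) 0) j0); split.
  by rewrite mulmxDl cyc -mulmxA chainP mulmxA cd mul0mx addr0.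
rewrite /w0 /= !mul_mx_row !mul_row_block !mul0mx !mulmx0 !addr0 mulmx1 !add_row_mx !add0r.
congr row_mx; [congr row_mx|].
- by rewrite mulmxN mulmxBl cd subr0 mulNmx opprK.
- by rewrite -opprD mulNmx mulmxDl -(addrA x) addrK.
rewrite mulmxDl -addrA -mulmxA -cE [RHS]addrC.
by rewrite subrK.
Qed.

End TwistedSums.

Section DerivedSums.
Local Open Scope ring_scope.
Variables (k : fieldType) (n : nat).
Local Notation Q := (linear_An n).
Variable (D : derived_category k Q).
Local Notation DC := (der_cat D).
Implicit Types (l m : label n) (X Y Z : cplx k Q).

Lemma D_zero_thin l : lc l = ld l -> zero_obj DC (Pcx k l).
Proof.
move=> e; rewrite /zero_obj -loc1; apply: loc_null.
have [tP dP] := Pcx_thin k l.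
have ok q : thin_ok n (Pset l (q + 1)) (Pset l q) by move=> j; rewrite /Pset; lia.
exists (fun q => @RHom k Q (Pcx k l (q + 1)) (Pcx k l q) (fun=> const_mx 1)
  (thin_okP 1 (tP (q + 1)) (tP q) (@ok q))) => q i /=.
rewrite !const_mxM (const_mx1_bool _ (erefl (nat_of_bool (Pset l (q + 1) i)))).
apply/matrixP => x y; rewrite !mxE; have : Pset l (q + 1) i by case: (Pset l (q + 1) i) x => // [[]].
rewrite mulr1 -mulrnDr => h.
have -> // : (Pset l (q + 1 + 1) i + Pset l q i = 1)%N.
by move: h; rewrite /Pset e; lia.
Qed.

Lemma D_has0 : exists X, zero_obj DC X.
Proof.
have l0 : (0 <= 0 <= n)%N by [].
by exists (Pcx k (Label 0 l0)); apply: D_zero_thin.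
Qed.

(** The map to the zero complex is a quasi-isomorphism. *)
Lemma acyclic_zero X :
  (forall p i (x : 'rV_(rdim (X (p + 1)) i)), x *m diff X (p + 1) i = 0 ->
     exists y, x = y *m diff X p i) -> zero_obj DC X.
Proof.
move=> ac; have [Z Z0] := D_has0; pose z : cplx k Q := stalk (rep0 k Q).
have z0 (p : int) (i : 'I_n) : rdim (z p) i = 0%N by rewrite /= /stalk_term; case: ifP.
have hC p i : rhom0 (X p) (z p) i *m diff z p i = diff X p i *m rhom0 (X (p + 1)) (z (p + 1)) i.
  by rewrite /= mul0mx mulmx0.
have qz : quasi_iso (Chain hC).
  move=> p i; split=> [x y /ac //|y _].
  by exists 0, 0; split; [rewrite mul0mx | apply: mx_empty; rewrite z0 orbT].
have [g [gf fg]] := loc_qis D qz.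
by rewrite /zero_obj -gf (@loc_0 _ _ D _ _ (Chain hC)) ?comp0r.
Qed.

Lemma D_sum2 X Y : exists S : dsum DC bool,
  [/\ S true = X, S false = Y & total S = cplx_add X Y].
Proof.
pose T := cplx_add X Y.
have h1 q (a : arrow Q) : rmap (X q) a *m (row_mx 1%:M 0 : 'M_(_, rdim (T q) (tgt a)))
   = (row_mx 1%:M 0 : 'M_(_, rdim (T q) (src a))) *m rmap (T q) a.
  by rewrite /= mul_mx_row mul_row_block mulmx1 !mul1mx !mulmx0 mul0mx !addr0.
have h2 q (a : arrow Q) : rmap (Y q) a *m (row_mx 0 1%:M : 'M_(_, rdim (T q) (tgt a)))
   = (row_mx 0 1%:M : 'M_(_, rdim (T q) (src a))) *m rmap (T q) a.
  by rewrite /= mul_mx_row mul_row_block mulmx1 !mul1mx !mulmx0 !mul0mx !add0r.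
have h3 q (a : arrow Q) : rmap (T q) a *m (col_mx 1%:M 0 : 'M_(rdim (T q) (tgt a), rdim (X q) (tgt a)))
   = (col_mx 1%:M 0 : 'M_(rdim (T q) (src a), rdim (X q) (src a))) *m rmap (X q) a.
  by rewrite /= mul_block_col mul_col_mx !mulmx1 !mul1mx !mulmx0 !mul0mx !addr0.
have h4 q (a : arrow Q) : rmap (T q) a *m (col_mx 0 1%:M : 'M_(rdim (T q) (tgt a), rdim (Y q) (tgt a)))
   = (col_mx 0 1%:M : 'M_(rdim (T q) (src a), rdim (Y q) (src a))) *m rmap (Y q) a.
  by rewrite /= mul_block_col mul_col_mx !mulmx1 !mul1mx !mulmx0 !mul0mx !add0r.
pose r1 q : rhom (X q) (T q) := @RHom k Q (X q) (T q) (fun i => row_mx 1%:M 0) (h1 q).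
pose r2 q : rhom (Y q) (T q) := @RHom k Q (Y q) (T q) (fun i => row_mx 0 1%:M) (h2 q).
pose r3 q : rhom (T q) (X q) := @RHom k Q (T q) (X q) (fun i => col_mx 1%:M 0) (h3 q).
pose r4 q : rhom (T q) (Y q) := @RHom k Q (T q) (Y q) (fun i => col_mx 0 1%:M) (h4 q).
have c1 q i : r1 q i *m diff T q i
    = diff X q i *m r1 (q + 1) i.
  by rewrite /= mul_mx_row mul_row_block mulmx1 !mul1mx !mulmx0 mul0mx !addr0.
have c2 q i : r2 q i *m diff T q i
    = diff Y q i *m r2 (q + 1) i.
  by rewrite /= mul_mx_row mul_row_block mulmx1 !mul1mx !mulmx0 !mul0mx !add0r.
have c3 q i : r3 q i *m diff X q i
    = diff T q i *m r3 (q + 1) i.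
  by rewrite /= mul_block_col mul_col_mx !mulmx1 !mul1mx !mulmx0 !mul0mx !addr0.
have c4 q i : r4 q i *m diff Y q i
    = diff T q i *m r4 (q + 1) i.
  by rewrite /= mul_block_col mul_col_mx !mulmx1 !mul1mx !mulmx0 !mul0mx !add0r.
pose i1 := loc D (Chain c1); pose i2 := loc D (Chain c2).
pose p1 := loc D (Chain c3); pose p2 := loc D (Chain c4).
have e1 : p1 \oc i1 = idm X.
  rewrite -loc_mul -loc1; apply: loc_ext => p i.
  by rewrite /= mul_row_col mulmx1 mulmx0 addr0.
have e2 : p2 \oc i2 = idm Y.
  rewrite -loc_mul -loc1; apply: loc_ext => p i.
  by rewrite /= mul_row_col mulmx1 mulmx0 add0r.
have e3 : p2 \oc i1 = 0.
  by rewrite -loc_mul; apply: loc_0 => p i; rewrite /= mul_row_col mulmx0 mul0mx addr0.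
have e4 : p1 \oc i2 = 0.
  by rewrite -loc_mul; apply: loc_0 => p i; rewrite /= mul_row_col mulmx0 mul0mx addr0.
have e5 : i1 \oc p1 + i2 \oc p2 = idm T.
  rewrite -!loc_mul -[loc D (chain_mul (Chain c3) _)]scale1r -loc1; apply/esym.
  apply: loc_lin => p i; rewrite /= scale1r !mul_col_mx !mul1mx !mul0mx.
  by rewrite add_col_mx addr0 add0r scalar_mx_block.
exact: (mk_sum2 e1 e2 e3 e4 e5).
Qed.

End DerivedSums.

(** * Splitting a standard complex off an object *)

Section Splitting.
Local Open Scope ring_scope.
Variables (k : fieldType) (n : nat).
Local Notation Q := (linear_An n).
Local Notation rp := (rep k Q).
Local Notation cx := (cplx k Q).
Implicit Types (l m : label n) (N : rp) (X Y Z : cx).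

(** With [ker_factor], the duality between subspaces and functionals that makes bars
    split. *)
Lemma sep_functional (p q : nat) (A : 'M[k]_(p, q)) (x : 'rV_q) :
  ~ (exists y, x = y *m A) -> exists v : 'cV_q, A *m v = 0 /\ x *m v = 1%:M.
Proof.
move=> nx; have : x *m cokermx A != 0.
  by apply/negP => h; have /submxP[y e] : (x <= A)%MS; [rewrite submxE | apply: nx; exists y].
move=> h; have [j hj] : exists j, (x *m cokermx A) 0 j != 0.
  apply/existsP; apply: contraR h; rewrite negb_exists => /forallP h.
  by apply/eqP/rowP => j; rewrite [RHS]mxE; apply/eqP; rewrite -[_ == _]negbK.
move: hj; set t := _ 0 j => hj.
exists (t^-1 *: (cokermx A *m delta_mx j 0)); split.
  by rewrite -scalemxAr (mulmxA A) mulmx_coker mul0mx scaler0.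
rewrite -scalemxAr (mulmxA x) -colE; apply/matrixP => a b; rewrite !ord1.
by rewrite [LHS]mxE [X in _ * X]mxE [RHS]mxE -/t mulVf.
Qed.

Lemma ker_factor (p q : nat) (A : 'M[k]_(p, q)) (v : 'cV_p) :
  (forall z : 'rV_p, z *m A = 0 -> z *m v = 0) -> exists w, v = A *m w.
Proof.
move=> h; have kv : kermx A *m v = 0.
  apply/row_matrixP => i; rewrite row_mul row0; apply: h.
  by rewrite -row_mul mulmx_ker row0.
have : (v^T <= A^T)%MS.
  rewrite submxE -trmx_eq0 trmx_mul trmxK.
  have /submxP[B ->] : ((cokermx A^T)^T <= kermx A)%MS.
    by apply/sub_kermxP; rewrite -[A in _ *m A]trmxK -trmx_mul mulmx_coker trmx0.
  by rewrite -mulmxA kv mulmx0.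
by case/submxP => w e; exists w^T; rewrite -[v]trmxK e trmx_mul trmxK.
Qed.

Definition boundary X p (i : 'I_n) (x : 'rV[k]_(rdim (X (p + 1)) i)) : Prop :=
  exists y, x = y *m diff X p i.

(** A homomorphism from the projective [0, d) to the cycles whose class lives down to
    the vertex [c]: a nonzero string of the cohomology. *)
Definition bar X p c d : Prop :=
  (c < d <= n)%N /\
  exists x : forall j : 'I_n, 'rV[k]_(rdim (X (p + 1)) j),
    [/\ is_sec d x, forall j : 'I_n, (j < d)%N -> x j *m diff X (p + 1) j = 0 &
        exists2 j : 'I_n, j = c :> nat & ~ boundary (x j)].

Lemma bar_start X p (i : 'I_n) (x : 'rV[k]_(rdim (X (p + 1)) i)) :
  x *m diff X (p + 1) i = 0 -> ~ boundary x -> bar X p i i.+1.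
Proof.
move=> xd nx; have [y [yi yP]] := section_ext x.
split; first by have := ltn_ord i; lia.
exists y; split=> [a h|j h|]; last by exists i => //; rewrite yi.
  by apply: yP; lia.
apply: (@down_ind n (fun j => y j *m diff X (p + 1) j = 0) i); rewrite ?yi //.
by move=> a ha e; rewrite yP // -mulmxA rhomP mulmxA e mul0mx.
Qed.

Lemma bar_max X p : (exists c d, bar X p c d) ->
  exists c d, bar X p c d /\ forall c' d', bar X p c' d' -> (d' - c' <= d - c)%N.
Proof.
move=> [c [d b]]; have [m] := ubnP (n - (d - c))%N.
elim: m c d b => // m IH c d b lt_m.
case: (classic (exists c' d', bar X p c' d' /\ (d - c < d' - c')%N)) => [[c' [d' [b' h]]]|no].
  by apply: (IH c' d' b'); have [/andP[]] := b; have [/andP[]] := b'; lia.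
exists c, d; split=> // c' d' b'; rewrite leqNgt; apply/negP => h.
by apply: no; exists c', d'.
Qed.

(** A longest bar [c, d) of the cohomology in degree [p + 1]: the section
    [x] spans it, and the functional [f] splits it off. Because the bar is longest,
    below [c] the class of [x] dies and above [d] every functional that
    factors through [c] kills the cycles. *)
Lemma longest_bar X p : (exists c d, bar X p c d) ->
  exists c d (x : forall j : 'I_n, 'rV[k]_(rdim (X (p + 1)) j))
         (f : forall j : 'I_n, 'cV[k]_(rdim (X (p + 1)) j)),
  [/\ (c < d <= n)%N,
      is_sec d x /\ (forall j : 'I_n, (j < d)%N -> x j *m diff X (p + 1) j = 0),
      forall j : 'I_n, (j < c)%N -> boundary (x j),
      [/\ forall a : arrow Q, (c <= a)%N -> f (src a) = rmap (X (p + 1)) a *m f (tgt a),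
       forall j : 'I_n, (c <= j)%N -> diff X p j *m f j = 0 &
       forall j : 'I_n, (d <= j)%N -> exists g, f j = diff X (p + 1) j *m g] &
      forall j : 'I_n, (c <= j < d)%N -> x j *m f j = 1%:M].
Proof.
move=> /bar_max[c [d [[/andP[cd dn] [x [sx xd [o oc nx]]]] mx]]].
have [f0 [f01 f02]] := sep_functional nx.
have [f [fo fP]] := cosection_ext f0.
have fP' (a : arrow Q) : (c <= a)%N -> f (src a) = rmap (X (p + 1)) a *m f (tgt a).
  by move=> h; apply: fP; rewrite oc.
have fd : forall j : 'I_n, (c <= j)%N -> diff X p j *m f j = 0.
  move=> j; rewrite -oc; apply: (@up_ind n (fun j => diff X p j *m f j = 0)); first by rewrite fo f01.
  by move=> a h e; rewrite fP // mulmxA -rhomP -mulmxA e mulmx0.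
have prop d' (z : forall j : 'I_n, 'rV[k]_(rdim (X (p + 1)) j)) : is_sec d' z ->
  forall j : 'I_n, (c <= j)%N -> (j < d')%N -> z j *m f j = z o *m f o.
  move=> sz j; rewrite -oc => h.
  apply: (@up_ind n (fun j => (j < d')%N -> z j *m f j = z o *m f o) o) h => // a h IH lt_a.
  by rewrite fP // mulmxA -sz // IH //; move: lt_a => /=; lia.
exists c, d, x, f; split=> //; first by rewrite cd.
- have below (o' : 'I_n) : o'.+1 = c -> boundary (x o').
    move=> e; apply: NNPP => nb.
    have : bar X p o' d by split; [lia | exists x; split=> //; exists o'].
    by move/mx; lia.
  move=> j jc; have c0 : (0 < c)%N by lia.
  have cn : (c <= n)%N by lia.
  apply: (@down_ind n (fun j => boundary (x j)) (top_vertex c0 cn)).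
  + by apply: below => /=; lia.
  + move=> a h [y e]; exists (y *m rmap (X p) a); rewrite sx; last by move: h => /=; lia.
    by rewrite e -!mulmxA rhomP.
  by rewrite /=; lia.
- split=> // j dj; have dn' : (d < n)%N by have := ltn_ord j; lia.
  apply: (@up_ind n (fun j => exists g, f j = diff X (p + 1) j *m g) (Ordinal dn')) dj.
    apply: ker_factor => z zd.
    have [zz [zo sz]] := section_ext z.
    have sz' : is_sec d.+1 zz by move=> a h; apply: sz => /=; lia.
    have cyc (j' : 'I_n) : (j' <= Ordinal dn')%N -> zz j' *m diff X (p + 1) j' = 0.
      apply: (@down_ind n (fun j => zz j *m diff X (p + 1) j = 0)); first by rewrite zo.
      by move=> a h e; rewrite sz // -mulmxA rhomP mulmxA e mul0mx.
    have := prop _ _ sz' (Ordinal dn'); rewrite zo /= => -> //; [|lia].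
    have : boundary (zz o).
      apply: NNPP => nb; have : bar X p c d.+1.
        by split; [lia | exists zz; split=> //; exists o].
      by move/mx; lia.
    by case=> y ->; rewrite -mulmxA fd ?mulmx0 ?oc.
  move=> a h [g e]; exists (rmap (X (p + 1 + 1)) a *m g).
  by rewrite fP' ?e; [rewrite !mulmxA rhomP | move: h => /=; lia].
by move=> j /andP[h1 h2]; rewrite (prop _ _ sx) // fo f02.
Qed.

(** Dual to [Pcx_chain]: maps to the injectives are functionals at the lowest
    vertices of their supports. *)
Lemma Jcx_chain l Y (f : forall j : 'I_n, 'cV[k]_(rdim (Y (lp l + 1 + 1)) j))
    (g : forall j : 'I_n, 'cV[k]_(rdim (Y (lp l + 1 + 1 + 1)) j)) :
  (forall a : arrow Q, (lc l <= a)%N -> f (src a) = rmap (Y _) a *m f (tgt a)) ->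
  (forall a : arrow Q, (ld l <= a)%N -> g (src a) = rmap (Y _) a *m g (tgt a)) ->
  (forall j : 'I_n, (lc l <= j)%N -> diff Y _ j *m f j = 0) ->
  (forall j : 'I_n, (ld l <= j)%N -> f j = diff Y _ j *m g j) ->
  exists v : chain Y (Jcx k l), forall j, v (lp l + 1 + 1) j = f j *m const_mx 1.
Proof.
move=> sf sg fd gd; have cd := lP l; have [tJ dJ] := Jcx_thin k l.
pose e : forall q (j : 'I_n), 'cV[k]_(rdim (Y q) j) :=
  dfwith (dfwith (fun q (j : 'I_n) => (0 : 'cV[k]_(rdim (Y q) j))) f) g.
have e1 : e (lp l + 1 + 1) = f by rewrite /e dfwith_out ?dfwith_in //; lia.
have e2 : e (lp l + 1 + 1 + 1) = g by rewrite /e dfwith_in.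
have J1 j : Jset l (lp l + 1 + 1) j = (lc l <= j)%N by rewrite /Jset; lia.
have J2 j : Jset l (lp l + 1 + 1 + 1) j = (ld l <= j)%N by rewrite /Jset; lia.
have J0 q j : q != lp l + 1 + 1 -> q != lp l + 1 + 1 + 1 -> Jset l q j = false.
  by rewrite /Jset; lia.
have rh q (a : arrow Q) : rmap (Y q) a *m (e q (tgt a) *m const_mx 1)
    = (e q (src a) *m const_mx 1) *m rmap (Jcx k l q) a.
  rewrite (proj2 (tJ q)) -[in RHS]mulmxA const_mxM mul1r mulmxA.
  have [h|h] := boolP (Jset l q (tgt a)); last first.
    by apply: mx_empty; rewrite (proj1 (tJ q)) (negPf h) orbT.
  rewrite (proj1 (tJ q) (src a)).
  have [eq|nq] := eqVneq q (lp l + 1 + 1).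
    subst q; move: h; rewrite !J1 e1 => h.
    have -> : (lc l <= src a)%N by move: h => /=; lia.
    by rewrite sf.
  have [eq|nq'] := eqVneq q (lp l + 1 + 1 + 1); last by rewrite J0 in h.
  subst q; move: h; rewrite !J2 e2 => h.
  have -> : (ld l <= src a)%N by move: h => /=; lia.
  by rewrite sg.
pose v q : rhom (Y q) (Jcx k l q) :=
  @RHom k Q (Y q) (Jcx k l q) (fun i => e q i *m const_mx 1) (rh q).
have vC q i : v q i *m diff (Jcx k l) q i = diff Y q i *m v (q + 1) i.
  rewrite dJ /v [LHS]/= -mulmxA const_mxM mul1r mulmxA.
  have [h|h] : Jset l (q + 1) i \/ ~~ Jset l (q + 1) i by case: (Jset l (q + 1) i); [left|right].
    2: by apply: mx_empty; rewrite (proj1 (tJ (q + 1))) (negPf h) orbT.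
  have [eq|nq] := eqVneq q (lp l + 1).
    subst q; have -> : Jset l (lp l + 1) i = false by apply: J0; lia.
    have hc : (lc l <= i)%N by rewrite -J1.
    by rewrite e1 fd // mul0mx (raddf0 (@const_mx _ _ _)) mulmx0.
  have [eq|nq'] := eqVneq q (lp l + 1 + 1); last by rewrite J0 in h; lia.
  subst q; have hd : (ld l <= i)%N by rewrite -J2.
  rewrite e1 e2.
  have -> : Jset l (lp l + 1 + 1) i = true by rewrite J1; lia.
  by rewrite -gd.
by exists (Chain vC) => j; rewrite /= e1.
Qed.

Lemma split_label X : (exists p (i : 'I_n) (x : 'rV[k]_(rdim (X (p + 1)) i)),
    x *m diff X (p + 1) i = 0 /\ ~ boundary x) ->
  exists l, (lc l < ld l)%N /\ exists (f : chain (Pcx k l) X) (v : chain X (Jcx k l)),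
    isthin (chain_mul f v).
Proof.
move=> [p0 [i0 [x0 [x0d nx0]]]].
have [p e] : exists p, p0 = p + 1 by exists (p0 - 1); rewrite subrK.
subst p0; have [|c [d [x [f [cd [sx xd] xc [sf fd fg] xf]]]]] := @longest_bar X (p + 1).
  by exists i0, i0.+1; apply: bar_start x0d nx0.
have cd' : (c <= d <= n)%N by lia.
exists (Label p cd'); split; first by case/andP: cd.
have [y [sy yd]] : exists y : forall j : 'I_n, 'rV[k]_(rdim (X (p + 1)) j),
   is_sec c y /\ forall j : 'I_n, (j < c)%N -> y j *m diff X _ j = x j.
  have [c0|c0] := posnP c.
    by exists (fun=> 0); split=> [a|j]; rewrite c0.
  have cn : (c <= n)%N by lia.
  have [|y0 y0E] := xc (top_vertex c0 cn); first by rewrite /=; lia.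
  have [y [yt sy]] := sec_top y0; exists y; split=> // j jc.
  apply: (@down_ind n (fun j => y j *m diff X _ j = x j) (top_vertex c0 cn)).
  - by rewrite yt -y0E.
  - move=> a h e; rewrite sy ?sx -?mulmxA ?rhomP ?mulmxA ?e //; move: h => /=; lia.
  by rewrite /=; lia.
have [g [sg gd]] : exists g : forall j : 'I_n, 'cV[k]_(rdim (X (p + 1 + 1 + 1)) j),
   (forall a : arrow Q, (d <= a)%N -> g (src a) = rmap (X _) a *m g (tgt a)) /\
   forall j : 'I_n, (d <= j)%N -> f j = diff X _ j *m g j.
  have [dn|dn] := leqP n d.
    by exists (fun=> 0); split=> [a|j] h; [have := ltn_ord (tgt a) | have := ltn_ord j];
      move: h => /=; lia.
  have [|g0 g0E] := fg (Ordinal dn); first by [].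
  have [g [go sg]] := cosection_ext g0; exists g; split=> // j dj.
  apply: (@up_ind n (fun j => f j = diff X _ j *m g j) (Ordinal dn)) dj.
    by rewrite go.
  move=> a h e; rewrite sf ?sg ?e ?mulmxA ?rhomP //; move: h => /=; lia.
have [||u uE] := @Pcx_chain k n (Label p cd') X y x sy sx; [exact: yd | exact: xd |].
have [||||v vE] := @Jcx_chain (Label p cd') X f g; [exact: sf|exact: sg|exact: fd|exact: gd|].
exists u, v => q i; have [tP _] := Pcx_thin k (Label p cd'); have [tJ _] := Jcx_thin k (Label p cd').
have [eq|nq] := eqVneq q (p + 1 + 1); last first.
  by apply: mx_empty; rewrite (proj1 (tP q)) (proj1 (tJ q)) /Pset /Jset /=; lia.
subst q; have [/andP[h1 h2]|h] := boolP ((c <= i)%N && (i < d)%N); last first.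
  by apply: mx_empty; rewrite (proj1 (tP _)) (proj1 (tJ _)) /Pset /Jset /=; lia.
rewrite /= uE vE fam2_1 mulmxA -(mulmxA _ (x i)) xf ?h1 // mulmx1 const_mxM.
by rewrite mul1r.
Qed.

Lemma PJcx_qis l (g : chain (Pcx k l) (Jcx k l)) : isthin g -> quasi_iso g.
Proof.
move=> target_of; apply: (thin_qis (Pcx_thin k l) (Jcx_thin k l) (oner_neq0 _) target_of) => q j.
by have := lP l; rewrite /Pset /Jset; lia.
Qed.

Variable D : derived_category k Q.
Local Notation DC := (der_cat D).

(** A complex that is not acyclic has a longest bar in its cohomology, which splits
    off; an acyclic one is a zero object. In particular bricks are standard. *)
Lemma D_split X : ~ zero_obj DC X -> exists l, (lc l < ld l)%N /\
  exists S : dsum DC bool, S true = Pcx k l /\ isomorphic DC (total S) X.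
Proof.
move=> nX; have [|l [cd [f [v t]]]] := @split_label X.
  apply: NNPP => no; apply: nX; apply: acyclic_zero => p i x xd.
  by apply: NNPP => nb; apply: no; exists p, i, x.
exists l; split=> //; have q := PJcx_qis t; have [w qw] := split_qis q.
have i1 : isomorphic DC X (cplx_add (cone f) (Jcx k l)).
  by exists (loc D w); exact: loc_qis.
have i2 : isomorphic DC (Pcx k l) (Jcx k l).
  by exists (loc D (chain_mul f v)); exact: loc_qis.
have [S [_ S2 S3]] := D_sum2 D (cone f) (Jcx k l).
rewrite -S2 in i2; have [S' [S1' _ e]] := sum2_swap i2.
by exists S'; split=> //; rewrite e S3; apply: iso_sym.
Qed.

End Splitting.

(** * Autoequivalences and their action on labels *)

Section AutoEquivalences.
Local Open Scope ring_scope.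
Variables (k : fieldType) (O : Type) (D : lincat k O).

Lemma natiso_iso (O' : Type) (D' : lincat k O') (oF oG : O -> O')
    (F : lfunctor D D' oF) (G : lfunctor D D' oG) (a : natiso F G) X :
  isomorphic D' (oF X) (oG X).
Proof. by exists (ni a X), (ni_inv a X); rewrite niK ni_invK. Qed.

Lemma natiso_eq0 (oF : O -> O) (F : lfunctor D D oF) (a : natiso F (lfunctor_id D))
    X Y (f : Hom D X Y) : fmap F f = 0 -> f = 0.
Proof.
move=> f0; have := ni_nat a f; rewrite f0 comp0r => /esym e.
by rewrite -[f]compm1 -(ni_invK a) compmA [f \oc _]e comp0l.
Qed.

Variable F : autoequiv D.

Lemma fw_eq0 X Y (f : Hom D X Y) : fmap (fw F) f = 0 -> f = 0.
Proof. by move=> f0; apply: (natiso_eq0 (ae_unit F)); rewrite /= f0 fmap0. Qed.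

Lemma bw_eq0 X Y (f : Hom D X Y) : fmap (bw F) f = 0 -> f = 0.
Proof. by move=> f0; apply: (natiso_eq0 (ae_counit F)); rewrite /= f0 fmap0. Qed.

Lemma fw_full X Y (g : Hom D (fw_obj F X) (fw_obj F Y)) : exists f, fmap (fw F) f = g.
Proof.
pose h : Hom D (bw_obj F (fw_obj F X)) (bw_obj F (fw_obj F Y)) := fmap (bw F) g.
pose f : Hom D X Y := ni (ae_unit F) Y \oc h \oc ni_inv (ae_unit F) X.
exists f; apply/eqP; rewrite -subr_eq0; apply/eqP/bw_eq0.
rewrite -[X in fmap _ (_ + X)]scaleN1r fmapD fmapZ scaleN1r; apply/eqP; rewrite subr_eq0; apply/eqP.
have /= e := ni_nat (ae_unit F) f.
have kK Z : ni_inv (ae_unit F) Z \oc ni (ae_unit F) Z = idm (bw_obj F (fw_obj F Z)) :=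
  niK (ae_unit F) Z.
rewrite -[LHS]comp1m -kK -compmA e /f -!compmA kK compm1.
by rewrite compmA kK comp1m.
Qed.

Lemma fw_brick X : brick D X -> brick D (fw_obj F X).
Proof.
move=> [nz b]; split=> [z|g].
  apply: nz; apply: fw_eq0; rewrite fmap1; exact: z.
have [f <-] := fw_full g; have [c ->] := b f.
by exists c; rewrite fmapZ fmap1.
Qed.

Lemma bw_fw_iso X Y : isomorphic D (fw_obj F X) Y -> isomorphic D (bw_obj F Y) X.
Proof.
move=> h; apply: iso_trans (iso_sym (fmap_iso (bw F) h)) _.
exact: (natiso_iso (ae_unit F)).
Qed.
Lemma fw_bw_iso X : isomorphic D (fw_obj F (bw_obj F X)) X.
Proof. exact: (natiso_iso (ae_counit F)). Qed.

Lemma ae_pow_iso X Y (i : int) : isomorphic D X Y -> isomorphic D (ae_pow F i X) (ae_pow F i Y).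
Proof.
case: i => m h /=.
  by elim: m => //= m IH; apply: (fmap_iso (fw F)).
by elim: m => [|m IH]; apply: (fmap_iso (bw F)).
Qed.

End AutoEquivalences.

Section Labels.
Local Open Scope ring_scope.
Variable n : nat.
Implicit Types l m : label n.

Lemma label_eq l m : lc l = lc m -> ld l = ld m -> lp l = lp m -> l = m.
Proof.
case: l m => [c d p h] [c' d' p' h'] /= e1 e2 e3; subst.
by rewrite (bool_irrelevance h h').
Qed.

Definition shift_lab l : label n := @Label n (lc l) (ld l) (lp l - 1) (lP l).
Definition unshift_lab l : label n := @Label n (lc l) (ld l) (lp l + 1) (lP l).

Fact Fl_subproof l : ((if ld l < n then (lc l).+1 else 0)
  <= (if ld l < n then (ld l).+1 else minn (lc l).+1 n) <= n)%N.
Proof. by have := lP l; case: ifP; lia. Qed.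
(** [F] is the inverse translate followed by the shift. An interval that ends at [n]
    is injective, and its inverse translate is a shifted projective. *)
Definition F_lab l : label n :=
  @Label n _ _ (if (ld l < n)%N then lp l - 1 else lp l - 2) (Fl_subproof l).

Fact Bl_subproof l : ((if 0 < lc l then (lc l).-1 else (ld l).-1)
  <= (if 0 < lc l then (ld l).-1 else n) <= n)%N.
Proof. by have := lP l; case: ifP; lia. Qed.
Definition Finv_lab l : label n :=
  @Label n _ _ (if (0 < lc l)%N then lp l + 1 else lp l + 2) (Bl_subproof l).

Definition proper l : bool := (lc l < ld l)%N.

Lemma F_lab_proper l : proper l -> proper (F_lab l).
Proof. by have := lP l; rewrite /proper /=; case: ifP; lia. Qed.
Lemma Finv_lab_proper l : proper l -> proper (Finv_lab l).
Proof. by have := lP l; rewrite /proper /=; case: ifP; lia. Qed.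
Lemma F_labK l : proper l -> Finv_lab (F_lab l) = l.
Proof.
have := lP l; rewrite /proper => *.
by apply: label_eq => /=; case: (ltnP (ld l) n) => /=; lia.
Qed.
Lemma Finv_labK l : proper l -> F_lab (Finv_lab l) = l.
Proof.
have := lP l; rewrite /proper => *.
by apply: label_eq => /=; case: (ltnP 0 (lc l)) => /=; case: ifP; lia.
Qed.

Definition Fpow (i : int) l : label n :=
  match i with Posz m => iter m F_lab l | Negz m => iter m.+1 Finv_lab l end.
Lemma Fpow_proper i l : proper l -> proper (Fpow i l).
Proof.
move=> h; case: i => m; first by elim: m => //= m IH; apply: F_lab_proper.
by elim: m => [|m IH]; apply: Finv_lab_proper.
Qed.

(** The labels with a homomorphism from [m] form a rectangle, which determines [m]:
    [m] and the image of [m] under the Serre functor are its opposite corners. *)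
Lemma Serre_label l m : proper l -> proper m ->
  (forall v : label n, hom_lab m (shift_lab v) -> hom_lab v (shift_lab l)) -> m = F_lab l.
Proof.
have := lP l; have := lP m; rewrite /proper => m1 l1 l2 m2 h.
have h1 : hom_lab (unshift_lab m) (shift_lab l) by apply: h; rewrite /hom_lab /shift_lab /unshift_lab /=; lia.
have sP : ((if 0 < lc m then (lc m).-1 else (ld m).-1) <=
           (if 0 < lc m then (ld m).-1 else n) <= n)%N by case: ifP; lia.
pose v := @Label n _ _ (if (0 < lc m)%N then lp m else lp m + 1) sP.
have h2 : hom_lab v (shift_lab l).
  by apply: h; rewrite /hom_lab /shift_lab /v /=; case: (ltnP 0 (lc m)) => /=; lia.
move: h1 h2; rewrite /hom_lab /shift_lab /unshift_lab /v /=.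
by case: (ltnP 0 (lc m)) => /= *; apply: label_eq => /=; case: (ltnP (ld l) n) => /=; lia.
Qed.

End Labels.

(** * Shift and [F] on standard complexes *)

Section StandardObjects.
Local Open Scope ring_scope.
Variables (k : fieldType) (n : nat).
Local Notation Q := (linear_An n).
Local Notation cx := (cplx k Q).
Implicit Types (l m r : label n) (X Y Z : cx).

Lemma inv_quasi_iso X Y (f : chain X Y)
    (g : forall q i, 'M[k]_(rdim (Y q) i, rdim (X q) i)) :
  (forall q i, f q i *m g q i = 1%:M /\ g q i *m f q i = 1%:M) -> quasi_iso f.
Proof.
move=> fg; have gC q i : g q i *m diff X q i = diff Y q i *m g (q + 1) i.
  rewrite -[LHS]mulmx1 -(proj1 (fg (q + 1) i)) mulmxA -(mulmxA (g q i)) -chainP.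
  by rewrite !mulmxA (proj2 (fg q i)) mul1mx.
move=> p i; split=> [x y xd e|y yd].
  by exists (y *m g p i); rewrite -mulmxA gC mulmxA -e -mulmxA (proj1 (fg _ i)) mulmx1.
exists (y *m g (p + 1) i), 0; rewrite mul0mx addr0 -!mulmxA (proj2 (fg _ i)) mulmx1.
by rewrite gC mulmxA yd mul0mx.
Qed.

Variable D : derived_category k Q.
Local Notation DC := (der_cat D).

Lemma shift_Pcx l : isomorphic DC (shift (Pcx k l)) (Pcx k (shift_lab l)).
Proof.
have [tP dP] := Pcx_thin k l; have [tP' dP'] := Pcx_thin k (shift_lab l).
pose c (q : int) : k := if q == lp l then 1 else -1.
have c2 q : c q * c q = 1 by rewrite /c; case: ifP; rewrite ?mulr1 // mulrNN mulr1.
have e q j : Pset l (q + 1) j = Pset (shift_lab l) q j by rewrite /Pset /=; lia.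
have t1 q : is_thin (Pset (shift_lab l) q) (shift (Pcx k l) q).
  by have [h1 h2] := tP (q + 1); split=> // j; rewrite h1 e.
have ok q : thin_ok n (Pset (shift_lab l) q) (Pset (shift_lab l) q).
  by move=> j; have := lP l; rewrite /Pset /=; lia.
pose f q : rhom (shift (Pcx k l) q) (Pcx k (shift_lab l) q) :=
  @RHom k Q (shift (Pcx k l) q) (Pcx k (shift_lab l) q) (fun=> const_mx (c q))
   (thin_okP (c q) (t1 q) (tP' q) (@ok q)).
have fC q i : f q i *m diff (Pcx k (shift_lab l)) q i = diff (shift (Pcx k l)) q i *m f (q + 1) i.
  rewrite dP'.
  have -> : diff (shift (Pcx k l)) q i = - const_mx 1 by rewrite -(dP (q + 1) i).
  have -> : f q i = const_mx (c q) by [].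
  have -> : f (q + 1) i = const_mx (c (q + 1)) by [].
  rewrite mulNmx !const_mxM mulr1 mul1r -raddfN.
  have [h|h] : (q == lp l /\ (i < lc l)%N) \/ ~~ ((q == lp l) && (i < lc l)%N).
    by case: (boolP ((q == lp l) && (i < lc l)%N)) => [/andP|]; [left|right].
  2: by apply: mx_empty; rewrite (proj1 (t1 q)) (proj1 (tP' (q + 1))) /Pset /=; lia.
  case: h => /eqP eq h; congr const_mx.
  have -> : rdim (Pcx k (shift_lab l) q) i = 1%N by rewrite (proj1 (tP' q)) /Pset /=; lia.
  have -> : rdim (shift (Pcx k l) (q + 1)) i = 1%N.
    by rewrite (proj1 (t1 (q + 1))) /Pset /=; have := lP l; lia.
  rewrite !mulr1n /c eq eqxx.
  by have -> : (lp l + 1 == lp l) = false; [lia | rewrite opprK].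
exists (loc D (Chain fC)); apply: loc_qis.
apply: (@inv_quasi_iso _ _ (Chain fC) (fun q i => const_mx (c q))) => q i.
have ee : (const_mx (c q) : 'M[k]_(rdim (shift (Pcx k l) q) i, rdim (Pcx k (shift_lab l) q) i)) = f q i by [].
have e1 := proj1 (t1 q) i; have e2 := proj1 (tP' q) i.
rewrite -[Chain fC q i]ee !const_mxM c2 (const_mx1_bool _ e1) (const_mx1_bool _ e2).
split; apply/matrixP => x y; rewrite !mxE.
  by rewrite e2; have := ltn_ord x; rewrite {2}e1; case: (Pset (shift_lab l) q i).
by rewrite e1; have := ltn_ord x; rewrite {2}e2; case: (Pset (shift_lab l) q i).
Qed.

Lemma hom_lab_refl l : proper l -> hom_lab l l.
Proof. by rewrite /proper /hom_lab; lia. Qed.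

Lemma brick_Pcx l : proper l -> brick DC (Pcx k l).
Proof.
move=> pl; have h := hom_lab_refl pl.
have t : isthin (chain1 (Pcx k l)).
  by move=> q i; rewrite /= (const_mx1_bool _ (erefl (nat_of_bool (Pset l q i)))).
split=> [z|f]; first by apply: (Dhom_nz (D := D) h t); rewrite loc1.
by have [s ->] := Dhom_span h t f; exists s; rewrite loc1.
Qed.

Lemma dl_hom0 X Y l m : isomorphic DC X (Pcx k l) -> isomorphic DC Y (Pcx k m) ->
  ~~ hom_lab l m -> forall f : Hom DC X Y, f = 0.
Proof.
move=> [a [a' [aa1 aa2]]] [b [b' [bb1 bb2]]] h f.
rewrite -[f]comp1m -[_ \oc f]compm1 -bb1 -aa1.
have -> : b' \oc b \oc f \oc (a' \oc a) = b' \oc (b \oc f \oc a') \oc a by rewrite !compmA.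
by rewrite (Dhom0 h (b \oc f \oc a')) comp0r comp0l.
Qed.

Lemma dl_hom1 X Y l m : isomorphic DC X (Pcx k l) -> isomorphic DC Y (Pcx k m) ->
  hom_lab l m -> exists2 e : Hom DC X Y, e <> 0 & forall f, exists s, f = s *: e.
Proof.
move=> [a [a' [aa1 aa2]]] [b [b' [bb1 bb2]]] h.
have [e te] := Dhom_ex k h.
exists (b' \oc loc D e \oc a).
  move=> e0; apply: (Dhom_nz (D := D) h te).
  rewrite -[loc D e]comp1m -[_ \oc loc D e]compm1 -bb2 -aa2.
  have -> : b \oc b' \oc loc D e \oc (a \oc a') = b \oc (b' \oc loc D e \oc a) \oc a'.
    by rewrite !compmA.
  by rewrite e0 comp0r comp0l.
move=> f; have [s es] := Dhom_span h te (b \oc f \oc a'); exists s.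
by rewrite -compZl -compZr -es !compmA bb1 comp1m -compmA aa1 compm1.
Qed.

(** The constant maps between standard complexes compose to constant maps, so that
    only the absence of homomorphisms can kill a composite. *)
Lemma dl_comp X Y Z l m r : isomorphic DC X (Pcx k l) -> isomorphic DC Y (Pcx k m) ->
  isomorphic DC Z (Pcx k r) -> forall (f : Hom DC X Y) (g : Hom DC Y Z),
  f <> 0 -> g <> 0 -> hom_lab l r -> g \oc f <> 0.
Proof.
move=> iX iY iZ f g f0 g0 h.
have hlm : hom_lab l m by apply: contraT => nh; case: f0; apply: (dl_hom0 iX iY nh).
have hmr : hom_lab m r by apply: contraT => nh; case: g0; apply: (dl_hom0 iY iZ nh).
move: iX iY iZ => [a [a' [aa1 aa2]]] [b [b' [bb1 bb2]]] [c [c' [cc1 cc2]]].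
have [e te] := Dhom_ex k hlm; have [e' te'] := Dhom_ex k hmr.
have [s es] := Dhom_span hlm te (b \oc f \oc a').
have [s' es'] := Dhom_span hmr te' (c \oc g \oc b').
have te2 := Dcomp hlm hmr h te te'.
move=> gf0; apply: (Dhom_nz (D := D) h te2); rewrite loc_mul.
have s0 : s <> 0.
  move=> s0; apply: f0; rewrite -[f]comp1m -[_ \oc f]compm1 -bb1 -aa1.
  have -> : b' \oc b \oc f \oc (a' \oc a) = b' \oc (b \oc f \oc a') \oc a by rewrite !compmA.
  by rewrite es s0 scale0r comp0r comp0l.
have s0' : s' <> 0.
  move=> s1; apply: g0; rewrite -[g]comp1m -[_ \oc g]compm1 -cc1 -bb1.
  have -> : c' \oc c \oc g \oc (b' \oc b) = c' \oc (c \oc g \oc b') \oc b by rewrite !compmA.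
  by rewrite es' s1 scale0r comp0r comp0l.
have : (s' * s) *: (loc D e' \oc loc D e) = 0.
  rewrite -scalerA -compZr -compZl -es -es'.
  have -> : c \oc g \oc b' \oc (b \oc f \oc a') = c \oc (g \oc (b' \oc b) \oc f) \oc a'.
    by rewrite !compmA.
  by rewrite bb1 compm1 gf0 comp0r comp0l.
move/eqP; rewrite scaler_eq0 mulf_eq0 => /orP[/orP[]|] /eqP //.
Qed.

End StandardObjects.

Section ClusterStandard.
Local Open Scope ring_scope.
Variables (k : fieldType) (n : nat).
Local Notation Q := (linear_An n).
Variable C : cluster_category k Q.
Local Notation cx := (cplx k Q).
Implicit Types (l m r : label n) (X Y Z : cx).
Local Notation D := (cl_der C).
Local Notation DC := (der_cat (cl_der C)).
Local Notation CC := (cl_cat C).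
Local Notation F := (cl_F C).

(** The Auslander-Reiten formula enters through this alone: it detects where
    homomorphisms vanish. *)
Lemma ar_nonzero X Y (f : Hom DC X (shift Y)) : f <> 0 ->
  exists g : Hom DC Y (tau_obj (cl_tau C) X), g <> 0.
Proof.
move=> f0; apply: NNPP => no; apply: f0.
have g0 (g : Hom DC Y (tau_obj (cl_tau C) X)) : g = 0.
  by apply: NNPP => ng; apply: no; exists g.
have z (u : Hom DC X (shift Y)) (g : Hom DC Y (tau_obj (cl_tau C) X)) : ar u g = 0.
  have := ar_linr 1 u (0 : Hom DC Y (tau_obj (cl_tau C) X)) 0.
  rewrite scaler0 addr0 (g0 g) mul1r => /eqP; rewrite -subr_eq subrr => /eqP <- //.
have [u [_ uu]] := ar_dual (X := X) (Y := Y) (\0 : {linear Hom DC Y (tau_obj (cl_tau C) X) -> k^o}).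
by rewrite -(uu f) ?(uu 0) // => g; rewrite z.
Qed.

(** The image is a brick, hence standard with some label [m]; by the
    Auslander-Reiten formula a homomorphism from it to [v] shifted forces one from
    [v] to [l] shifted, and [Serre_label] identifies [m]. *)
Lemma fw_Pcx l : proper l -> isomorphic DC (fw_obj F (Pcx k l)) (Pcx k (F_lab l)).
Proof.
move=> pl; have bF := fw_brick F (brick_Pcx D pl).
have [m [pm [S [S1 iS]]]] := D_split (proj1 bF).
have iF : isomorphic DC (fw_obj F (Pcx k l)) (Pcx k m).
  rewrite -S1; apply: indec_sum_iso iS _; first exact: brick_indec.
  by rewrite S1; case: (brick_Pcx D pm).
suff -> : F_lab l = m by [].
apply/esym/Serre_label => // v h.
have [f f0 _] := dl_hom1 iF (shift_Pcx D v) h.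
have [g g0] := ar_nonzero f0.
apply: contraT => nh; case: g0; apply: (dl_hom0 (iso_refl _ _) _ nh).
apply: iso_trans (shift_Pcx D l).
exact: (natiso_iso (cl_FE C) (Pcx k l)).
Qed.

Lemma bw_Pcx l : proper l -> isomorphic DC (bw_obj F (Pcx k l)) (Pcx k (Finv_lab l)).
Proof.
by move=> pl; apply: bw_fw_iso; rewrite -{2}(Finv_labK pl); apply: fw_Pcx; apply: Finv_lab_proper.
Qed.

Lemma ae_pow_Pcx i l : proper l -> isomorphic DC (ae_pow F i (Pcx k l)) (Pcx k (Fpow i l)).
Proof.
move=> pl; case: i => m.
  elim: m => [|m IH]; first exact: iso_refl.
  apply: iso_trans (fmap_iso (fw F) IH) _.
  by apply: fw_Pcx; apply: (@Fpow_proper n (Posz m)).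
elim: m => [|m IH]; first exact: bw_Pcx.
apply: iso_trans (fmap_iso (bw F) IH) _.
by apply: bw_Pcx; apply: (@Fpow_proper n (Negz m)).
Qed.

End ClusterStandard.

(** * Diagonals of the polygon as orbits of labels *)

Section Pairs.
Variable n : nat.
Implicit Types x y z : nat * nat.

(** Pairs of numbers are segments of the polygon with vertices [0, ..., n + 2]: its
    diagonals and its edges. *)
Definition is_seg x : bool := x.1 < x.2 <= n + 2.
(** The sides of the polygon are excluded, also the one that joins [0] and
    [n + 2]. *)
Definition is_diag x : bool := [&& x.1 + 2 <= x.2, x.2 <= n + 2 & x.2 <= x.1 + n + 1].

(** Homomorphisms between the objects of two diagonals that lift to degree 0,
    respectively 1, of the orbit category. *)
Definition hom_seg0 x y : bool :=
  [&& x.1 <= y.1, y.1 + 2 <= x.2, x.2 <= y.2 & y.2 <= x.1 + n + 1].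
Definition hom_seg1 x y : bool := [&& y.1 + 2 <= x.1, x.1 <= y.2 & y.2 + 2 <= x.2].
Definition hom_seg x y : bool := hom_seg0 x y || hom_seg1 x y.
(** When nonzero homomorphisms [x -> y -> z] have a nonzero composite: the degrees
    add up, and degree 2 contains nothing. *)
Definition comp_seg x y z : bool :=
  [|| [&& hom_seg0 x y, hom_seg0 y z & hom_seg0 x z], [&& hom_seg0 x y, hom_seg1 y z & hom_seg1 x z]
    | [&& hom_seg1 x y, hom_seg0 y z & hom_seg1 x z]].

Fact lab_subproof x :
  (if x.2 <= n.+1 then minn x.1 x.2.-1 else 0)
  <= (if x.2 <= n.+1 then minn x.2.-1 n else
      if x.1 <= n then x.1 else 0) <= n.
Proof. by (do 2?case: ifP => ?); lia. Qed.
(** The diagonal [(i, j)] with [j <= n + 1] is the module with support [i, j - 1), and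
    [(i, n + 2)] is the shift of the projective [0, i). An edge gets an empty support,
    hence a zero object; the minima only serve to make the label well formed. *)
Definition seg_lab x : label n :=
  Label (if (x.2 <= n.+1)%N then -2 else -3)%R (lab_subproof x).

Lemma diag_proper x : is_diag x -> proper (seg_lab x).
Proof. by rewrite /is_diag /proper /=; (do 2?case: ifP => ?); lia. Qed.
Lemma diag_seg x : is_diag x -> is_seg x.
Proof. by rewrite /is_diag /is_seg; lia. Qed.
Lemma edge_lab x : is_seg x -> ~~ is_diag x -> lc (seg_lab x) = ld (seg_lab x).
Proof. by rewrite /is_diag /is_seg /=; (do 2?case: ifP => ?); lia. Qed.

Lemma lp_iterF m (l : label n) : (lp (iter m (@F_lab n) l) <= lp l - m%:Z)%R.
Proof.
elim: m => [|m IH] /=; first by lia.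
by case: ifP; lia.
Qed.
Lemma lp_iterB m (l : label n) : (lp l + m%:Z <= lp (iter m (@Finv_lab n) l))%R.
Proof.
elim: m => [|m IH] /=; first by lia.
by case: ifP; lia.
Qed.

Lemma Fpow_diag x y (i : int) : is_diag x -> is_diag y ->
  hom_lab (seg_lab x) (Fpow i (seg_lab y)) = ((i == 0%R) && hom_seg0 x y) || ((i == 1%R) && hom_seg1 x y).
Proof.
case: x y => [x1 x2] [y1 y2]; rewrite /is_diag /= => dx dy.
have cases (P : Prop) : (x2 <= n.+1 -> y2 <= n.+1 -> P) ->
    (x2 <= n.+1 -> y2 = n.+2 -> P) -> (x2 = n.+2 -> y2 <= n.+1 -> P) ->
    (x2 = n.+2 -> y2 = n.+2 -> P) -> P.
  by case: (leqP x2 n.+1) => h1; case: (leqP y2 n.+1) => h2 *; auto with zarith; lia.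
have x1n : x1 <= n by lia.
have y1n : y1 <= n by lia.
case: i => [[|[|[|m]]]|[|m]].
- apply: cases => hx hy; rewrite /hom_lab /hom_seg0 /= ?hx ?hy ?x1n ?y1n ?ltnn /=; lia.
- apply: cases => hx hy; rewrite /hom_lab /hom_seg1 /= ?hx ?hy ?x1n ?y1n ?ltnn /=;
    (do ?case: ifP => ? /=); lia.
- apply: cases => hx hy; rewrite /hom_lab /= ?hx ?hy ?x1n ?y1n ?ltnn /=;
    case: (ltnP _ n) => ? /=; case: ifP => ? /=; lia.
- have := lp_iterF m.+3 (seg_lab (y1, y2)); rewrite /hom_lab -[Fpow _ _]/(iter m.+3 (@F_lab n) _).
  move: (iter _ _ _) => l /=.
  by apply: cases => hx hy; rewrite ?hx ?hy ?x1n ?ltnn /=; lia.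
- apply: cases => hx hy; rewrite /hom_lab /= ?hx ?hy ?x1n ?y1n ?ltnn /=;
    (do ?case: ifP => ? /=); lia.
have := lp_iterB m.+2 (seg_lab (y1, y2)); rewrite /hom_lab -[Fpow _ _]/(iter m.+2 (@Finv_lab n) _).
move: (iter _ _ _) => l /=.
by apply: cases => hx hy; rewrite ?hx ?hy ?x1n ?ltnn /=; lia.
Qed.

Lemma FF_dg x z : is_diag x -> is_diag z -> ~~ hom_lab (seg_lab x) (F_lab (F_lab (seg_lab z))).
Proof. by move=> dx dz; rewrite (@Fpow_diag x z 2 dx dz). Qed.

Lemma Fpow_self i (l : label n) : proper l -> hom_lab l (Fpow i l) -> i = 0%R.
Proof.
have := lP l; rewrite /proper => lP' pl; case: i => [[|[|m]]|m] //.
- by rewrite /hom_lab /=; case: ifP; lia.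
- have := lp_iterF m.+2 l; rewrite /hom_lab -[Fpow _ _]/(iter m.+2 (@F_lab n) _).
  by move: (iter _ _ _) => l'; lia.
have := lp_iterB m.+1 l; rewrite /hom_lab -[Fpow _ _]/(iter m.+1 (@Finv_lab n) _).
by move: (iter _ _ _) => l'; lia.
Qed.

Lemma Fpow_succ i (l : label n) : proper l -> Fpow (i + 1) l = F_lab (Fpow i l).
Proof.
move=> pl; case: i => [i|[|i]].
- by have -> : (Posz i + 1 = Posz i.+1)%R by lia.
- by rewrite /= Finv_labK.
have -> : (Negz i.+1 + 1 = Negz i)%R by lia.
have -> : Fpow (Negz i.+1) l = Finv_lab (Fpow (Negz i) l) by [].
by rewrite Finv_labK //; exact: (@Fpow_proper n (Negz i)).
Qed.

Lemma Fpow_pred i (l : label n) : proper l -> Fpow (i - 1) l = Finv_lab (Fpow i l).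
Proof.
move=> pl; have {2}-> : i = (i - 1 + 1)%R by lia.
by rewrite Fpow_succ // F_labK //; apply: Fpow_proper.
Qed.

Lemma Fpow_add i j (l : label n) : proper l -> Fpow i (Fpow j l) = Fpow (i + j) l.
Proof.
move=> pl; have pj := Fpow_proper j pl; case: i => i.
  elim: i => [|i IH]; first by rewrite add0r.
  have -> : Posz i.+1 = (Posz i + 1)%R by lia.
  by rewrite Fpow_succ // IH -Fpow_succ //; congr Fpow; lia.
elim: i => [|i IH].
  have -> : (Negz 0 + j = j - 1)%R by lia.
  by rewrite Fpow_pred.
have -> : Negz i.+1 = (Negz i - 1)%R by lia.
by rewrite Fpow_pred // IH -Fpow_pred //; congr Fpow; lia.
Qed.

(** The labels of diagonals are a fundamental domain for [F]: applying [F] or its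
    inverse moves a label towards the degrees [-2] and [-3]. *)
Lemma lab_orbit (l : label n) : proper l -> exists i x, is_diag x /\ Fpow i (seg_lab x) = l.
Proof.
move=> pl; pose ht (l : label n) := `|(lp l + 2)%R|%N.
have [m] := ubnP (ht l); elim: m l pl => // m IH l pl lt_m.
have := lP l; have := pl; rewrite /proper => h1 h2.
have stop0 : lp l = (-2)%R -> exists i x, is_diag x /\ Fpow i (seg_lab x) = l.
  move=> e; exists 0%R, (lc l, (ld l).+1); split; first by rewrite /is_diag /=; lia.
  have hd : (ld l < n.+1)%N by lia.
  by apply: label_eq; rewrite /= hd; lia.
have stop1 (l' : label n) : proper l' -> lp l' = (-3)%R -> lc l' = 0 ->
    exists i x, is_diag x /\ Fpow i (seg_lab x) = l'.
  have := lP l'; rewrite /proper => h3 h4 e e0.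
  exists 0%R, (ld l', n.+2); split; first by rewrite /is_diag /=; lia.
  have hd : (ld l' <= n)%N by lia.
  by apply: label_eq; rewrite /= ltnn ?hd; lia.
have [e|ne] := eqVneq (lp l) (-2)%R; first exact: stop0.
have succF i x : is_diag x -> Fpow (i + 1) (seg_lab x) = F_lab (Fpow i (seg_lab x)).
  by move/diag_proper; apply: Fpow_succ.
have succB i x : is_diag x -> Fpow (i - 1) (seg_lab x) = Finv_lab (Fpow i (seg_lab x)).
  by move/diag_proper; apply: Fpow_pred.
have [lt|ge] := boolP (lp l < -2)%R; last first.
  suff [i [x [dx e]]] : exists i x, is_diag x /\ Fpow i (seg_lab x) = F_lab l.
    by exists (i - 1)%R, x; split=> //; rewrite succB // e F_labK.
  have [/andP[/eqP e /negPf e']|h] := boolP ((lp l == -1)%R && ~~ (ld l < n)).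
    by apply: stop1; [exact: F_lab_proper | rewrite /= e' e | rewrite /= e'].
  apply: IH (F_lab_proper pl) _; move: lt_m; rewrite /ht /=.
  by case: ifP => ?; lia.
have [/andP[/eqP e /eqP e0]|h] := boolP ((lp l == -3)%R && (lc l == 0)).
  exact: stop1.
have [|i [x [dx e]]] := IH (Finv_lab l) (Finv_lab_proper pl).
  by move: lt_m; rewrite /ht /=; case: ifP => ?; lia.
by exists (i + 1)%R, x; split=> //; rewrite succF // e Finv_labK.
Qed.

End Pairs.

(** * Homomorphisms in the orbit category *)

Section OrbitHoms.
Local Open Scope ring_scope.
Variables (k : fieldType) (O : Type) (D : lincat k O) (F : autoequiv D).
Variable OC : orbit_category F.
Local Notation CC := (orb_cat OC).
Local Notation pi := (orb_proj OC).
Local Notation phi := (orb_triv OC).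

Lemma orb_fw_iso X : isomorphic CC (fw_obj F X) X.
Proof. exact: (natiso_iso phi X). Qed.

Lemma orb_single i X Y (f : Hom D X (ae_pow F i Y)) : orbit_mor phi f = 0 -> f = 0.
Proof.
move=> f0; pose g : forall i, Hom D X (ae_pow F i Y) := dfwith (fun=> 0) f.
have := @orb_inj _ _ _ _ OC X Y [:: i] g isT.
by rewrite big_seq1 /g dfwith_in f0 => /(_ erefl i); rewrite inE eqxx dfwith_in; apply.
Qed.

Lemma orb_pi_eq0 X Y (f : Hom D X Y) : fmap pi f = 0 -> f = 0.
Proof. by move=> f0; apply: (@orb_single 0); rewrite /orbit_mor f0 comp0r. Qed.

Lemma orb_zero X : zero_obj CC X -> zero_obj D X.
Proof. by move=> z; apply: orb_pi_eq0; rewrite fmap1. Qed.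

(** A homomorphism of the orbit category lifts to one degree if no other degree
    contains homomorphisms. *)
Lemma orb_only i0 X Y (h : Hom CC X Y) :
  (forall i, i != i0 -> forall f : Hom D X (ae_pow F i Y), f = 0) ->
  exists f : Hom D X (ae_pow F i0 Y), h = orbit_mor phi f.
Proof.
move=> z; have [s [f [us ->]]] := orb_surj h.
have z' i : i != i0 -> orbit_mor phi (f i) = 0.
  by move=> ne; rewrite /orbit_mor (z i ne (f i)) fmap0 comp0r.
have [ins|nin] := boolP (i0 \in s).
  by exists (f i0); rewrite (bigD1_seq i0) //= big1 ?addr0 // => i /z'.
exists 0; rewrite /orbit_mor fmap0 comp0r big_seq big1 // => i ins; apply: z'.
by apply: contraNneq nin => <-.
Qed.

Lemma orbit_mor0 X Y (f : Hom D X Y) : orbit_mor phi (i := 0) f = fmap pi f.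
Proof. by rewrite /orbit_mor /= comp1m. Qed.
Lemma orbit_mor1 X Y (f : Hom D X (fw_obj F Y)) :
  orbit_mor phi (i := 1) f = (ni phi Y : Hom CC (fw_obj F Y) Y) \oc fmap pi f.
Proof. by rewrite /orbit_mor /= comp1m. Qed.

Lemma phi_mono X Y (f : Hom CC X (fw_obj F Y)) : (ni phi Y : Hom CC (fw_obj F Y) Y) \oc f = 0 -> f = 0.
Proof.
move=> e; have kY : (ni_inv phi Y : Hom CC Y (fw_obj F Y)) \oc ni phi Y = idm (fw_obj F Y).
  exact: niK.
by rewrite -[f]comp1m -kY -compmA e comp0r.
Qed.

Lemma phi_nat X Y (f : Hom D X Y) :
  fmap pi f \oc (ni phi X : Hom CC (fw_obj F X) X)
  = (ni phi Y : Hom CC (fw_obj F Y) Y) \oc fmap pi (fmap (fw F) f).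
Proof. by have /= -> := ni_nat phi f. Qed.

End OrbitHoms.

Section OrbitRetracts.
Local Open Scope ring_scope.
Variables (k : fieldType) (O : Type) (D : lincat k O) (F : autoequiv D).
Variable OC : orbit_category F.
Local Notation CC := (orb_cat OC).
Local Notation pi := (orb_proj OC).
Local Notation phi := (orb_triv OC).

Lemma pi_comp X Y Z (g : Hom D Y Z) (f : Hom D X Y) :
  (fmap pi g : Hom CC Y Z) \oc (fmap pi f : Hom CC X Y) = fmap pi (g \oc f).
Proof. exact/esym/(fmap_comp pi). Qed.

Lemma phi_inv_nat X Y (f : Hom D X Y) :
  fmap pi (fmap (fw F) f) \oc (ni_inv phi X : Hom CC X (fw_obj F X))
  = (ni_inv phi Y : Hom CC Y (fw_obj F Y)) \oc fmap pi f.
Proof.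
have k1 Z : (ni_inv phi Z : Hom CC Z (fw_obj F Z)) \oc ni phi Z = idm (fw_obj F Z) := niK phi Z.
have k2 Z : (ni phi Z : Hom CC (fw_obj F Z) Z) \oc ni_inv phi Z = idm Z := ni_invK phi Z.
rewrite -[LHS]comp1m -k1 -compmA (compmA (ni phi Y)) -phi_nat.
by rewrite -(compmA (fmap pi f)) k2 compm1.
Qed.

(** The trivialisations [triv i] are natural, for some action of [F^i] on morphisms. *)
Lemma triv_nat i X Y (g : Hom D X Y) :
  exists g' : Hom D (ae_pow F i X) (ae_pow F i Y),
    fmap pi g \oc triv phi i X = triv phi i Y \oc fmap pi g'.
Proof.
case: i => m.
  elim: m => [|m [g' IH]]; first by exists g; rewrite /= compm1 comp1m.
  exists (fmap (fw F) g'); rewrite /= compmA [fmap pi g \oc _]IH -!compmA.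
  by rewrite phi_nat.
have step A B (h : Hom D A B) :
    fmap pi h \oc triv_inv phi A = triv_inv phi B \oc fmap pi (fmap (bw F) h).
  pose eA : Hom D (fw_obj F (bw_obj F A)) A := ni (ae_counit F) A.
  pose eB : Hom D (fw_obj F (bw_obj F B)) B := ni (ae_counit F) B.
  have e : eB \oc fmap (fw F) (fmap (bw F) h) = h \oc eA := ni_nat (ae_counit F) h.
  rewrite -[triv_inv phi A]/(fmap pi eA \oc _) -[triv_inv phi B]/(fmap pi eB \oc _).
  by rewrite -[RHS]compmA -phi_inv_nat !compmA !pi_comp e.
suff [g1 e1] : exists g' : Hom D (iter m.+1 (bw_obj F) X) (iter m.+1 (bw_obj F) Y),
  fmap pi g \oc triv_neg phi m.+1 X = triv_neg phi m.+1 Y \oc fmap pi g' by exists g1.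
elim: m => [|m [g' IH]]; first by exists (fmap (bw F) g); rewrite /= !comp1m step.
exists (fmap (bw F) g').
have e Z : triv_neg phi m.+2 Z = triv_neg phi m.+1 Z \oc triv_inv phi (iter m.+1 (bw_obj F) Z) by [].
by rewrite !e compmA IH -(compmA (triv_neg phi m.+1 Y)) step compmA.
Qed.

(** Moving a summand of [F^i X] back to [X] costs only a power of [F], as the
    quasi-inverse undoes [F] up to isomorphism. *)
Lemma retract_unpow i A X : retract D A (ae_pow F i X) ->
  exists j, retract D (ae_pow F j A) X.
Proof.
case: i => m.
  suff h : retract D A (iter m (fw_obj F) X) -> retract D (iter m (bw_obj F) A) X.
    move=> /h {}h; case: m h => [|m] h; first by exists 0.
    by exists (Negz m).
  elim: m A => [|m IH] A //= h.
  rewrite -iterS iterSr; apply: IH.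
  apply: retract_trans (fmap_retract (bw F) h) _; apply: iso_retract.
  exact: (natiso_iso (ae_unit F)).
move=> h; exists (Posz m.+1); rewrite /=.
elim: m A h => [|m IH] A h.
  apply: retract_trans (fmap_retract (fw F) h) _; apply: iso_retract.
  exact: fw_bw_iso.
rewrite -iterS iterSr; apply: IH.
apply: retract_trans (fmap_retract (fw F) h) _; apply: iso_retract.
exact: fw_bw_iso.
Qed.

End OrbitRetracts.

(** * Indecomposable objects of the cluster category *)

Section ClusterHoms.
Local Open Scope ring_scope.
Variables (k : fieldType) (n : nat).
Local Notation Q := (linear_An n).
Variable C : cluster_category k Q.
Local Notation cx := (cplx k Q).
Implicit Types (l m r : label n) (X Y Z : cx) (x y z : nat * nat).
Local Notation D := (cl_der C).
Local Notation DC := (der_cat (cl_der C)).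
Local Notation CC := (cl_cat C).
Local Notation F := (cl_F C).
Local Notation pi := (orb_proj (cl_orb C)).
Local Notation phi := (orb_triv (cl_orb C)).

Definition seg_obj x : cx := Pcx k (seg_lab n x).
(** Objects are not compared by equality: an arbitrary object is tied to its diagonal
    by an isomorphism in the cluster category. *)
Definition labelled X x : Prop := isomorphic CC X (seg_obj x).

Lemma hom_seg01 x y : hom_seg0 n x y -> ~~ hom_seg1 x y.
Proof. by case: x y => [i j] [i' j']; rewrite /hom_seg0 /hom_seg1 /=; lia. Qed.

Lemma pi_iso X Y : isomorphic DC X Y -> isomorphic CC X Y.
Proof. exact: (fmap_iso pi). Qed.

Lemma c_pi_eq0 X Y (f : Hom DC X Y) : (fmap pi f : Hom CC X Y) = 0 -> f = 0.
Proof. exact: (@orb_pi_eq0 _ _ _ _ (cl_orb C)). Qed.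

Lemma c_phi_eq0 X Y (f : Hom CC X (fw_obj F Y)) :
  (ni phi Y : Hom CC (fw_obj F Y) Y) \oc f = 0 -> f = 0.
Proof. exact: (@phi_mono _ _ _ _ (cl_orb C)). Qed.

Lemma F_lab_ciso l : proper l -> isomorphic CC (Pcx k (F_lab l)) (Pcx k l).
Proof.
move=> pl; apply: iso_trans (orb_fw_iso (cl_orb C) _).
by apply: pi_iso; apply: iso_sym; apply: fw_Pcx.
Qed.

Lemma Fpow_ciso i l : proper l -> isomorphic CC (Pcx k (Fpow i l)) (Pcx k l).
Proof.
move=> pl; case: i => m.
  elim: m => [|m IH]; first exact: iso_refl.
  by apply: iso_trans IH; apply: F_lab_ciso; apply: (@Fpow_proper n (Posz m)).
elim: m => [|m IH].
  by apply: iso_sym; rewrite -{1}(Finv_labK pl); apply: F_lab_ciso; apply: Finv_lab_proper.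
apply: iso_trans IH; have pm := @Fpow_proper n (Negz m) l pl.
by apply: iso_sym; rewrite -{1}(Finv_labK pm); apply: F_lab_ciso; apply: Finv_lab_proper.
Qed.

Lemma seg_obj_deg x y (i : int) : is_diag n x -> is_diag n y ->
  (hom_seg0 n x y -> i != 0) -> (hom_seg1 x y -> i != 1) ->
  forall f : Hom DC (seg_obj x) (ae_pow F i (seg_obj y)), f = 0.
Proof.
move=> dx dy h0 h1; apply: dl_hom0 (iso_refl _ _) (ae_pow_Pcx C i (diag_proper dy)) _.
rewrite Fpow_diag //; apply/negP => /orP[/andP[/eqP e h]|/andP[/eqP e h]].
  by have := h0 h; rewrite e eqxx.
by have := h1 h; rewrite e.
Qed.

Lemma seg_obj_hom0 x y : is_diag n x -> is_diag n y -> hom_seg0 n x y -> forall h : Hom CC (seg_obj x) (seg_obj y),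
  exists f : Hom DC (seg_obj x) (seg_obj y), h = fmap pi f.
Proof.
move=> dx dy h0 h; have [|f ->] := @orb_only _ _ _ _ (cl_orb C) 0 (seg_obj x) (seg_obj y) h.
  by move=> i ne; apply: seg_obj_deg => // h1; have := hom_seg01 h0; rewrite h1.
by exists f; rewrite orbit_mor0.
Qed.

Lemma seg_obj_hom1 x y : is_diag n x -> is_diag n y -> hom_seg1 x y -> forall h : Hom CC (seg_obj x) (seg_obj y),
  exists f : Hom DC (seg_obj x) (fw_obj F (seg_obj y)),
    h = (ni phi (seg_obj y) : Hom CC (fw_obj F (seg_obj y)) (seg_obj y)) \oc fmap pi f.
Proof.
move=> dx dy h1 h; have [|f ->] := @orb_only _ _ _ _ (cl_orb C) 1 (seg_obj x) (seg_obj y) h.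
  by move=> i ne; apply: seg_obj_deg => // h0; have := hom_seg01 h0; rewrite h1.
by exists f; rewrite orbit_mor1.
Qed.

Lemma seg_obj_none x y : is_seg n x -> is_seg n y -> ~~ hom_seg n x y ->
  forall h : Hom CC (seg_obj x) (seg_obj y), h = 0.
Proof.
move=> sx sy; rewrite /hom_seg negb_or => /andP[h0 h1] h.
have [dx|ex] := boolP (is_diag n x); last first.
  by apply/zero_objP/(fmap_zero pi)/D_zero_thin/edge_lab.
have [dy|ey] := boolP (is_diag n y); last first.
  by apply/zero_objP'/(fmap_zero pi)/D_zero_thin/edge_lab.
have [|f ->] := @orb_only _ _ _ _ (cl_orb C) 0 (seg_obj x) (seg_obj y) h.
  by move=> i ne; apply: seg_obj_deg => // hh; rewrite hh in h1.
rewrite orbit_mor0 (_ : f = 0) ?fmap0 //.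
apply: (dl_hom0 (iso_refl _ _) (iso_refl _ _)).
by have := @Fpow_diag n x y 0 dx dy; rewrite /= (negPf h0) => ->.
Qed.

Lemma hom_seg_diag x y : is_seg n x -> is_seg n y -> hom_seg n x y -> is_diag n x /\ is_diag n y.
Proof.
case: x y => [i j] [i' j'].
by rewrite /is_seg /hom_seg /hom_seg0 /hom_seg1 /is_diag /= => *; split; lia.
Qed.

Lemma seg_obj_span x y : is_diag n x -> is_diag n y -> hom_seg n x y ->
  exists2 e : Hom CC (seg_obj x) (seg_obj y), e <> 0 & forall h, exists s, h = s *: e.
Proof.
move=> dx dy /orP[h|h].
  have [|e e0 eS] := dl_hom1 (iso_refl DC (seg_obj x)) (iso_refl DC (seg_obj y)).
    by have := @Fpow_diag n x y 0 dx dy; rewrite h => ->.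
  exists (fmap pi e); first by move/c_pi_eq0.
  move=> g.
  by have [f ->] := seg_obj_hom0 dx dy h g; have [s ->] := eS f; exists s; rewrite fmapZ.
have [|e e0 eS] := dl_hom1 (iso_refl DC (seg_obj x)) (fw_Pcx C (diag_proper dy)).
  by have := @Fpow_diag n x y 1 dx dy; rewrite h => ->.
exists ((ni phi (seg_obj y) : Hom CC (fw_obj F (seg_obj y)) (seg_obj y)) \oc fmap pi e).
  by move/c_phi_eq0/c_pi_eq0.
move=> g; have [f ->] := seg_obj_hom1 dx dy h g; have [s ->] := eS f; exists s.
by rewrite fmapZ compZr.
Qed.

(** Both factors lift to the derived category, in degree 0 or 1, and so does the
    composite; there nonzero maps compose as [dl_comp] says. *)
Lemma seg_obj_comp x y z : is_diag n x -> is_diag n y -> is_diag n z ->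
  forall (f : Hom CC (seg_obj x) (seg_obj y)) (g : Hom CC (seg_obj y) (seg_obj z)), f <> 0 -> g <> 0 ->
  (comp_seg n x y z -> g \oc f <> 0) /\ (~~ comp_seg n x y z -> g \oc f = 0).
Proof.
move=> dx dy dz f g f0 g0.
have : hom_seg n x y.
  by apply: contraT => h; case: f0; apply: seg_obj_none => //; apply: diag_seg.
have : hom_seg n y z.
  by apply: contraT => h; case: g0; apply: seg_obj_none => //; apply: diag_seg.
have L0 := @Fpow_diag n x z 0 dx dz; have L1 := @Fpow_diag n x z 1 dx dz.
rewrite /= orbF in L0; rewrite /= in L1.
rewrite /comp_seg => /orP[hyz|hyz] /orP[hxy|hxy]; rewrite hyz hxy /=.
- rewrite (negPf (hom_seg01 hxy)) (negPf (hom_seg01 hyz)) /= !orbF -L0.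
  have [f' e] := seg_obj_hom0 dx dy hxy f; have [g' e'] := seg_obj_hom0 dy dz hyz g.
  subst f g; rewrite pi_comp; split=> [h|h].
    have f1 : f' <> 0 by move=> e; apply: f0; rewrite e fmap0.
    have g1 : g' <> 0 by move=> e; apply: g0; rewrite e fmap0.
    move/c_pi_eq0.
    exact: (dl_comp (iso_refl _ _) (iso_refl _ _) (iso_refl _ _) f1 g1 h).
  by rewrite (dl_hom0 (iso_refl _ _) (iso_refl _ _) h (g' \oc f')) fmap0.
- have -> : hom_seg0 n x y = false by apply: contraTF hxy => /hom_seg01.
  have [f' e] := seg_obj_hom1 dx dy hxy f; have [g' e'] := seg_obj_hom0 dy dz hyz g.
  subst f g; rewrite compmA phi_nat -compmA pi_comp -L1; split=> [h|h].
    have f1 : f' <> 0 by move=> e; apply: f0; rewrite e fmap0 comp0r.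
    have g1 : fmap (fw F) g' <> 0 by move=> e; apply: g0; rewrite (fw_eq0 e) fmap0.
    move/c_phi_eq0/c_pi_eq0.
    exact: (dl_comp (iso_refl _ _) (fw_Pcx C (diag_proper dy)) (fw_Pcx C (diag_proper dz)) f1 g1 h).
  by rewrite (dl_hom0 (iso_refl _ _) (fw_Pcx C (diag_proper dz)) h (fmap (fw F) g' \oc f')) fmap0 comp0r.
- have -> : hom_seg0 n y z = false by apply: contraTF hyz => /hom_seg01.
  rewrite (negPf (hom_seg01 hxy)) /= orbF.
  have [f' e] := seg_obj_hom0 dx dy hxy f; have [g' e'] := seg_obj_hom1 dy dz hyz g.
  subst f g; rewrite -compmA pi_comp -L1; split=> [h|h].
    have f1 : f' <> 0 by move=> e; apply: f0; rewrite e fmap0.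
    have g1 : g' <> 0 by move=> e; apply: g0; rewrite e fmap0 comp0r.
    move/c_phi_eq0/c_pi_eq0.
    exact: (dl_comp (iso_refl _ _) (iso_refl _ _) (fw_Pcx C (diag_proper dz)) f1 g1 h).
  by rewrite (dl_hom0 (iso_refl _ _) (fw_Pcx C (diag_proper dz)) h (g' \oc f')) fmap0 comp0r.
have -> : hom_seg0 n x y = false by apply: contraTF hxy => /hom_seg01.
have -> : hom_seg0 n y z = false by apply: contraTF hyz => /hom_seg01.
split=> // _.
have [f' ->] := seg_obj_hom1 dx dy hxy f; have [g' ->] := seg_obj_hom1 dy dz hyz g.
rewrite -compmA (compmA (fmap pi g')) phi_nat -compmA pi_comp.
set w := _ \oc f'; rewrite (_ : w = 0) ?fmap0 ?comp0r //.
apply: (dl_hom0 (iso_refl _ _) _ (FF_dg dx dz)).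
apply: iso_trans (fw_Pcx C (F_lab_proper (diag_proper dz))).
by apply: (fmap_iso (fw F)); apply: fw_Pcx; apply: diag_proper.
Qed.

Lemma seg_obj_brick x : is_diag n x -> brick CC (seg_obj x).
Proof.
move=> dx; split.
  by move=> z; case: (brick_Pcx D (diag_proper dx)) => nz _; apply: nz; apply: (orb_zero z).
have h0 : hom_seg0 n x x by move: dx; rewrite /is_diag /hom_seg0; lia.
move=> f; have [g ->] := seg_obj_hom0 dx dx h0 f.
have [_ b] := brick_Pcx D (diag_proper dx); have [c ->] := b g; exists c.
by rewrite fmapZ fmap1.
Qed.

Lemma lab_none X Y x y : labelled X x -> labelled Y y -> is_seg n x -> is_seg n y ->
  ~~ hom_seg n x y -> forall f : Hom CC X Y, f = 0.
Proof.
move=> [a [a' [aa1 aa2]]] [b [b' [bb1 bb2]]] sx sy h f.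
rewrite -[f]comp1m -[_ \oc f]compm1 -bb1 -aa1.
have -> : b' \oc b \oc f \oc (a' \oc a) = b' \oc (b \oc f \oc a') \oc a by rewrite !compmA.
by rewrite (seg_obj_none sx sy h (b \oc f \oc a')) comp0r comp0l.
Qed.

Lemma lab_span X Y x y : labelled X x -> labelled Y y -> is_seg n x -> is_seg n y ->
  hom_seg n x y -> exists2 e : Hom CC X Y, e <> 0 & forall h, exists s, h = s *: e.
Proof.
move=> [a [a' [aa1 aa2]]] [b [b' [bb1 bb2]]] sx sy h.
have [dx dy] := hom_seg_diag sx sy h; have [e e0 eS] := seg_obj_span dx dy h.
exists (b' \oc e \oc a) => [z|g].
  apply: e0; rewrite -[e]comp1m -[_ \oc e]compm1 -bb2 -aa2.
  have -> : b \oc b' \oc e \oc (a \oc a') = b \oc (b' \oc e \oc a) \oc a' by rewrite !compmA.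
  by rewrite z comp0r comp0l.
have [s es] := eS (b \oc g \oc a'); exists s.
by rewrite -compZl -compZr -es !compmA bb1 comp1m -compmA aa1 compm1.
Qed.

Lemma lab_comp X Y Z x y z : labelled X x -> labelled Y y -> labelled Z z ->
  is_diag n x -> is_diag n y -> is_diag n z ->
  forall (f : Hom CC X Y) (g : Hom CC Y Z), f <> 0 -> g <> 0 ->
  (comp_seg n x y z -> g \oc f <> 0) /\ (~~ comp_seg n x y z -> g \oc f = 0).
Proof.
move=> [a [a' [aa1 aa2]]] [b [b' [bb1 bb2]]] [c [c' [cc1 cc2]]] dx dy dz f g f0 g0.
have f0' : b \oc f \oc a' <> 0.
  move=> e; apply: f0; rewrite -[f]comp1m -[_ \oc f]compm1 -bb1 -aa1.
  have -> : b' \oc b \oc f \oc (a' \oc a) = b' \oc (b \oc f \oc a') \oc a by rewrite !compmA.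
  by rewrite e comp0r comp0l.
have g0' : c \oc g \oc b' <> 0.
  move=> e; apply: g0; rewrite -[g]comp1m -[_ \oc g]compm1 -cc1 -bb1.
  have -> : c' \oc c \oc g \oc (b' \oc b) = c' \oc (c \oc g \oc b') \oc b by rewrite !compmA.
  by rewrite e comp0r comp0l.
have := seg_obj_comp dx dy dz f0' g0'.
have -> : c \oc g \oc b' \oc (b \oc f \oc a') = c \oc (g \oc (b' \oc b) \oc f) \oc a'.
  by rewrite !compmA.
rewrite bb1 compm1 => -[h1 h2]; split=> [/h1 h e|/h2 e].
  by apply: h; rewrite e comp0r comp0l.
rewrite -[g \oc f]comp1m -[_ \oc (g \oc f)]compm1 -cc1 -aa1.
have -> : c' \oc c \oc (g \oc f) \oc (a' \oc a) = c' \oc (c \oc (g \oc f) \oc a') \oc a.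
  by rewrite !compmA.
by rewrite e comp0r comp0l.
Qed.

Lemma lab_brick X x : labelled X x -> is_diag n x -> brick CC X.
Proof. by move=> i /seg_obj_brick; apply: brick_iso; apply: iso_sym. Qed.

Lemma lab_inj X x y : labelled X x -> labelled X y -> is_diag n x -> is_diag n y -> x = y.
Proof.
move=> ix iy dx dy; have bX := lab_brick ix dx.
have [a [b [ba ab]]] := iso_trans (iso_sym ix) iy.
have nz : idm (seg_obj x) <> 0 :> Hom CC _ _ by case: (seg_obj_brick dx).
have a0 : a <> 0 by move=> e; apply: nz; rewrite -ba e comp0r.
have b0 : b <> 0 by move=> e; apply: nz; rewrite -ba e comp0l.
have [_ h] := seg_obj_comp dx dy dx a0 b0.
have : comp_seg n x y x by apply: contraT => /h e; case: nz; rewrite -ba e.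
case: x y {ix iy dx dy a b ba ab nz a0 b0 h bX} => [i j] [i' j'].
by rewrite /comp_seg /hom_seg0 /hom_seg1 /= => h; congr pair; lia.
Qed.

(** An indecomposable object of the cluster category is nonzero in the derived
    category, so a standard complex splits off there. *)
Lemma indec_label X : indecomposable CC X -> exists2 x, is_diag n x & labelled X x.
Proof.
move=> iX; have nX : ~ zero_obj DC X by case: iX => h _ /(fmap_zero pi).
have [l [pl [S [S1 iS]]]] := D_split nX.
have [S' [e1 e2]] := fmap_dsum pi S.
have iXl : isomorphic CC X (Pcx k l).
  rewrite -S1 -e2; apply: indec_sum_iso iX _ _; first by rewrite e1; apply: pi_iso.
  by rewrite e2 S1; move/(orb_zero (OC := cl_orb C)); case: (brick_Pcx D pl).
have [i [x [dx e]]] := lab_orbit pl; exists x => //.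
by apply: iso_trans iXl _; rewrite -e; apply: Fpow_ciso; apply: diag_proper.
Qed.

(** The shift acts on the derived category only. To use it on a summand in the
    cluster category, the summand is first lifted: among the finitely many degrees
    of the inclusion and the projection, one pair has an invertible composite. *)
Lemma D_retract_of_C X x : is_diag n x -> retract CC (seg_obj x) X ->
  exists i, retract DC (Pcx k (Fpow i (seg_lab n x))) X.
Proof.
move=> dx [u [v vu]]; have px := diag_proper dx.
have [s [uf [_ eu]]] := orb_surj u; have [t [vf [_ ev]]] := orb_surj v.
have nz : idm (seg_obj x) <> 0 :> Hom CC _ _ by case: (seg_obj_brick dx).
have [i [j w0]] : exists i j, orbit_mor phi (vf j) \oc orbit_mor phi (uf i) <> 0.
  apply: NNPP => no; apply: nz; rewrite -vu eu ev comp_suml big1 // => j _.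
  rewrite comp_sumr big1 // => i _; apply: NNPP => ne; apply: no; by exists i, j.
have [g' e] := triv_nat (cl_orb C) i (vf j).
have w1 : g' \oc uf i <> 0.
  move=> z; apply: w0; rewrite /orbit_mor -compmA (compmA (fmap pi (vf j))) e.
  by rewrite -compmA pi_comp z fmap0 !comp0r.
have iZ : isomorphic DC (ae_pow F i (ae_pow F j (seg_obj x))) (Pcx k (Fpow i (Fpow j (seg_lab n x)))).
  apply: iso_trans (ae_pow_Pcx C i (Fpow_proper j px)).
  by apply: ae_pow_iso; apply: ae_pow_Pcx.
(* a brick has no nonzero map to the other members of its orbit *)
have ij : i + j = 0.
  apply: (Fpow_self px); rewrite -Fpow_add //; apply: contraT => h; case: w1.
  exact: (dl_hom0 (iso_refl _ _) iZ h).
rewrite Fpow_add // ij /= in iZ.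
have [b [b' [bb1 bb2]]] := iZ.
have w2 : b \oc (g' \oc uf i) <> 0.
  by move=> z; apply: w1; rewrite -[_ \oc _]comp1m -bb1 -compmA z comp0r.
have [_ bP] := brick_Pcx D px; have [c ec] := bP (b \oc (g' \oc uf i)).
have c0 : c != 0 by apply: contra_not_neq w2 => c0; rewrite ec c0 scale0r.
have r : retract DC (seg_obj x) (ae_pow F i X).
  exists (uf i), (c^-1 *: (b \oc g')).
  by rewrite compZl -compmA ec scalerA mulVf // scale1r.
have [j' r'] := retract_unpow r; exists j'.
by apply: retract_trans r'; apply: iso_retract; apply: iso_sym; apply: ae_pow_Pcx.
Qed.

End ClusterHoms.

(** * Triangulations and flips *)

Section Triangulations.
Variable n : nat.
Definition crosses (x y : nat * nat) : bool :=
  [&& x.1 < y.1, y.1 < x.2 & x.2 < y.2] || [&& y.1 < x.1, x.1 < y.2 & y.2 < x.2].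

Lemma crossesC (y z : nat * nat) : crosses y z = crosses z y.
Proof. by rewrite /crosses orbC. Qed.

(** Induction on the width [c - a]: the longest segment starting at [a], other than
    [(a, c)], separates the segments below its end from those above. *)
Lemma noncrossing_bound (a c : nat) (s : seq (nat * nat)) : a < c -> uniq s ->
  {in s, forall x : nat * nat, [&& a <= x.1, x.1 + 2 <= x.2 & x.2 <= c]} ->
  {in s &, forall x y : nat * nat, ~~ crosses x y} -> size s + a.+1 <= c.
Proof.
have [m] := ubnP (c - a); elim: m a c s => // m IH a c s lt_m ac us rs nc.
have [e|ne] := eqVneq c a.+1.
  case: s {us nc} rs => [|x s] rs; first by rewrite e.
  by have := rs x (mem_head _ _); lia.
pose s1 := [seq x <- s | x != (a, c)].
have us1 : uniq s1 by rewrite filter_uniq.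
have ss : size s <= (size s1).+1.
  rewrite size_filter -(count_predC (pred1 (a, c)) s) (count_uniq_mem _ us) addnC.
  by rewrite -addn1 leq_add2l; case: (_ \in _).
have s1s x : x \in s1 -> x \in s by rewrite mem_filter => /andP[].
pose P b := ((a, b) \in s1) || (b == a.+1).
have exP : exists b, P b by exists a.+1; rewrite /P eqxx orbT.
have bdP b : P b -> b <= c.
  by case/orP => [/s1s/rs/and3P[]|/eqP->] //=.
case: (ex_maxnP exP bdP) => b Pb maxb.
have ab : a < b by have /orP[/s1s/rs|] := Pb; rewrite /=; lia.
have bc : b < c.
  have := bdP b Pb; rewrite leq_eqVlt => /orP[/eqP e|//].
  have /orP[|] := Pb; last by lia.
  by rewrite mem_filter e eqxx.
have split_s1 x : x \in s1 -> (x.2 <= b) || (b <= x.1).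
  move=> xs; have /= h := rs _ (s1s _ xs).
  have [e|xa] := eqVneq x.1 a.
    by rewrite maxb // /P -e -surjective_pairing xs.
  have /orP[abs|/eqP e] := Pb; last by rewrite e; move: h xa; case: (x) => u v /=; lia.
  by have := nc _ _ (s1s _ xs) (s1s _ abs); move: h xa; rewrite /crosses; case: (x) => u v /=; lia.
pose p (z : nat * nat) := z.2 <= b.
have h1 : size (filter p s1) + a.+1 <= b.
  apply: IH => //; first by lia.
  - by rewrite filter_uniq.
  - by move=> x; rewrite mem_filter => /andP[h xs]; have := rs _ (s1s _ xs); move: h; rewrite /p /=; lia.
  by move=> x y hx hy; apply: nc; apply: s1s; [move: hx | move: hy]; rewrite mem_filter => /andP[].
have h2 : size (filter (predC p) s1) + b.+1 <= c.
  apply: IH => //; first by lia.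
  - by rewrite filter_uniq.
  - by move=> x; rewrite mem_filter => /andP[h xs]; have := split_s1 _ xs; have := rs _ (s1s _ xs); move: h; rewrite /p /=; lia.
  by move=> x y hx hy; apply: nc; apply: s1s; [move: hx | move: hy]; rewrite mem_filter => /andP[].
move: h1 h2 ss; rewrite -(count_predC p s1) !(size_filter p) !(size_filter (predC p)).
by move: (count p s1) (count _ s1) (size s) => u v w; lia.
Qed.

Implicit Types (x : 'I_n -> nat * nat) (y z : nat * nat).

(** No further diagonal fits in ([tri_max]), so these are the triangulations of the
    polygon, with their diagonals numbered. *)
Definition tri (x : 'I_n -> nat * nat) : Prop :=
  [/\ forall i, is_diag n (x i), forall i j, ~~ crosses (x i) (x j) & injective x].

(** An additional diagonal, together with the edge joining [0] and [n + 2], would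
    exceed [noncrossing_bound]. *)
Lemma tri_max x y : tri x -> is_diag n y -> (forall i, ~~ crosses (x i) y) -> exists i, x i = y.
Proof.
move=> [dx nx ix] dy ny; apply: NNPP => no.
have nin : y \notin codom x by apply/negP => /codomP[i e]; apply: no; exists i.
(* the edge joining the extreme vertices counts in the bound as well *)
pose s := y :: (0, n.+2) :: codom x.
have cr0 z : is_diag n z -> (crosses z (0, n.+2) = false) * (crosses (0, n.+2) z = false).
  by rewrite /is_diag /crosses /=; split; lia.
have self z : crosses z z = false by rewrite /crosses; lia.
have us : uniq s.
  have ne z : is_diag n z -> z != (0, n.+2) by apply: contraTneq => ->; rewrite /is_diag /=; lia.
  rewrite /s /= inE negb_or nin ne //= map_inj_uniq // enum_uniq andbT.
  by apply/negP => /codomP[i e]; have := ne _ (dx i); rewrite -e eqxx.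
have := @noncrossing_bound 0 n.+2 s isT us.
rewrite /s /= size_codom card_ord => h; suff : n.+2 + 1 <= n.+2 by lia.
apply: h => [z|z w].
  rewrite !inE => /or3P[/eqP->|/eqP->|/codomP[i ->]] /=; [|lia|have := dx i].
    by move: dy; rewrite /is_diag; lia.
  by rewrite /is_diag; lia.
rewrite !inE => /or3P[/eqP->|/eqP->|/codomP[i ->]] /or3P[/eqP->|/eqP->|/codomP[j ->]];
  by rewrite ?self ?(cr0 _ dy) ?(cr0 _ (dx _)) ?(nx _ _) ?ny // crossesC ny.
Qed.

(** The sides of the triangles of a triangulation. *)
Definition sideT (x : 'I_n -> nat * nat) z : Prop :=
  is_seg n z /\ (~~ is_diag n z \/ exists i, x i = z).

Lemma sideT_nc x z y : tri x -> sideT x z -> is_diag n y ->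
  (forall i, x i = z -> ~~ crosses (x i) y) -> ~~ crosses z y.
Proof.
move=> tx [sz [ez|[i ei]]] dy h; last by rewrite -ei; apply: h.
by move: sz ez dy; rewrite /is_seg /is_diag /crosses; lia.
Qed.

Lemma sideT_nc' x z i : tri x -> sideT x z -> ~~ crosses z (x i).
Proof. by move=> tx sz; have [dx nx _] := tx; apply: sideT_nc tx sz (dx i) _ => j _; apply: nx. Qed.

(** The triangle below a side [(a, c)] has its third vertex at the far end of the
    longest side starting at [a]; maximality of the triangulation yields the other
    side. *)
Lemma apex x a c : tri x -> a + 2 <= c -> sideT x (a, c) ->
  exists b, [/\ a < b < c, sideT x (a, b) & sideT x (b, c)].
Proof.
move=> tx ac sac; have [dx nx ix] := tx; have [seg_ac _] := sac.
pose P b := (b < c) && ([exists i, x i == (a, b)] || (b == a.+1)).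
have exP : exists b, P b by exists a.+1; rewrite /P eqxx orbT andbT; lia.
have bdP b : P b -> b <= c by case/andP => /ltnW.
case: (ex_maxnP exP bdP) => b /andP[bc Pb] maxb.
have ab : a < b.
  have /orP[/existsP[i /eqP e]|/eqP->//] := Pb.
  by have := dx i; rewrite e /is_diag /=; lia.
have sab : sideT x (a, b).
  split; first by move: seg_ac; rewrite /is_seg /=; lia.
  have /orP[/existsP[i /eqP e]|/eqP e] := Pb; first by right; exists i.
  by left; rewrite e /is_diag /=; lia.
exists b; split=> //; first by rewrite ab.
split; first by move: seg_ac; rewrite /is_seg /=; lia.
case: (boolP (is_diag n (b, c))) => [dbc|]; [right | by left].
apply: tri_max => // i; apply/negP => cr.
have h1 := sideT_nc' i tx sac; have h2 := sideT_nc' i tx sab; have d := dx i.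
have h3 : (x i).1 = a -> (x i).2 < c -> (x i).2 <= b.
  move=> e lt; apply: maxb; rewrite /P lt; apply/orP; left; apply/existsP; exists i.
  by rewrite -e -surjective_pairing.
move: cr h1 h2 d h3; rewrite /crosses /is_diag /=; case: (x i) => u v /=; lia.
Qed.

(** The triangle above a diagonal: take the shortest side around it. The third vertex
    may lie on either end. *)
Lemma outer x r : tri x -> let: (a, c) := x r in
  (exists e, [/\ e < a, sideT x (e, a) & sideT x (e, c)]) \/
  (exists e, [/\ c < e, sideT x (a, e) & sideT x (c, e)]).
Proof.
move=> tx; have [dx nx ix] := tx; case e: (x r) => [a c].
have dac : is_diag n (a, c) by rewrite -e.
pose R w := exists p q, [/\ p <= a, c <= q, (p, q) <> (a, c), sideT x (p, q) & w = q - p].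
have [w [[p [q [pa cq ne spq ew]]] minw]] : exists w, R w /\ forall w', R w' -> w <= w'.
  have : R n.+2.
    exists 0, n.+2; split=> //; first by move: dac; rewrite /is_diag /=; lia.
      by move=> [] e1 e2; move: dac; rewrite -e1 -e2 /is_diag /=; lia.
    split; first by rewrite /is_seg /=; lia.
    by left; rewrite /is_diag /=; lia.
  move: (n.+2) => w; have [m] := ubnP w; elim: m w => // m IH w lt_m Rw.
  case: (classic (exists w', R w' /\ w' < w)) => [[w' [Rw' lt]]|no].
    by apply: (IH w') => //; lia.
  exists w; split=> // w' Rw'; rewrite leqNgt; apply/negP => lt; apply: no.
  by exists w'.
have pq : p + 2 <= q by move: dac; rewrite /is_diag /=; lia.
have [b [/andP[pb bq] spb sbq]] := apex tx pq spq.
have n1 := sideT_nc' r tx spb; have n2 := sideT_nc' r tx sbq; rewrite e in n1 n2.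
have ne' : p < a \/ c < q.
  case: (ltngtP p a) pa => // [|ep] _; first by left.
  case: (ltngtP c q) cq => // [|ep'] _; first by right.
  by case: ne; rewrite ep ep'.
have [cb|cb] := leqP c b.
  have eb : (p, b) = (a, c).
    apply: NNPP => nn; have : w <= b - p by apply: minw; exists p, b.
    lia.
  case: eb => e1 e2; subst p b; right; exists q; split=> //.
have ba : b <= a by move: n1 n2; rewrite /crosses /=; lia.
have eb : (b, q) = (a, c).
  apply: NNPP => nn; have : w <= q - b by apply: minw; exists b, q.
  lia.
by case: eb => e1 e2; subst q b; left; exists p.
Qed.

(** The union of the two triangles that meet in the diagonal [x r]; [b] tells which
    of the two diagonals of this quadrilateral belongs to the triangulation. *)
Definition quad (x : 'I_n -> nat * nat) r (b : bool) p q s t : Prop :=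
  [/\ p < q < s, s < t <= n + 2, x r = if b then (p, s) else (q, t),
      sideT x (p, q) /\ sideT x (q, s) & sideT x (s, t) /\ sideT x (p, t)].

Lemma quad_ex x r : tri x -> exists b p q s t, quad x r b p q s t.
Proof.
move=> tx; have := outer r tx; have [dx _ _] := tx; have := dx r.
case e: (x r) => [a c] dac.
have sac : sideT x (a, c) by split; [exact: diag_seg | right; exists r].
have [|b [/andP[ab bc] sab sbc]] := apex tx _ sac; first by move: dac; rewrite /is_diag /=; lia.
case=> [[f [fa sfa sfc]]|[f [cf saf scf]]].
  exists false, f, a, b, c; split=> //; rewrite ?fa ?bc //.
  by move: dac; rewrite /is_diag /=; lia.
exists true, a, b, c, f; split=> //; rewrite ?ab ?cf //.
by have [] := saf; rewrite /is_seg /=; lia.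
Qed.

Definition flip (x : 'I_n -> nat * nat) r (z : nat * nat) : 'I_n -> nat * nat :=
  fun j => if j == r then z else x j.

Definition flip_diag (b : bool) (p q s t : nat) : nat * nat := if b then (q, t) else (p, s).

Lemma quad_sides_nc x r b p q s t j : tri x -> quad x r b p q s t ->
  [/\ ~~ crosses (p, q) (x j), ~~ crosses (q, s) (x j), ~~ crosses (s, t) (x j)
    & ~~ crosses (p, t) (x j)].
Proof.
by move=> tx [_ _ _ [h1 h2] [h3 h4]]; split; apply: sideT_nc'.
Qed.

Lemma quad_is_diag x r b p q s t : tri x -> quad x r b p q s t -> is_diag n (flip_diag b p q s t).
Proof.
move=> [dx _ _] [h1 h2 e _ _]; have := dx r; rewrite e.
by case: b {e}; rewrite /is_diag /flip_diag /=; lia.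
Qed.

Lemma flip_tri x r b p q s t : tri x -> quad x r b p q s t ->
  tri (flip x r (flip_diag b p q s t)).
Proof.
move=> tx qx; have dz := quad_is_diag tx qx; have [dx nx ix] := tx.
have [h1 h2 e _ _] := qx.
have key j : j != r -> ~~ crosses (x j) (flip_diag b p q s t).
  move=> nj; have [c1 c2 c3 c4] := quad_sides_nc j tx qx.
  have ne : x j <> x r by move/ix => e'; rewrite e' eqxx in nj.
  have := nx j r; have := dx j; move: c1 c2 c3 c4 ne; rewrite e /crosses /is_diag /flip_diag.
  case: (x j) => u v; case: b {dz qx e} => /= c1 c2 c3 c4 ne d cr; apply/negP => cr';
    apply: ne; congr pair; lia.
have crz : crosses (flip_diag b p q s t) (x r).
  by rewrite e /crosses /flip_diag; case: (b) => /=; lia.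
have self z : ~~ crosses z z by rewrite /crosses; lia.
rewrite /flip; split=> [i|i j|i j].
- by case: ifP.
- have [hi|hi] := eqVneq i r; have [hj|hj] := eqVneq j r; rewrite ?self ?nx //.
    by rewrite crossesC key.
  by rewrite key.
have [hi|hi] := eqVneq i r; have [hj|hj] := eqVneq j r; rewrite ?hi ?hj //; last exact: ix.
  by move=> e'; have := nx j r; rewrite -e' crz.
by move=> e'; have := nx i r; rewrite e' crz.
Qed.

(** A new diagonal has to cross [x r], by maximality, but none of the four sides. *)
Lemma flip_unique x x' r b p q s t : tri x -> tri x' -> quad x r b p q s t ->
  (forall j, j != r -> x' j = x j) -> x' r <> x r -> x' r = flip_diag b p q s t.
Proof.
move=> tx tx' qx ej ne; have [dx nx ix] := tx; have [dx' nx' ix'] := tx'.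
have [h1 h2 e [s1 s2] [s3 s4]] := qx.
have cr : crosses (x r) (x' r).
  apply: contraT => ncr; case: ne; have [|i ei] := tri_max tx (dx' r).
    by move=> i; have [->//|nir] := eqVneq i r; rewrite -ej // nx'.
  have [eir|nir] := eqVneq i r; first by rewrite -ei eir.
  by move: ei; rewrite -ej // => /ix' ei; rewrite ei eqxx in nir.
have nc z : sideT x z -> z <> x r -> ~~ crosses z (x' r).
  move=> sz nz; apply: sideT_nc tx sz (dx' r) _ => i ei.
  have nir : i != r by apply: contra_not_neq nz => eir; rewrite -ei eir.
  by rewrite -ej // nx'.
have := nc _ s1; have := nc _ s2; have := nc _ s3; have := nc _ s4; move: cr.
have := dx' r; rewrite e /crosses /is_diag /flip_diag; case: (x' r) => u v.
have np (u1 v1 u2 v2 : nat) : u1 != u2 \/ v1 != v2 -> (u1, v1) <> (u2, v2).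
  by move=> h [] e1 e2; case: h => /eqP.
case: b {qx e} => /= d cr.
  move=> /(_ (np _ _ _ _ _)) c4 /(_ (np _ _ _ _ _)) c3 /(_ (np _ _ _ _ _)) c2 /(_ (np _ _ _ _ _)) c1.
  have {}c1 : _ := c1 ltac:(right; lia). have {}c2 : _ := c2 ltac:(left; lia).
  have {}c3 : _ := c3 ltac:(left; lia). have {}c4 : _ := c4 ltac:(right; lia).
  congr pair; lia.
move=> /(_ (np _ _ _ _ _)) c4 /(_ (np _ _ _ _ _)) c3 /(_ (np _ _ _ _ _)) c2 /(_ (np _ _ _ _ _)) c1.
have {}c1 : _ := c1 ltac:(left; lia). have {}c2 : _ := c2 ltac:(right; lia).
have {}c3 : _ := c3 ltac:(left; lia). have {}c4 : _ := c4 ltac:(left; lia).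
congr pair; lia.
Qed.

End Triangulations.

(** * Cluster tilting objects are triangulations *)

Section SumIso.
Local Open Scope ring_scope.
Variables (k : fieldType) (O : Type) (C : lincat k O).

Lemma dsum_iso (I : finType) (S : dsum C I) (F : I -> O) :
  (forall i, isomorphic C (F i) (S i)) ->
  exists S' : dsum C I, (forall i, S' i = F i) /\ total S' = total S.
Proof.
move=> h.
have [u uP] : exists u : forall i, (Hom C (F i) (S i) * Hom C (S i) (F i))%type,
    forall i, (u i).2 \oc (u i).1 = idm _ /\ (u i).1 \oc (u i).2 = idm _.
  apply: (@fin_all_exists I _ (fun i (u : (Hom C (F i) (S i) * Hom C (S i) (F i))%type) =>
    u.2 \oc u.1 = idm _ /\ u.1 \oc u.2 = idm _)) => i.
  by have [f [g fg]] := h i; exists (f, g).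
pose ii i : Hom C (F i) (total S) := inj S i \oc (u i).1.
pose pp i : Hom C (total S) (F i) := (u i).2 \oc prj S i.
have h1 i : pp i \oc ii i = idm _.
  by rewrite /pp /ii -compmA (compmA (prj S i)) prj_inj comp1m; case: (uP i).
have h2 i j : i != j -> pp j \oc ii i = 0.
  by move=> ne; rewrite /pp /ii -compmA (compmA (prj S j)) prj_inj0 // comp0l comp0r.
have h3 : \sum_i ii i \oc pp i = idm (total S).
  rewrite -inj_prj; apply: eq_bigr => i _.
  by rewrite /pp /ii -compmA (compmA (u i).1); case: (uP i) => _ ->; rewrite comp1m.
by exists (DSum h1 h2 h3).
Qed.
End SumIso.

Section Tilting.
Local Open Scope ring_scope.
Variables (k : fieldType) (n : nat).
Local Notation Q := (linear_An n).
Variable C : cluster_category k Q.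
Local Notation cx := (cplx k Q).
Local Notation D := (cl_der C).
Local Notation DC := (der_cat (cl_der C)).
Local Notation CC := (cl_cat C).
Local Notation F := (cl_F C).
Local Notation pi := (orb_proj (cl_orb C)).
Local Notation sh := (sh (cl_shift C)).
Local Notation seg_obj := (@seg_obj k n).
Local Notation labelled := (@labelled k n C).

(** In the cluster category the shift is the Auslander-Reiten translation: [tau]
    is the rotation of the polygon that lowers every vertex by one. *)
Definition tau_seg (y : nat * nat) : nat * nat :=
  if y.1 == 0%N then (y.2.-1, n.+2) else (y.1.-1, y.2.-1).

Lemma tau_seg_diag y : is_diag n y -> is_diag n (tau_seg y).
Proof. by case: y => i j; rewrite /is_diag /tau_seg /=; case: eqP => /=; lia. Qed.

Lemma hom_seg_tau x y : is_diag n x -> is_diag n y -> hom_seg n x (tau_seg y) = crosses x y.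
Proof.
case: x y => [i j] [i' j']; rewrite /is_diag /hom_seg /hom_seg0 /hom_seg1 /crosses /tau_seg /=.
by case: eqP => /=; lia.
Qed.

Lemma shift_lab_Fpow i (l : label n) : proper l -> shift_lab (Fpow i l) = Fpow i (shift_lab l).
Proof.
have sF (l' : label n) : shift_lab (F_lab l') = F_lab (shift_lab l').
  by apply: label_eq => //=; case: ifP; lia.
have sB (l' : label n) : shift_lab (Finv_lab l') = Finv_lab (shift_lab l').
  by apply: label_eq => //=; case: ifP; lia.
move=> pl; case: i => m; first by elim: m => //= m IH; rewrite sF IH.
by elim: m => [|m IH] //=; rewrite sB //; congr Finv_lab.
Qed.

Lemma shift_lab_seg y : is_diag n y -> shift_lab (seg_lab n y) = seg_lab n (tau_seg y) \/ shift_lab (seg_lab n y) = F_lab (seg_lab n (tau_seg y)).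
Proof.
case: y => i j; rewrite /is_diag /= => h; rewrite /tau_seg /=; case: eqP => i0; [left|right].
  have e1 : (j <= n.+1)%N by lia.
  have e2 : (j.-1 <= n)%N by lia.
  by apply: label_eq; rewrite /= e1 ltnn ?e2; lia.
have e2 : (j.-1 <= n.+1)%N by lia.
have e3 : (i <= n)%N by lia.
case: (leqP j n.+1) => hj.
  have e4 : (minn j.-1.-1 n < n)%N by lia.
  have e5 : (j <= n.+1)%N = true by rewrite hj.
  by apply: label_eq; rewrite /= e2 e4 e5; lia.
have e4 : (minn j.-1.-1 n < n)%N = false by lia.
have e5 : (j <= n.+1)%N = false by lia.
by apply: label_eq; rewrite /= e2 e4 e5 ?e3; lia.
Qed.

Lemma shift_label i y : is_diag n y -> labelled (shift (Pcx k (Fpow i (seg_lab n y)))) (tau_seg y).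
Proof.
move=> dy; have py := diag_proper dy; have pt := diag_proper (tau_seg_diag dy).
apply: iso_trans (pi_iso (shift_Pcx D _)) _; rewrite shift_lab_Fpow //.
apply: iso_trans (Fpow_ciso C i _) _; first exact: py.
by have [->|->] := shift_lab_seg dy; [exact: iso_refl | exact: F_lab_ciso].
Qed.

(** Two crossing diagonals give a nonzero extension, since [Hom(x, tau y)] is nonzero
    exactly when [x] and [y] cross ([hom_seg_tau]). *)
Lemma ct_tri (T : dsum CC 'I_n) : cluster_tilting T ->
  exists x, tri x /\ forall i, labelled (T i) (x i).
Proof.
move=> [indT isoT extT].
have [x xP] : exists x : 'I_n -> nat * nat, forall i, is_diag n (x i) /\ labelled (T i) (x i).
  apply: (@fin_all_exists _ _ (fun i z => is_diag n z /\ labelled (T i) z)) => i.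
  by have [z dz lz] := indec_label (indT i); exists z.
exists x; split; last by move=> i; case: (xP i).
split=> [i|i j|i j e]; first by case: (xP i).
  apply/negP => cr; have [dxi li] := xP i; have [dxj lj] := xP j.
  have rt a : retract CC (seg_obj (x a)) (total T).
    have [_ la] := xP a; apply: (@retract_trans _ _ _ _ (T a)).
      by apply: iso_retract; apply: iso_sym.
    by exists (inj T a), (prj T a); exact: prj_inj.
  have [a [u [v vu]]] := D_retract_of_C dxi (rt i).
  have [b [u' [v' vu']]] := D_retract_of_C dxj (rt j).
  have la : labelled (Pcx k (Fpow a (seg_lab n (x i)))) (x i).
    by apply: Fpow_ciso; apply: diag_proper.
  have lb := shift_label b dxj.
  have h : hom_seg n (x i) (tau_seg (x j)) by rewrite hom_seg_tau.
  have [f f0 _] := lab_span la lb (diag_seg dxi) (diag_seg (tau_seg_diag dxj)) h.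
  apply: f0.
  pose su : Hom CC (shift (Pcx k (Fpow b (seg_lab n (x j))))) (shift (total T)) := fmap pi (fmap sh u').
  pose sv : Hom CC (shift (total T)) (shift (Pcx k (Fpow b (seg_lab n (x j))))) := fmap pi (fmap sh v').
  have e1 : sv \oc su = idm _.
    by rewrite /sv /su pi_comp -fmap_comp vu' !fmap1.
  have e2 : (fmap pi v : Hom CC _ _) \oc fmap pi u = idm _.
    by rewrite pi_comp vu fmap1.
  rewrite -[f]comp1m -e1 -[_ \oc f]compm1 -e2.
  have -> : sv \oc su \oc f \oc ((fmap pi v : Hom CC _ _) \oc fmap pi u)
      = sv \oc (su \oc f \oc fmap pi v) \oc fmap pi u by rewrite !compmA.
  by rewrite (extT (su \oc f \oc fmap pi v)) comp0r comp0l.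
apply/eqP; apply: contraT => ne; case: (isoT _ _ ne).
have [_ li] := xP i; have [_ lj] := xP j.
by apply: iso_trans li _; rewrite e; apply: iso_sym.
Qed.

Lemma tri_ct x (G : 'I_n -> cx) : tri x -> (forall i, labelled (G i) (x i)) ->
  exists T : dsum CC 'I_n, (forall i, T i = G i) /\ cluster_tilting T.
Proof.
move=> [dx nx ix] lG.
have [|S SP] := dsum_seq (D_has0 D) _ (fun i => seg_obj (x i)).
  by move=> X Y; have [S [S1 S2 _]] := D_sum2 D X Y; exists S.
have [S' [tS' S'P]] := fmap_dsum pi S.
have [T [TG tT]] := @dsum_iso _ _ CC _ S' G (fun i => ltac:(rewrite S'P SP; exact: lG)).
exists T; split=> //; split=> [i|i j ne iso_ij|].
- by apply: brick_indec; rewrite TG; apply: (lab_brick (lG i)).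
- rewrite !TG in iso_ij; have e := lab_inj (lG i) (iso_trans iso_ij (lG j)) (dx i) (dx j).
  by move/ix: e => e; rewrite e eqxx in ne.
rewrite tT tS' => f.
have e1 : \sum_i (fmap pi (inj S i) : Hom CC _ _) \oc fmap pi (prj S i) = idm (total S).
  by under eq_bigr => i _ do rewrite pi_comp; rewrite -(fmap_sum pi) inj_prj fmap1.
have e2 : \sum_i (fmap pi (fmap sh (inj S i)) : Hom CC _ _) \oc fmap pi (fmap sh (prj S i))
   = idm (shift (total S)).
  under eq_bigr => i _ do rewrite pi_comp -fmap_comp.
  by rewrite -(fmap_sum pi) -(fmap_sum sh) inj_prj !fmap1.
rewrite -[f]comp1m -e2 comp_suml big1 // => i _.
rewrite -[_ \oc f]compm1 -e1 comp_sumr big1 // => j _.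
set a : Hom CC _ _ := fmap pi (fmap sh (inj S i)); set b : Hom CC _ _ := fmap pi (fmap sh (prj S i)).
set c : Hom CC _ _ := fmap pi (inj S j); set d : Hom CC _ _ := fmap pi (prj S j).
have -> : a \oc b \oc f \oc (c \oc d) = a \oc (b \oc f \oc c) \oc d by rewrite !compmA.
have lj : labelled (S j) (x j) by rewrite SP; exact: iso_refl.
have li : labelled (shift (S i)) (tau_seg (x i)) by rewrite SP; apply: (@shift_label 0).
rewrite (lab_none lj li _ _ _ (b \oc f \oc c)) ?comp0r ?comp0l ?diag_seg ?tau_seg_diag //.
by rewrite hom_seg_tau.
Qed.

End Tilting.

(** * The quiver of an endomorphism algebra with thin homomorphism spaces *)

Section ThinEndQuiver.
Local Open Scope ring_scope.
Variables (k : fieldType) (O : Type) (C : lincat k O).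
Variables (I : finType) (S : dsum C I) (H : rel I) (K : I -> I -> I -> bool).
Hypothesis brickS : forall i, brick C (S i).
Hypothesis homS0 : forall i j, ~~ H i j -> forall f : Hom C (S i) (S j), f = 0.
Hypothesis homS1 : forall i j, H i j ->
  exists2 e : Hom C (S i) (S j), e <> 0 & forall f, exists s, f = s *: e.
Hypothesis compS : forall i j l (f : Hom C (S i) (S j)) (g : Hom C (S j) (S l)),
  f <> 0 -> g <> 0 -> (K i j l -> g \oc f <> 0) /\ (~~ K i j l -> g \oc f = 0).
Hypothesis K_H : forall i j l, K i j l -> [/\ H i j, H j l & H i l].
Hypothesis K_self : forall i j, K i j i -> i = j.

(** There is an arrow [i -> j] exactly when there are homomorphisms which do not
    factor through a third summand. *)
Definition irred i j : bool :=
  [&& i != j, H i j & [forall l, [|| l == i, l == j | ~~ K i l j]]].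

Local Notation T := (total S).

Lemma compS0 i j l (f : Hom C (S i) (S j)) (g : Hom C (S j) (S l)) :
  ~~ K i j l -> g \oc f = 0.
Proof.
move=> nK; have [->|/eqP f0] := eqVneq f 0; first by rewrite comp0r.
have [->|/eqP g0] := eqVneq g 0; first by rewrite comp0l.
by have [_ ->] := compS f0 g0.
Qed.

Lemma rad_off i j (f : Hom C (S i) (S j)) : i != j -> rad (inj S j \oc f \oc prj S i).
Proof.
move=> ne g; pose u : Hom C T T := g \oc (inj S j \oc f \oc prj S i).
have uu : u \oc u = 0.
  have -> : u \oc u = g \oc inj S j \oc (f \oc ((prj S i \oc g \oc inj S j) \oc f)) \oc prj S i.
    by rewrite /u !compmA.
  have nK : ~~ K i j i by apply/negP => /K_self e; rewrite e eqxx in ne.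
  by rewrite (compS0 f (prj S i \oc g \oc inj S j) nK) !comp0r comp0l.
exists (idm T + u); rewrite -/u; split.
  by rewrite compDl !compBr comp1m compm1 comp1m uu subr0 subrK.
by rewrite compDr !compBl comp1m compm1 comp1m uu subr0 subrK.
Qed.

(** As [S i] is a brick, a nonzero diagonal entry would be invertible. *)
Lemma rad_diag i (f : Hom C T T) : rad f -> prj S i \oc f \oc inj S i = 0.
Proof.
move=> rf; have [nz b] := brickS i; have [c ec] := b (prj S i \oc f \oc inj S i).
have [c00|c0] := eqVneq c 0; first by rewrite ec c00 scale0r.
have [w [w1 _]] := rf (c^-1 *: (inj S i \oc prj S i)).
case: nz; rewrite /zero_obj -(prj_inj S) -[inj S i]comp1m -w1.
rewrite -(compmA w) compBl comp1m !compZl.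
have -> : inj S i \oc prj S i \oc f \oc inj S i = inj S i \oc (prj S i \oc f \oc inj S i).
  by rewrite !compmA.
by rewrite ec compZr compm1 scalerA mulVf // scale1r subrr !comp0r.
Qed.

Lemma corner_eq i j (f : Hom C T T) : f = idem S j \oc f \oc idem S i ->
  f = inj S j \oc (prj S j \oc f \oc inj S i) \oc prj S i.
Proof. by move=> e; rewrite {1}e /idem !compmA. Qed.

Lemma corner_idem i j (f : Hom C (S i) (S j)) :
  inj S j \oc f \oc prj S i = idem S j \oc (inj S j \oc f \oc prj S i) \oc idem S i.
Proof.
rewrite /idem !compmA -(compmA (inj S j) (prj S j) (inj S j)) prj_inj compm1.
by rewrite -!compmA (compmA (prj S i)) prj_inj comp1m.
Qed.

Let U i j (f : Hom C T T) := rad f /\ f = idem S j \oc f \oc idem S i.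

(** A factorisation of [f] into two radical maps passes through a third summand,
    where the composites vanish. *)
Lemma rad2_irred i j (f : Hom C T T) : irred i j -> U i j f -> rad2 f -> f = 0.
Proof.
move=> /and3P[ne hij /forallP nK] [_ /corner_eq ef] [m [u [v [ru rv e]]]].
rewrite ef {1}e comp_sumr comp_suml big1 ?comp0r ?comp0l // => l _.
rewrite -(compm1 (u l)) -(inj_prj S) !(comp_sumr, comp_suml) big1 // => s _.
have -> : prj S j \oc (u l \oc (inj S s \oc prj S s) \oc v l) \oc inj S i
   = (prj S j \oc u l \oc inj S s) \oc (prj S s \oc v l \oc inj S i) by rewrite !compmA.
have [es|nes] := eqVneq s i; first by subst s; rewrite rad_diag ?comp0r.
have [es'|nes'] := eqVneq s j; first by subst s; rewrite (rad_diag _ (ru l)) comp0l.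
by apply: compS0; have := nK s; rewrite (negPf nes) (negPf nes').
Qed.

Lemma rad2_0 : rad2 (0 : Hom C T T).
Proof. by exists 0%N, (fun=> 0), (fun=> 0); split=> [[]//|[]//|]; rewrite big_ord0. Qed.

Lemma rad2_reducible i j (f : Hom C T T) : ~~ irred i j -> U i j f -> rad2 f.
Proof.
move=> nI [rf ef]; have ef' := corner_eq ef.
have [e|ne] := eqVneq i j.
  by subst j; rewrite ef' rad_diag // comp0r comp0l; exact: rad2_0.
move: nI; rewrite /irred ne /= negb_and => /orP[nh|].
  by rewrite ef' (homS0 nh (prj S j \oc f \oc inj S i)) comp0r comp0l; exact: rad2_0.
rewrite negb_forall => /existsP[s]; rewrite !negb_or negbK => /and3P[si sj Ks].
have [his hsj hij] := K_H Ks.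
have [a a0 _] := homS1 his; have [b b0 _] := homS1 hsj; have [e e0 eS] := homS1 hij.
have [/(_ Ks) ba0 _] := compS a0 b0.
have [c ec] := eS (b \oc a); have [d ed] := eS (prj S j \oc f \oc inj S i).
have c0 : c != 0 by apply: contra_not_neq ba0 => c0; rewrite ec c0 scale0r.
exists 1%N, (fun=> inj S j \oc b \oc prj S s),
  (fun=> inj S s \oc ((d / c) *: a) \oc prj S i); split=> [_|_|].
- exact: rad_off.
- by apply: rad_off; rewrite eq_sym.
rewrite big_ord1 {1}ef' ed.
have -> : inj S j \oc b \oc prj S s \oc (inj S s \oc ((d / c) *: a) \oc prj S i)
  = inj S j \oc (b \oc (prj S s \oc inj S s) \oc ((d / c) *: a)) \oc prj S i.
  by rewrite !compmA.
by rewrite prj_inj compm1 (compZr (d / c) b a) ec scalerA divfK.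
Qed.

Lemma end_quiver_irred i j m : end_quiver S i j m <-> m = irred i j.
Proof.
rewrite /end_quiver -/(U i j).
have [ir|nir] := boolP (irred i j); last first.
  split=> [[b [bU bP]]|->]; last first.
    exists (fun=> 0); split=> [[]//|v vU]; exists 0; split=> [|c _].
      by rewrite big_ord0 subr0; apply: (rad2_reducible nir vU).
    by apply/rowP => [[]].
  case: m b bU bP => // m b bU bP.
  have U0 : U i j 0.
    split=> [g|]; last by rewrite comp0r comp0l.
    by rewrite comp0r subr0; exists (idm T); rewrite comp1m.
  have [c [_ cu]] := bP 0 U0.
  have c1 : c = 0.
    apply: cu; rewrite big1 ?subr0; first exact: rad2_0.
    by move=> l _; rewrite mxE scale0r.
  have c2 : c = - delta_mx 0 0.
    apply: cu; rewrite (bigD1 0) //= big1 ?addr0.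
      by rewrite !mxE eqxx scaleN1r opprK add0r; apply: (rad2_reducible nir (bU 0)).
    by move=> l ne; rewrite !mxE (negPf ne) oppr0 scale0r.
  have := congr1 (fun A : 'rV[k]_m.+1 => A 0 0) c2; rewrite c1 !mxE !eqxx /= => /eqP.
  by rewrite eq_sym oppr_eq0 oner_eq0.
have /and3P[ne hij _] := ir; have [e0 e0n eS] := homS1 hij.
pose e := inj S j \oc e0 \oc prj S i.
have e_n0 : e <> 0.
  move=> z; apply: e0n; rewrite -[e0]comp1m -[_ \oc e0]compm1 -!(prj_inj S).
  have -> : prj S j \oc inj S j \oc e0 \oc (prj S i \oc inj S i) = prj S j \oc e \oc inj S i.
    by rewrite /e !compmA.
  by rewrite z comp0r comp0l.
have Ue s : U i j (s *: e).
  have -> : s *: e = inj S j \oc (s *: e0) \oc prj S i by rewrite compZr compZl.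
  by split; [exact: rad_off | exact: corner_idem].
have US v : U i j v -> exists s, v = s *: e.
  move=> [_ /corner_eq ev]; have [s es] := eS (prj S j \oc v \oc inj S i).
  by exists s; rewrite ev es compZr compZl.
have W0 s : rad2 (s *: e) -> s = 0.
  move=> w; have /eqP := rad2_irred ir (Ue s) w.
  by rewrite scaler_eq0 => /orP[/eqP//|/eqP/e_n0].
split=> [[b [bU bP]]|->]; last first.
  exists (fun=> e); split=> [_|v /US[s ->]]; first by rewrite -[e]scale1r.
  exists (const_mx s); split=> [|c]; rewrite big_ord1.
    by rewrite mxE subrr; exact: rad2_0.
  rewrite -scalerBl => /W0/eqP; rewrite subr_eq0 => /eqP es.
  by apply/rowP => l; rewrite !mxE ord1 es.
have [bt btP] : exists bt : 'I_m -> k, forall l, b l = bt l *: e.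
  by apply: (@fin_all_exists _ _ (fun l s => b l = s *: e)) => l; apply: US.
have sumE (c : 'rV[k]_m) : \sum_l c 0 l *: b l = (c *m \col_l bt l) 0 0 *: e.
  rewrite mxE scaler_suml; apply: eq_bigr => l _.
  by rewrite btP scalerA mxE.
case: m b bU bP bt btP sumE => [|[|m]] b bU bP bt btP sumE //.
  have [c [w _]] := bP e (eq_ind _ (U i j) (Ue 1) _ (scale1r e)).
  by move: w; rewrite big_ord0 subr0 -[e]scale1r => /W0/eqP; rewrite oner_eq0.
have kz : kermx (\col_l bt l) != 0.
  rewrite -mxrank_eq0 mxrank_ker subn_eq0 -ltnNge.
  by apply: leq_ltn_trans (rank_leq_col _) _.
have [l hl] : exists l, row l (kermx (\col_l bt l)) != 0.
  apply/existsP; apply: contraR kz; rewrite negb_exists => /forallP h.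
  by apply/eqP/row_matrixP => l; rewrite row0; apply/eqP; rewrite -[_ == _]negbK.
have [c [_ cu]] := bP 0 (eq_ind _ (U i j) (Ue 0) _ (scale0r e)).
have c1 : c = 0.
  by apply: cu; rewrite sumE mul0mx mxE scale0r subr0; exact: rad2_0.
have c2 : c = row l (kermx (\col_l bt l)).
  apply: cu; rewrite sumE -row_mul mulmx_ker row0 mxE scale0r subr0; exact: rad2_0.
by rewrite -c2 c1 eqxx in hl.
Qed.

End ThinEndQuiver.

(** * Irreducible maps and the sides of a quadrilateral *)

Section QuadSides.
Variable n : nat.
Implicit Types (x : 'I_n -> nat * nat) (y z : nat * nat).

(** The sides of the quadrilateral [p < q < s < t] from which one rotates into
    the diagonal [(p, s)], if [b], or [(q, t)]. *)
Definition in_side (b : bool) (p q s t : nat) (c : bool) : nat * nat :=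
  if b then (if c then (p, q) else (s, t)) else (if c then (q, s) else (p, t)).
Definition quad_diag (b : bool) (p q s t : nat) : nat * nat := if b then (p, s) else (q, t).

(** What every diagonal of the triangulation satisfies. *)
Definition nc4 p q s t y : Prop :=
  [/\ ~~ crosses (p, q) y, ~~ crosses (q, s) y, ~~ crosses (s, t) y & ~~ crosses (p, t) y].

(** Confines every other diagonal of a triangulation to one of the four regions
    outside a quadrilateral; in each region what follows is arithmetic. *)
Lemma region b p q s t u v : p < q < s -> s < t -> u < v -> nc4 p q s t (u, v) ->
  ~~ crosses (u, v) (quad_diag b p q s t) -> (u, v) <> quad_diag b p q s t ->
  [\/ p <= u /\ v <= q, q <= u /\ v <= s, s <= u /\ v <= t
    | (u <= p \/ t <= u) /\ (v <= p \/ t <= v)].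
Proof.
rewrite /crosses /quad_diag /= => h1 h2 uv [/= n1 n2 n3 n4] n5 ne.
have ne' : ~~ ((u == (quad_diag b p q s t).1) && (v == (quad_diag b p q s t).2)).
  by apply/negP => /andP[/eqP e1 /eqP e2]; apply: ne; rewrite e1 e2 /quad_diag; case: (b).
move: n1 n2 n3 n4; rewrite /crosses /= => n1 n2 n3 n4.
have [up|up] := leqP u p.
  have [vp|vp] := leqP v p; first by constructor 4; lia.
  have [tv|tv] := leqP t v; first by constructor 4; lia.
  have -> : u = p by clear n5 ne'; lia.
  have [vq|vq] := leqP v q; first by constructor 1; lia.
  by case: b n5 ne ne' => /= n5 ne ne'; exfalso; lia.
have [uq|uq] := ltnP u q.
  by have [vq|vq] := leqP v q; [constructor 1; lia | exfalso; clear n5 ne'; lia].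
have [us|us] := ltnP u s.
  have [vs|vs] := leqP v s; first by constructor 2; lia.
  by case: b n5 ne ne' => /= n5 ne ne'; exfalso; lia.
have [ut|ut] := ltnP u t; last by constructor 4; lia.
by have [vt|vt] := leqP v t; [constructor 3; lia | exfalso; clear n5 ne'; lia].
Qed.

(** The combinatorial content of an approximation: every map into the diagonal of the
    quadrilateral factors through one of two opposite sides. *)
Lemma factor_in b p q s t y : p < q < s -> s < t <= n + 2 -> is_diag n (quad_diag b p q s t) ->
  is_diag n y -> nc4 p q s t y -> ~~ crosses y (quad_diag b p q s t) -> y <> quad_diag b p q s t ->
  hom_seg n y (quad_diag b p q s t) ->
  exists c, y = in_side b p q s t c \/ comp_seg n y (in_side b p q s t c) (quad_diag b p q s t).
Proof.
case: y => u v h1 /andP[h2 h2'] d1 d2 n4 n5 ne hc.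
have uv : u < v by move: d2; rewrite /is_diag /=; lia.
have R := region h1 h2 uv n4 n5 ne; clear n4 n5 ne.
suff [c /orP[/andP[/eqP-> /eqP->]|h]] : exists c,
   ((u == (in_side b p q s t c).1) && (v == (in_side b p q s t c).2))
   || comp_seg n (u, v) (in_side b p q s t c) (quad_diag b p q s t).
- by exists c; left; case: (in_side _ _ _ _ _ _).
- by exists c; right.
move: d1 d2 hc; rewrite /is_diag /hom_seg /hom_seg0 /hom_seg1 /comp_seg /hom_seg0 /hom_seg1 /quad_diag /in_side.
case: b => /= d1 d2 /orP[hc|hc]; case: R => -[r1 r2]; try (exfalso; lia).
all: first [by exists true => /=; lia | by exists false => /=; lia].
Qed.

Lemma factor_out b p q s t y : p < q < s -> s < t <= n + 2 -> is_diag n (quad_diag b p q s t) ->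
  is_diag n y -> nc4 p q s t y -> ~~ crosses y (quad_diag b p q s t) -> y <> quad_diag b p q s t ->
  hom_seg n (quad_diag b p q s t) y ->
  exists c, y = in_side (~~ b) p q s t c \/ comp_seg n (quad_diag b p q s t) (in_side (~~ b) p q s t c) y.
Proof.
case: y => u v h1 /andP[h2 h2'] d1 d2 n4 n5 ne hc.
have uv : u < v by move: d2; rewrite /is_diag /=; lia.
have R := region h1 h2 uv n4 n5 ne; clear n4 n5 ne.
suff [c /orP[/andP[/eqP-> /eqP->]|h]] : exists c,
   ((u == (in_side (~~ b) p q s t c).1) && (v == (in_side (~~ b) p q s t c).2))
   || comp_seg n (quad_diag b p q s t) (in_side (~~ b) p q s t c) (u, v).
- by exists c; left; case: (in_side _ _ _ _ _ _).
- by exists c; right.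
move: d1 d2 hc; rewrite /is_diag /hom_seg /hom_seg0 /hom_seg1 /comp_seg /hom_seg0 /hom_seg1 /quad_diag /in_side.
case: b => /= d1 d2 /orP[hc|hc]; case: R => -[r1 r2]; try (exfalso; lia).
all: first [by exists true => /=; lia | by exists false => /=; lia].
Qed.

Lemma in_side_hom b p q s t c : p < q < s -> s < t <= n + 2 -> is_diag n (quad_diag b p q s t) ->
  is_diag n (in_side b p q s t c) -> hom_seg n (in_side b p q s t c) (quad_diag b p q s t).
Proof. by case: b; case: c; rewrite /is_diag /quad_diag /in_side /hom_seg /hom_seg0 /hom_seg1 /=; lia. Qed.

Lemma out_side_hom b p q s t c : p < q < s -> s < t <= n + 2 -> is_diag n (quad_diag b p q s t) ->
  is_diag n (in_side (~~ b) p q s t c) -> hom_seg n (quad_diag b p q s t) (in_side (~~ b) p q s t c).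
Proof. by case: b; case: c; rewrite /is_diag /quad_diag /in_side /hom_seg /hom_seg0 /hom_seg1 /=; lia. Qed.

Lemma in_side_opp b p q s t c : p < q < s -> s < t <= n + 2 ->
  ~~ hom_seg n (in_side b p q s t c) (in_side b p q s t (~~ c)).
Proof. by case: b; case: c; rewrite /in_side /hom_seg /hom_seg0 /hom_seg1 /=; lia. Qed.

Lemma in_side_irred b p q s t c y : p < q < s -> s < t <= n + 2 ->
  is_diag n y -> nc4 p q s t y -> ~~ crosses y (quad_diag b p q s t) ->
  comp_seg n (in_side b p q s t c) y (quad_diag b p q s t) ->
  y = in_side b p q s t c \/ y = quad_diag b p q s t.
Proof.
case: y => u v h1 /andP[h2 h2'] d n4 n5 hk; apply: NNPP => /not_or_and[ne1 ne].
have uv : u < v by move: d; rewrite /is_diag /=; lia.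
have R := region h1 h2 uv n4 n5 ne; clear n4 n5 ne.
case: ne1; suff /andP[/eqP-> /eqP->] :
   (u == (in_side b p q s t c).1) && (v == (in_side b p q s t c).2) by case: (in_side _ _ _ _ _ _).
move: d hk; rewrite /is_diag /comp_seg /hom_seg0 /hom_seg1 /quad_diag /in_side.
by case: b; case: c => /= d /or3P[] hk; case: R => -[r1 r2]; lia.
Qed.

Lemma out_side_irred b p q s t c y : p < q < s -> s < t <= n + 2 ->
  is_diag n y -> nc4 p q s t y -> ~~ crosses y (quad_diag b p q s t) ->
  comp_seg n (quad_diag b p q s t) y (in_side (~~ b) p q s t c) ->
  y = in_side (~~ b) p q s t c \/ y = quad_diag b p q s t.
Proof.
case: y => u v h1 /andP[h2 h2'] d n4 n5 hk; apply: NNPP => /not_or_and[ne1 ne].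
have uv : u < v by move: d; rewrite /is_diag /=; lia.
have R := region h1 h2 uv n4 n5 ne; clear n4 n5 ne.
case: ne1; suff /andP[/eqP-> /eqP->] :
   (u == (in_side (~~ b) p q s t c).1) && (v == (in_side (~~ b) p q s t c).2)
  by case: (in_side _ _ _ _ _ _).
move: d hk; rewrite /is_diag /comp_seg /hom_seg0 /hom_seg1 /quad_diag /in_side.
by case: b; case: c => /= d /or3P[] hk; case: R => -[r1 r2]; lia.
Qed.

Lemma in_side_ne b p q s t c : p < q < s -> s < t <= n + 2 ->
  in_side b p q s t c <> quad_diag b p q s t /\ in_side (~~ b) p q s t c <> quad_diag b p q s t.
Proof.
by move=> h1 h2; case: b; case: c; rewrite /in_side /quad_diag /=; split=> -[] *; lia.
Qed.

(** The arrows of the quiver of [End T], for any [T] labelled by [x]. *)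
Definition irredx x : rel 'I_n :=
  irred (fun i j => hom_seg n (x i) (x j)) (fun i j l => comp_seg n (x i) (x j) (x l)).

Definition on_side x (b : bool) p q s t i : bool :=
  (x i == in_side b p q s t true) || (x i == in_side b p q s t false).

Lemma on_sideP x b p q s t i :
  reflect (exists c, x i = in_side b p q s t c) (on_side x b p q s t i).
Proof.
apply: (iffP orP) => [[/eqP e|/eqP e]|[[] ->]]; [by exists true|by exists false| |].
  by left.
by right.
Qed.

Lemma comp_seg_hom y z w : comp_seg n y z w -> [/\ hom_seg n y z, hom_seg n z w & hom_seg n y w].
Proof. by rewrite /comp_seg /hom_seg => /or3P[] /and3P[-> -> ->]; rewrite ?orbT. Qed.

Lemma in_side_seg b p q s t c : p < q < s -> s < t <= n + 2 -> is_seg n (in_side b p q s t c).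
Proof. by case: b; case: c; rewrite /is_seg /in_side /=; lia. Qed.

Lemma quad_side x r b p q s t b' c : quad x r b p q s t -> sideT x (in_side b' p q s t c).
Proof. by case=> _ _ _ [s1 s2] [s3 s4]; case: b'; case: c. Qed.

Lemma side_index x r b p q s t b' c : tri x -> quad x r b p q s t ->
  is_diag n (in_side b' p q s t c) -> exists2 l, x l = in_side b' p q s t c & l != r.
Proof.
move=> tx qx d; have [_ [|[l e]]] := quad_side b' c qx; first by rewrite d.
exists l => //; apply/eqP => lr; have [h1 h2 er _ _] := qx.
have [ne1 ne2] := in_side_ne b c h1 h2.
move: e; rewrite lr er => e; case: (eqVneq b' b) e => [->|nb]; first by move/esym.
have -> : b' = ~~ b by case: b b' nb {qx er ne1 ne2 d} => [] [].
by move/esym.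
Qed.

(** Any other map into [x r] factors through a side by [factor_in]; a map from a side
    itself does not factor further, by [in_side_irred]. *)
Lemma irred_in x r b p q s t i : tri x -> quad x r b p q s t ->
  irredx x i r = on_side x b p q s t i.
Proof.
move=> tx qx; have [h1 h2 er _ _] := qx; have [dx nx ix] := tx.
have dr : is_diag n (quad_diag b p q s t) by rewrite -[quad_diag _ _ _ _ _]er.
have n4 j : nc4 p q s t (x j) := quad_sides_nc j tx qx.
have er' : x r = quad_diag b p q s t by [].
apply/idP/on_sideP => [/and3P[ne hc /forallP irr]|[c e]].
  have nxe : x i <> quad_diag b p q s t by rewrite -er' => /ix e; rewrite e eqxx in ne.
  have nc : ~~ crosses (x i) (quad_diag b p q s t) by rewrite -er'.
  rewrite er' in hc.
  have [c [e|K]] := factor_in h1 h2 dr (dx i) (n4 i) nc nxe hc; first by exists c.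
  have [k1 _ _] := comp_seg_hom K.
  have [_ dsd] := hom_seg_diag (diag_seg (dx i)) (in_side_seg b c h1 h2) k1.
  have [l el lr] := side_index tx qx dsd.
  have := irr l; rewrite (negPf lr) el er' K /= orbF => /eqP li.
  by exists c; rewrite -el li.
have [ne1 _] := in_side_ne b c h1 h2.
have ir : i != r by apply: contra_not_neq ne1 => e'; rewrite -e e' er'.
have di : is_diag n (in_side b p q s t c) by rewrite -e.
apply/and3P; split=> //; first by rewrite e er' in_side_hom.
apply/forallP => l; have [//|nl] := eqVneq l i; have [//|nr] := eqVneq l r.
rewrite /=; apply/negP; rewrite e er' => K.
have nc : ~~ crosses (x l) (quad_diag b p q s t) by rewrite -er'.
have [e'|e'] := in_side_irred h1 h2 (dx l) (n4 l) nc K.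
  by rewrite -e in e'; move/ix: e' => e'; rewrite e' eqxx in nl.
by rewrite -er' in e'; move/ix: e' => e'; rewrite e' eqxx in nr.
Qed.

Lemma irred_out x r b p q s t i : tri x -> quad x r b p q s t ->
  irredx x r i = on_side x (~~ b) p q s t i.
Proof.
move=> tx qx; have [h1 h2 er _ _] := qx; have [dx nx ix] := tx.
have dr : is_diag n (quad_diag b p q s t) by rewrite -[quad_diag _ _ _ _ _]er.
have n4 j : nc4 p q s t (x j) := quad_sides_nc j tx qx.
have er' : x r = quad_diag b p q s t by [].
apply/idP/on_sideP => [/and3P[ne hc /forallP irr]|[c e]].
  have nxe : x i <> quad_diag b p q s t by rewrite -er' => /ix e; rewrite e eqxx in ne.
  have nc : ~~ crosses (x i) (quad_diag b p q s t) by rewrite -er'.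
  rewrite er' in hc.
  have [c [e|K]] := factor_out h1 h2 dr (dx i) (n4 i) nc nxe hc; first by exists c.
  have [_ k1 _] := comp_seg_hom K.
  have [dsd _] := hom_seg_diag (in_side_seg (~~ b) c h1 h2) (diag_seg (dx i)) k1.
  have [l el lr] := side_index tx qx dsd.
  have := irr l; rewrite (negPf lr) el er' K /= orbF => /eqP li.
  by exists c; rewrite -el li.
have [_ ne1] := in_side_ne b c h1 h2.
have ir : r != i by apply: contra_not_neq ne1 => e'; rewrite -e -e' er'.
have di : is_diag n (in_side (~~ b) p q s t c) by rewrite -e.
apply/and3P; split=> //; first by rewrite e er' out_side_hom.
apply/forallP => l; have [//|nr] := eqVneq l r; have [//|nl] := eqVneq l i.
rewrite /=; apply/negP; rewrite e er' => K.
have nc : ~~ crosses (x l) (quad_diag b p q s t) by rewrite -er'.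
have [e'|e'] := out_side_irred h1 h2 (dx l) (n4 l) nc K.
  by rewrite -e in e'; move/ix: e' => e'; rewrite e' eqxx in nl.
by rewrite -er' in e'; move/ix: e' => e'; rewrite e' eqxx in nr.
Qed.

End QuadSides.

(** * Minimal right approximations *)

Section Approximations.
Local Open Scope ring_scope.
Variables (k : fieldType) (O : Type) (C : lincat k O).

(** Each approximation factors through the other; minimality makes both composites
    invertible. *)
Lemma min_approx_unique (I : finType) (S : dsum C I) r B B' X X'
    (f : Hom C B X) (f' : Hom C B' X') :
  min_right_approx S r f -> min_right_approx S r f' -> isomorphic C X X' ->
  isomorphic C B B'.
Proof.
move=> [aB fB mB] [aB' fB' mB'] [u [v [vu uv]]].
have [h eh] := fB' _ aB (u \oc f); have [h' eh'] := fB _ aB' (v \oc f').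
have [w [w1 w2]] : invertible (h' \oc h).
  by apply: mB; rewrite compmA eh' -compmA eh compmA vu comp1m.
have [w' [w1' w2']] : invertible (h \oc h').
  by apply: mB'; rewrite compmA eh -compmA eh' compmA uv comp1m.
have e : w \oc h' = h' \oc w'.
  have : w \oc h' \oc (h \oc h' \oc w') = w \oc (h' \oc h) \oc (h' \oc w').
    by rewrite !compmA.
  by rewrite w1 w2' compm1 comp1m.
by exists h, (w \oc h'); split; [rewrite -compmA w1 | rewrite e compmA w2'].
Qed.

Lemma dsum_drop0 (J : finType) (S : dsum C J) (P : {pred J}) :
  (forall j, j \notin P -> zero_obj C (S j)) ->
  exists Y : dsum C 'I_#|P|, total Y = total S /\ forall l, Y l = S (enum_val l).
Proof.
move=> hz.
have p1 (l : 'I_#|P|) : prj S (enum_val l) \oc inj S (enum_val l) = idm (S (enum_val l)).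
  exact: prj_inj.
have p2 (l l' : 'I_#|P|) : l != l' -> prj S (enum_val l') \oc inj S (enum_val l) = 0.
  by move=> ne; apply: prj_inj0; apply: contraNneq ne => /enum_val_inj ->.
have p3 : \sum_(l < #|P|) inj S (enum_val l) \oc prj S (enum_val l) = idm (total S).
  rewrite -(big_enum_val (fun j => inj S j \oc prj S j)) -(inj_prj S) [RHS](bigID (mem P)) /=.
  rewrite [X in _ + X]big1 ?addr0 // => j /hz z.
  by rewrite (zero_objP z (inj S j)) comp0l.
by exists (@DSum _ _ _ _ (total S) _ _ _ p1 p2 p3).
Qed.

(** Zero summands have to be dropped, as there may be no index other than [r] to
    represent them. *)
Lemma add_rest_sum (I J : finType) (T : dsum C I) r (S : dsum C J) :
  (exists Z, zero_obj C Z) ->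
  (forall j, zero_obj C (S j) \/ exists2 i, i != r & isomorphic C (T i) (S j)) ->
  in_add_rest T r (total S).
Proof.
move=> [z0 hz0] h.
have [P' hP'] : exists P : J -> bool, forall j,
    (P j -> exists i, i != r /\ isomorphic C (T i) (S j)) /\ (~~ P j -> zero_obj C (S j)).
  apply: (@fin_all_exists _ _ (fun j (a : bool) => (a -> exists i, i != r /\ isomorphic C (T i) (S j)) /\ (~~ a -> zero_obj C (S j)))).
  by move=> j; case: (h j) => [z|[i ni e]]; [exists false|exists true]; split=> // _; exists i.
have [Y [tY eY]] : exists Y : dsum C 'I_#|P'|, total Y = total S /\ forall l, Y l = S (enum_val l).
  by apply: dsum_drop0 => j; apply: (hP' j).2.
have [c hc] : exists c : 'I_#|P'| -> I, forall l, c l != r /\ isomorphic C (T (c l)) (Y l).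
  apply: (@fin_all_exists _ _ (fun l i => i != r /\ isomorphic C (T i) (Y l))) => l.
  by rewrite eY; apply: (hP' _).1; exact: enum_valP.
have [Y' [eY' tY']] := @dsum_iso _ _ C _ Y (fun l => T (c l)) (fun l => (hc l).2).
have [|||||Z [zt zf tz]] :=
    @mk_sum2 _ _ C (total S) z0 (total S) (idm _) 0 (idm _) 0.
- by rewrite comp1m.
- by rewrite comp0l.
- by rewrite comp0l.
- by rewrite comp0r.
- by rewrite comp1m comp0l addr0.
exists #|P'|, c, Y', Z; split=> [l|||].
- by case: (hc l).
- exact: eY'.
- by rewrite tz tY' tY; apply: iso_refl.
by rewrite zt; apply: iso_refl.
Qed.

Lemma factor_add (I : finType) (T : dsum C I) r B X (f : Hom C B X) :
  (forall i, i != r -> forall g : Hom C (T i) X, exists h, f \oc h = g) ->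
  forall Z, in_add_rest T r Z -> forall g : Hom C Z X, exists h, f \oc h = g.
Proof.
move=> hf Z [m [c [Y [W [nc eY [u [v [vu uv]]] [a [a' [a'a aa']]]]]]]] g.
pose g' : Hom C (total Y) X := g \oc a \oc prj W true \oc v.
have [h hh] : exists h : forall l, Hom C (Y l) B, forall l, f \oc h l = g' \oc inj Y l.
  apply: (@fin_all_exists _ (fun l => Hom C (Y l) B) (fun l h => f \oc h = g' \oc inj Y l)) => l.
  by move: (inj Y l); rewrite eY => i; apply: hf.
exists ((\sum_l h l \oc prj Y l) \oc (u \oc inj W true \oc a')).
rewrite compmA comp_sumr.
under eq_bigr => l _ do rewrite compmA hh -compmA.
rewrite -comp_sumr inj_prj compm1 /g' -!compmA (compmA v) vu comp1m.
by rewrite (compmA (prj W true)) prj_inj comp1m aa' compm1.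
Qed.

End Approximations.

Section ClusterApproximations.
Local Open Scope ring_scope.
Variables (k : fieldType) (n : nat).
Variable C : cluster_category k (linear_An n).
Local Notation CC := (cl_cat C).
Local Notation pi := (orb_proj (cl_orb C)).
Local Notation seg_obj := (@seg_obj k n).
Local Notation labelled := (@labelled k n C).

Lemma edge_zero x : is_seg n x -> ~~ is_diag n x -> zero_obj CC (seg_obj x).
Proof. by move=> sx dx; apply: seg_obj_none => //; apply/negP => /hom_seg_diag[] // dx' _; rewrite dx' in dx. Qed.

Lemma cl_zero : exists Z, zero_obj CC Z.
Proof. by exists (seg_obj (0, 1)%N); apply: edge_zero; rewrite /is_seg /is_diag /=; lia. Qed.

Lemma cl_sum2 X Y : exists S : dsum CC bool, S true = X /\ S false = Y.
Proof.
have [S [e1 e2 _]] := D_sum2 (cl_der C) X Y; have [S' [_ h]] := fmap_dsum pi S.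
by exists S'; rewrite !h.
Qed.

(** The middle term of the exchange triangle is the sum of two opposite sides of the
    quadrilateral. It is minimal because there are no maps between opposite sides
    ([in_side_opp]), which leaves a diagonal matrix of scalars. *)
Lemma approx_ex x r b p q s t (T : dsum CC 'I_n) X :
  tri x -> quad x r b p q s t -> (forall j, j != r -> labelled (T j) (x j)) ->
  labelled X (x r) -> exists (S : dsum CC bool) (f : Hom CC (total S) X),
    (forall c, S c = seg_obj (in_side b p q s t c)) /\ min_right_approx T r f.
Proof.
move=> tx qx lT lX; have [h1 h2 er _ _] := qx; have [dx nx ix] := tx.
pose y c := in_side b p q s t c.
have [S [et ef]] := cl_sum2 (seg_obj (y true)) (seg_obj (y false)).
have eS c : S c = seg_obj (y c) by case: c.
have lS c : labelled (S c) (y c) by rewrite eS; exact: (iso_refl CC (seg_obj (y c))).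
have sy c : is_seg n (y c) by apply: in_side_seg.
have er' : x r = quad_diag b p q s t by [].
have dr : is_diag n (quad_diag b p q s t) by rewrite -er'.
have n4 j : nc4 p q s t (x j) := quad_sides_nc j tx qx.
have zS c : ~~ is_diag n (y c) -> zero_obj CC (S c) by rewrite eS; apply: edge_zero.
have [f hf] : exists f : forall c, Hom CC (S c) X, forall c, is_diag n (y c) -> f c <> 0.
  apply: (@fin_all_exists _ (fun c => Hom CC (S c) X) (fun c h => is_diag n (y c) -> h <> 0)) => c.
  have [dc|ndc] := boolP (is_diag n (y c)); last by exists 0.
  have hc : hom_seg n (y c) (x r) by rewrite er'; apply: in_side_hom.
  by have [e e0 _] := lab_span (lS c) lX (sy c) (diag_seg (dx r)) hc; exists e.
pose g := \sum_c f c \oc prj S c.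
have gS c : g \oc inj S c = f c.
  rewrite /g comp_suml (bigD1 c) //= -compmA prj_inj compm1 big1 ?addr0 // => d ne.
  by rewrite -compmA prj_inj0 ?comp0r // eq_sym.
exists S, g; split=> //; split.
- apply: (add_rest_sum cl_zero) => c.
  have [dc|ndc] := boolP (is_diag n (y c)); last by left; apply: zS.
  have [l el nl] := side_index tx qx dc; right; exists l => //.
  by apply: iso_trans (lT l nl) _; rewrite el eS; exact: (iso_refl CC (seg_obj (y c))).
- apply: factor_add => j nj h; have [hc|nhc] := boolP (hom_seg n (x j) (x r)); last first.
    by exists 0; rewrite comp0r (lab_none (lT j nj) lX (diag_seg (dx j)) (diag_seg (dx r)) nhc h).
  have [c [a ga]] : exists c (a : Hom CC (T j) (S c)), f c \oc a <> 0.
    have [c hcx] : exists c, x j = in_side b p q s t c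
       \/ comp_seg n (x j) (in_side b p q s t c) (quad_diag b p q s t).
      apply: (factor_in h1 h2 dr (dx j) (n4 j)); rewrite -?er' ?nx //.
      by move/ix => e; rewrite e eqxx in nj.
    exists c; case: hcx => [e|K].
      have dc : is_diag n (y c) by rewrite -[y c]e.
      have [u [v [_ uv]]] : isomorphic CC (T j) (S c).
        by rewrite eS /y -e; apply: lT.
      exists u => fu0; apply: (hf c dc).
      by rewrite -[f c]compm1 -uv compmA fu0 comp0l.
    have [k1 _ _] := comp_seg_hom K.
    have [_ dc] := hom_seg_diag (diag_seg (dx j)) (sy c) k1.
    have [a a0 _] := lab_span (lT j nj) (lS c) (diag_seg (dx j)) (sy c) k1.
    exists a; have [] := lab_comp (lT j nj) (lS c) lX (dx j) dc (dx r) a0 (hf c dc).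
    by rewrite er' => /(_ K).
  have [e e0 eS'] := lab_span (lT j nj) lX (diag_seg (dx j)) (diag_seg (dx r)) hc.
  have [w ew] := eS' (f c \oc a); have [w' ew'] := eS' h.
  have w0 : w != 0 by apply: contra_not_neq ga => w0; rewrite ew w0 scale0r.
  exists (inj S c \oc ((w' / w) *: a)).
  by rewrite compmA gS compZr ew scalerA divfK // ew'.
move=> h gh.
suff -> : h = idm (total S) by exists (idm _); rewrite !comp1m.
rewrite -[h]comp1m -[_ \oc h]compm1 -(inj_prj S) comp_sumr; apply: eq_bigr => d _.
have off c : c != d -> prj S c \oc h \oc inj S d = 0.
  move=> ne; have ec : c = ~~ d by case: c d ne => [] [].
  apply: (lab_none (lS d) (lS c) (sy d) (sy c)); rewrite ec; exact: in_side_opp.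
have diag : prj S d \oc h \oc inj S d = idm (S d).
  have [dd|ndd] := boolP (is_diag n (y d)); last first.
    by rewrite (zero_objP (zS d ndd) (idm _)) (zero_objP (zS d ndd) (_ \oc _)).
  have [_ /(_ (prj S d \oc h \oc inj S d))[w ew]] := lab_brick (lS d) dd.
  have e : f d = w *: f d.
    rewrite -{1}gS -gh -compmA /g comp_suml (bigD1 d) //= big1 ?addr0 => [|c ne].
      by rewrite -compmA (compmA (prj S d)) ew compZr compm1.
    by rewrite -compmA (compmA (prj S c)) off // comp0r.
  have /eqP : (1 - w) *: f d = 0 by rewrite scalerBl scale1r -e subrr.
  rewrite scaler_eq0 => /orP[|/eqP/(hf d dd)//]; rewrite subr_eq0 => /eqP w1.
  by rewrite ew -w1 scale1r.
rewrite compmA; congr (_ \oc _).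
rewrite comp_suml comp_suml (bigD1 d) //= big1 ?addr0 => [|c ne].
  by rewrite -compmA -compmA (compmA (prj S d)) diag compm1.
by rewrite -compmA -compmA (compmA (prj S c)) off // comp0r.
Qed.

End ClusterApproximations.

(** * Sums and summands of representations *)

Section RepSums.
Local Open Scope ring_scope.
Variables (k : fieldType) (Q : quiver).
Implicit Types M N : rep k Q.

Definition rep_iso M N : Prop := exists f : rhom M N, rhom_iso f.

Lemma rep_iso_refl M : rep_iso M M.
Proof. by exists (rhom1 M), (rhom1 M) => i; rewrite /= mulmx1. Qed.

Lemma rep_iso_sym M N : rep_iso M N -> rep_iso N M.
Proof. by move=> [f [g h]]; exists g, f => i; have [] := h i. Qed.

Lemma rep_iso_trans N M M' : rep_iso M N -> rep_iso N M' -> rep_iso M M'.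
Proof.
move=> [f [g h]] [f' [g' h']]; exists (rhom_mul f f'), (rhom_mul g' g) => i /=.
have [e1 e2] := h i; have [e3 e4] := h' i.
by rewrite mulmxA -(mulmxA (f i)) e3 mulmx1 mulmxA -(mulmxA (g' i)) e2 mulmx1.
Qed.

Lemma rep_iso_dim M N i : rep_iso M N -> rdim M i = rdim N i.
Proof.
by move=> [f [g /(_ i)[/mulmx1_min h1 /mulmx1_min h2]]]; apply/eqP; rewrite eqn_leq h1 h2.
Qed.

Lemma rdsum_iso (I : finType) (N : I -> rep k Q) M M' :
  rdsum N M -> rep_iso M M' -> rdsum N M'.
Proof.
move=> [u [v h]] [f [g fg]].
exists (fun l => rhom_mul (u l) f), (fun l => rhom_mul g (v l)) => i /=.
have [h1 h2 h3] := h i; have [e1 e2] := fg i; split=> [l|l l' ne|].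
- by rewrite mulmxA -(mulmxA (u l i)) e1 mulmx1.
- by rewrite mulmxA -(mulmxA (u l i)) e1 mulmx1 h2.
under eq_bigr => l _ do rewrite mulmxA -(mulmxA (g i)).
by rewrite -mulmx_suml -mulmx_sumr h3 mulmx1.
Qed.

(** Inclusions and projections form two mutually inverse block matrices; comparing
    traces would not do in positive characteristic. *)
Lemma rdsum_dim (I : finType) (N : I -> rep k Q) M i :
  rdsum N M -> rdim M i = (\sum_l rdim (N l) i)%N.
Proof.
move=> [u [v /(_ i)[h1 h2 h3]]].
pose p := #|I|; pose d (l : 'I_p) := rdim (N (enum_val l)) i.
pose U := \mxcol_(l < p) (u (enum_val l) i : 'M_(d l, rdim M i)).
pose V := \mxrow_(l < p) (v (enum_val l) i : 'M_(rdim M i, d l)).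
have sE : (\sum_l rdim (N l) i)%N = (\sum_l d l)%N.
  by rewrite /d -(big_enum_val (fun l => rdim (N l) i)).
rewrite sE; apply/eqP; rewrite eqn_leq; apply/andP; split.
  apply: (@mulmx1_min _ _ _ V U); rewrite mul_mxrow_mxcol -h3.
  by rewrite -(big_enum_val (fun l => v l i *m u l i)).
apply: (@mulmx1_min _ _ _ U V); rewrite mul_mxcol_mxrow.
rewrite -mxdiagZ; apply/eq_mxblockP => a b; case: eqVneq => [e|ne]; last first.
  by rewrite h2 //; apply: contra_neq ne => /enum_val_inj.
by subst b; rewrite h1 conform_mx_id.
Qed.

Lemma rdsum_zero (N : bool -> rep k Q) M b : rdsum N M -> rzero (N b) ->
  rep_iso (N (~~ b)) M.
Proof.
move=> [u [v h]] z; exists (u (~~ b)), (v (~~ b)) => i.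
have [h1 h2 <-] := h i; split=> //; rewrite [RHS](bigD1 (~~ b)) //= [X in _ = _ + X]big1 ?addr0 //.
move=> c nc; have -> : c = b by case: b c nc {z} => [] [].
by apply: mulmx_empty; apply: z.
Qed.

(** The image of an idempotent endomorphism, through a rank factorisation at
    each vertex. *)
Lemma rep_split M N (u : rhom N M) (v : rhom M N) : (forall i, u i *m v i = 1%:M) ->
  exists K : bool -> rep k Q, K true = N /\ rdsum K M.
Proof.
move=> uv; pose e i := 1%:M - v i *m u i.
have ee i : e i *m e i = e i.
  rewrite /e mulmxBl mul1mx mulmxBr mulmx1 mulmxA -(mulmxA (v i)) uv mulmx1.
  by rewrite subrr subr0.
have eM a : rmap M a *m e (tgt a) = e (src a) *m rmap M a.
  rewrite /e mulmxBl mulmxBr mulmx1 mul1mx; congr (_ - _).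
  by rewrite mulmxA rhomP -!mulmxA rhomP.
have CR i : col_base (e i) *m row_base (e i) = e i := mulmx_base (e i).
have RC i : row_base (e i) *m col_base (e i) = 1%:M.
  apply: (row_free_inj (row_base_free (e i))); rewrite /= mul1mx.
  apply: (row_full_inj (col_base_full (e i))).
  transitivity ((col_base (e i) *m row_base (e i)) *m (col_base (e i) *m row_base (e i))).
    by rewrite !mulmxA.
  by rewrite !CR ee.
have Re i : row_base (e i) *m e i = row_base (e i).
  by rewrite -[X in _ *m X = _]CR mulmxA RC mul1mx.
have eC i : e i *m col_base (e i) = col_base (e i).
  by rewrite -[X in X *m _ = _]CR -mulmxA RC mulmx1.
have ue i : u i *m e i = 0 by rewrite mulmxBr mulmx1 mulmxA uv mul1mx subrr.
have ev i : e i *m v i = 0 by rewrite mulmxBl mul1mx -mulmxA uv mulmx1 subrr.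
pose K' := @Rep k Q (fun i => \rank (e i))
  (fun a => row_base (e (src a)) *m rmap M a *m col_base (e (tgt a))).
have uP a : rmap K' a *m row_base (e (tgt a)) = row_base (e (src a)) *m rmap M a.
  rewrite [rmap K' a]/(row_base (e (src a)) *m rmap M a *m col_base (e (tgt a))).
  by rewrite -[LHS]mulmxA CR -mulmxA eM mulmxA Re.
have vP a : rmap M a *m col_base (e (tgt a))
   = col_base (e (src a)) *m (row_base (e (src a)) *m rmap M a *m col_base (e (tgt a))).
  by rewrite mulmxA (mulmxA (col_base _)) CR -eM -mulmxA eC.
pose u' : rhom K' M := @RHom _ _ K' M (fun i => row_base (e i)) uP.
pose v' : rhom M K' := @RHom _ _ M K' (fun i => col_base (e i)) vP.
pose K b := if b then N else K'.
exists K; split=> //.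
exists (fun b => match b return rhom (K b) M with true => u | false => u' end).
exists (fun b => match b return rhom M (K b) with true => v | false => v' end).
move=> i; split.
- by case; [exact: uv | exact: RC].
- move=> [] [] //= _.
    by rewrite -eC mulmxA ue mul0mx.
  by rewrite -Re -mulmxA ev mulmx0.
by rewrite big_bool /= CR /e addrC subrK.
Qed.

End RepSums.

(** * Indecomposable representations are intervals *)

Section Intervals.
Local Open Scope ring_scope.
Variables (k : fieldType) (n : nat).
Local Notation Q := (linear_An n).
Local Notation rp := (rep k Q).
Implicit Types (S : nat -> bool) (M N : rp).
Local Notation thin := (@thin_rep k n).

Let const_mx0 p q : const_mx 0 = 0 :> 'M[k]_(p, q).
Proof. by []. Qed.

Definition is_ivl c d M : Prop := (c < d <= n)%N /\ rep_iso (thin (ivl c d)) M.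

Lemma is_ivl_dim c d M (j : 'I_n) : is_ivl c d M -> rdim M j = ivl c d j.
Proof. by case=> _ h; rewrite -(rep_iso_dim (j : vert Q) h). Qed.

Lemma is_ivl_iso c d M N : is_ivl c d M -> rep_iso M N -> is_ivl c d N.
Proof. by move=> [h i] j; split=> //; apply: (rep_iso_trans i j). Qed.

Lemma is_ivl_inj c d c' d' M : is_ivl c d M -> is_ivl c' d' M -> c = c' /\ d = d'.
Proof.
move=> h h'; have [cd _] := h; have [cd' _] := h'.
have e j : (j < n)%N -> ivl c d j = ivl c' d' j.
  move=> jn; apply/eqP; rewrite -[_ == _]eqb_id; apply/eqP.
  have := is_ivl_dim (Ordinal jn) h; rewrite (is_ivl_dim (Ordinal jn) h') /=.
  by case: (ivl c d j); case: (ivl c' d' j).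
have inI j : (j < n)%N -> (c <= j < d)%N -> (c' <= j < d')%N by move=> /e; rewrite /ivl => ->.
have inI' j : (j < n)%N -> (c' <= j < d')%N -> (c <= j < d)%N by move=> /e; rewrite /ivl => ->.
have /andP[i1 _] := inI c ltac:(lia) ltac:(lia).
have /andP[i2 _] := inI' c' ltac:(lia) ltac:(lia).
have /andP[_ i3] := inI d.-1 ltac:(lia) ltac:(lia).
have /andP[_ i4] := inI' d'.-1 ltac:(lia) ltac:(lia).
by clear -i1 i2 i3 i4; lia.
Qed.

Lemma is_ivl_hom c d c' d' M N (f : rhom M N) : is_ivl c d M -> is_ivl c' d' N ->
  (exists i, f i != 0) -> [/\ c <= c', c' < d & d <= d']%N.
Proof.
move=> [cd [g [g' gg']]] [cd' [h [h' hh']]] [i fi].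
have dn : (d <= n)%N by case/andP: cd.
have dn' : (d' <= n)%N by case/andP: cd'.
have [s [es hs]] := @ivl_hom k n c d c' d' _ _ (rhom_mul (rhom_mul g f) h')
  (thin_repP k n (ivl c d)) (thin_repP k n (ivl c' d')) dn dn'.
apply: hs; apply: contraNneq fi => s0; apply/eqP.
have [_ e1] := gg' i; have [_ e2] := hh' i.
rewrite -[f i]mul1mx -[_ *m f i]mulmx1 -e1 -e2.
have := es i; rewrite /= s0 => e0.
have -> : g' i *m g i *m f i *m (h' i *m h i) = g' i *m (g i *m f i *m h' i) *m h i.
  by rewrite !mulmxA.
by rewrite e0 const_mx0 mulmx0 mul0mx.
Qed.

Lemma thin_hom S S' : thin_ok n S S' -> exists f : rhom (thin S) (thin S'),
  forall i, f i = const_mx 1.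
Proof.
move=> ok; exists (@RHom _ _ (thin S) (thin S') (fun=> const_mx 1)
  (thin_okP 1 (thin_repP k n S) (thin_repP k n S') ok)).
by [].
Qed.

Lemma ivl_ok c d c' d' : (c <= c' -> d <= d' -> d <= n -> d' <= n -> thin_ok n (ivl c d) (ivl c' d'))%N.
Proof. by rewrite /thin_ok /ivl => h1 h2 h3 h4 j; lia. Qed.

Lemma is_ivl_hom_ex c d c' d' M N : is_ivl c d M -> is_ivl c' d' N ->
  [/\ c <= c', c' < d & d <= d']%N -> exists f : rhom M N, exists i, f i != 0.
Proof.
move=> [cd [g [g' gg']]] [cd' [h [h' hh']]] [h1 h2 h3].
have dn : (d <= n)%N by case/andP: cd.
have dn' : (d' <= n)%N by case/andP: cd'.
have [f fE] := thin_hom (ivl_ok h1 h3 dn dn').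
exists (rhom_mul (rhom_mul g' f) h); exists (Ordinal (leq_trans h2 dn)) => /=.
set i := Ordinal _; apply/eqP => e0.
have [e1 _] := gg' i; have [e2 _] := hh' i.
have : g i *m (g' i *m f i *m h i) *m h' i = f i.
  by rewrite !mulmxA e1 mul1mx -mulmxA e2 mulmx1.
rewrite e0 mulmx0 mul0mx fE -const_mx0 => e.
have : (0 : k) = 1.
  by apply: (const_mx_inj _ _ e); rewrite /= /ivl; lia.
by move/eqP; rewrite eq_sym oner_eq0.
Qed.

(** The idempotent of a summand is a scalar, hence 0 or 1. *)
Lemma ivl_rindec c d M : is_ivl c d M -> rindec M.
Proof.
move=> h; have [cd _] := h; have dn : (d <= n)%N by case/andP: cd.
have cn : (c < n)%N by case/andP: cd => c1 c2; lia.
split=> [z|N sN].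
  by have := z (Ordinal cn); rewrite (is_ivl_dim _ h) /= /ivl; lia.
have [u [v uv]] : rdsum N (thin (ivl c d)).
  by apply: rdsum_iso sN _; apply: rep_iso_sym; case: h.
have zero b : (forall i, v b i *m u b i = 0) -> rzero (N b).
  move=> vu i; have [h1 _ _] := uv i.
  have e0 : (1%:M : 'M[k]_(rdim (N b) i)) = 0.
    by rewrite -[LHS]mulmx1 -{1}(h1 b) -(h1 b) mulmxA -(mulmxA (u b i)) vu mulmx0 mul0mx.
  by have := mxrank1 k (rdim (N b) i); rewrite e0 mxrank0.
have [s [es _]] := @ivl_hom k n c d c d _ _ (rhom_mul (v true) (u true))
  (thin_repP k n (ivl c d)) (thin_repP k n (ivl c d)) dn dn.
have [s0|sn0] := eqVneq s 0.
  by exists true; apply: zero => i; have := es i; rewrite s0 const_mx0.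
exists false; apply: zero => i; have [h1 h2 h3] := uv i.
have ie : ivl c d c by rewrite /ivl; lia.
have s1 : s = 1.
  have [g1 _ _] := uv (Ordinal cn); have e := es (Ordinal cn); rewrite /= in e.
  have ee : v true (Ordinal cn) *m u true (Ordinal cn) *m (v true (Ordinal cn) *m u true (Ordinal cn)) = v true (Ordinal cn) *m u true (Ordinal cn).
    by rewrite mulmxA -(mulmxA (v true _)) g1 mulmx1.
  have rd : rdim (thin (ivl c d)) (Ordinal cn) = 1%N by rewrite -[1%N]/(nat_of_bool true) -ie.
  have {}ee : s * s = s.
    move: ee; rewrite e const_mxM.
    have -> : s * s *+ rdim (thin (ivl c d)) (Ordinal cn) = s * s by rewrite rd.
    by apply: const_mx_inj; rewrite rd.
  by apply: (mulfI sn0); rewrite ee mulr1.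
have := h3; rewrite big_bool /=; have := es i; rewrite /= => ->.
rewrite s1 -(const_mx1_bool k (b := ivl c d i)) // => /eqP.
by rewrite addrC -subr_eq0 addrK => /eqP.
Qed.

Lemma rstep_ivl c d c' d' M N : is_ivl c d M -> is_ivl c' d' N ->
  [/\ c <= c', c' < d & d <= d']%N -> (c, d) <> (c', d') -> rstep M N.
Proof.
move=> hM hN h ne; split; [exact: ivl_rindec hM | exact: ivl_rindec hN|].
have [f fi] := is_ivl_hom_ex hM hN h; exists f; split=> // fiso; apply: ne.
by have [-> ->] := is_ivl_inj hM (is_ivl_iso hN (rep_iso_sym (ex_intro _ f fiso))).
Qed.

(** A representation has an interval as a summand: the longest nonzero string of
    the complex concentrated in degree 0. *)
Lemma rindec_ivl M : rindec M -> exists c d, is_ivl c d M.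
Proof.
move=> [nz hs]; pose X := stalk M.
(* degree -1, since the bar lives in the next degree, which is that of the stalk *)
have eX : X (-1 + 1) = M by [].
have dz p i : diff X p i = 0 by [].
have [|c [d [x [f [cd [sx _] xc [sf _ fd] xf]]]]] := @longest_bar k n X (-1).
  have [i ni] : exists i, rdim M i <> 0%N.
    by apply: NNPP => no; apply: nz => i; apply: NNPP => ni; apply: no; exists i.
  exists (i : nat), i.+1; apply: (@bar_start _ _ _ _ i (const_mx 1)).
    by rewrite dz mulmx0.
  case=> y; rewrite dz mulmx0 => /eqP; rewrite -const_mx0 => /eqP e.
  have : (1 : k) = 0 by apply: (const_mx_inj _ _ e) => //; move/eqP: ni; rewrite -lt0n.
  by move/eqP; rewrite oner_eq0.
have {x f sx xc sf fd xf} [x [f [sx x0 sf f0 xf]]] :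
  exists (x : forall j : 'I_n, 'rV[k]_(rdim M j)) (f : forall j : 'I_n, 'cV[k]_(rdim M j)),
  [/\ is_sec d x, forall j : 'I_n, (j < c)%N -> x j = 0,
      forall a : arrow Q, (c <= a)%N -> f (src a) = rmap M a *m f (tgt a),
      forall j : 'I_n, (d <= j)%N -> f j = 0
    & forall j : 'I_n, (c <= j < d)%N -> x j *m f j = 1%:M].
  exists x, f; split=> // j; first by move=> /xc[y ->]; rewrite dz mulmx0.
  by move=> /fd[g ->]; rewrite dz mul0mx.
pose I := ivl c d; pose N := thin I.
have uP a : rmap N a *m (const_mx 1 *m x (tgt a)) = (const_mx 1 *m x (src a)) *m rmap M a.
  apply: (@fam_hom k n M N x I (thin_repP k n I)) => {}a ha.
  rewrite -sx; last by move: ha; rewrite /I /ivl /=; lia.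
  have [h|h] := boolP (I (tgt a)); first by rewrite mulr1n.
  by rewrite x0 ?mul0rn //; move: ha h; rewrite /I /ivl /=; lia.
have vP a : rmap M a *m (f (tgt a) *m (const_mx 1 : 'M_(1, I (tgt a))))
    = (f (src a) *m (const_mx 1 : 'M_(1, I (src a)))) *m rmap N a.
  have [h|h] := orP (orbN (I (tgt a))); last first.
    by apply: (@mx_empty k (rdim M (src a)) (I (tgt a))); rewrite (negPf h) orbT.
  rewrite mulmxA -sf; last by move: h; rewrite /I /ivl /=; lia.
  have [h'|h'] := orP (orbN (I (src a))).
    by rewrite -mulmxA /= const_mxM h' mulr1.
  rewrite f0 ?mul0mx //; move: h h'; rewrite /I /ivl /=; lia.
pose u : rhom N M := @RHom _ _ N M (fun i => const_mx 1 *m x i) uP.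
pose v : rhom M N := @RHom _ _ M N (fun i => f i *m const_mx 1) vP.
have uv i : u i *m v i = 1%:M.
  rewrite /= mulmxA -(mulmxA (const_mx 1)).
  have [h|h] := orP (orbN (I i)); last by apply: mx_empty; rewrite (negPf h).
  by rewrite xf // mulmx1 const_mxM mulr1 mulr1n (const_mx1_bool k (b := I i)).
have [K [KN sK]] := rep_split uv; exists c, d; split=> //.
have [b zb] := hs K sK; case: b zb => zb; last by rewrite -/N -KN; apply: rdsum_zero sK zb.
have cn : (c < n)%N by lia.
by move: zb; rewrite KN => /(_ (Ordinal cn)); rewrite /N /I /ivl /=; lia.
Qed.

(** A homomorphism of intervals moves both ends up, and it is an isomorphism if it
    moves neither. *)
Lemma rsucc_order M N c d c' d' : rsucc M N -> is_ivl c d M -> is_ivl c' d' N ->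
  [/\ c <= c', d <= d' & (c, d) <> (c', d')]%N.
Proof.
move=> s; elim: s c d c' d' => {M N} [M N [iM iN [f [nz ni]]]|M P N _ IH1 s2 IH2] c d c' d' hM hN.
  have [h1 h2 h3] := is_ivl_hom hM hN nz; split=> // -[e1 e2]; apply: ni; subst c' d'.
  have dn : (d <= n)%N by case: hM => /andP[].
  have [_ [g [g' gg']]] := hM; have [_ [h [h' hh']]] := hN.
  have [s [es _]] := @ivl_hom k n c d c d _ _ (rhom_mul (rhom_mul g f) h')
    (thin_repP k n (ivl c d)) (thin_repP k n (ivl c d)) dn dn.
  have s0 : s != 0.
    have [i fi] := nz; apply: contraNneq fi => s0; apply/eqP.
    have [_ e1] := gg' i; have [_ e2] := hh' i.
    rewrite -[f i]mul1mx -[_ *m f i]mulmx1 -e1 -e2.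
    have := es i; rewrite /= s0 => e0.
    have -> : g' i *m g i *m f i *m (h' i *m h i) = g' i *m (g i *m f i *m h' i) *m h i.
      by rewrite !mulmxA.
    by rewrite e0 const_mx0 mulmx0 mul0mx.
  have tP a : rmap N a *m (s^-1 *: (h' (tgt a) *m g (tgt a)))
      = (s^-1 *: (h' (src a) *m g (src a))) *m rmap M a.
    by rewrite -scalemxAr -scalemxAl mulmxA rhomP -!mulmxA rhomP.
  exists (@RHom _ _ N M (fun i => s^-1 *: (h' i *m g i)) tP) => i /=; have [g1 g2] := gg' i; have [h4 h5] := hh' i.
  have fE : f i = s *: (g' i *m h i).
    have := es i; rewrite /= => e.
    rewrite -[f i]mul1mx -[_ *m f i]mulmx1 -g2 -h5.
    have -> : g' i *m g i *m f i *m (h' i *m h i) = g' i *m (g i *m f i *m h' i) *m h i.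
      by rewrite !mulmxA.
    have -> : g i *m f i *m h' i = s *: 1%:M.
      by rewrite e (const_mx1_bool k (b := ivl c d i)) // scalemx_const mulr1.
    by rewrite -scalemxAr -scalemxAl mulmx1.
  rewrite fE -!scalemxAr -!scalemxAl scalerA mulVf // scale1r scalerA mulfV // scale1r.
  rewrite mulmxA -(mulmxA (g' i)) h4 mulmx1 g2 mulmxA -(mulmxA (h' i)) g1 mulmx1 h5.
  by [].
have [a [b hP]] : exists c d, is_ivl c d P.
  apply: rindec_ivl; elim: s2 {IH1 IH2 hM hN} => [? ? []//|? ? ? _ h _ _ //].
have [h1 h2 h3] := IH1 _ _ _ _ hM hP; have [h4 h5 h6] := IH2 _ _ _ _ hP hN.
split; [lia|lia|] => -[e1 e2]; apply: h3; congr pair; lia.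
Qed.

End Intervals.

(** * The summands of a module that succeed an interval *)

Section ThinSums.
Local Open Scope ring_scope.
Variables (k : fieldType) (n : nat).
Local Notation Q := (linear_An n).
Local Notation thin := (@thin_rep k n).
Local Notation is_ivl := (@is_ivl k n).

(** Separated supports: no arrow joins two of them, so that the constant matrices are
    homomorphisms in both directions. *)
Lemma rdsum_thin (J : finType) (D : J -> nat -> bool) (U : nat -> bool) :
  (forall j i, D j i -> U i) -> (forall i, U i -> exists j, D j i) ->
  (forall j l i, D j i -> D l i -> j = l) ->
  (forall j l i, D j i.+1 -> D l i -> j = l) ->
  rdsum (fun j => thin (D j)) (thin U).
Proof.
move=> DU UD dis adj.
have [u uE] : exists u : forall j, rhom (thin (D j)) (thin U), forall j i, u j i = const_mx 1.
  apply: (@fin_all_exists _ (fun j => rhom (thin (D j)) (thin U)) (fun j (u : rhom (thin (D j)) (thin U)) => forall i, u i = const_mx 1)) => j.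
  apply: thin_hom => i _ d1 /UD[l d2]; have e := adj _ _ _ d1 d2; subst l.
  by rewrite d2 (DU _ _ d1).
have [v vE] : exists v : forall j, rhom (thin U) (thin (D j)), forall j i, v j i = const_mx 1.
  apply: (@fin_all_exists _ (fun j => rhom (thin U) (thin (D j))) (fun j (v : rhom (thin U) (thin (D j))) => forall i, v i = const_mx 1)) => j.
  apply: thin_hom => i _ /UD[l d1] d2; have e := adj _ _ _ d1 d2; subst l.
  by rewrite d1 (DU _ _ d2).
exists u, v => i; split=> [l|l l' ne|].
- rewrite uE vE const_mxM mulr1.
  have [h|h] := orP (orbN (D l i)); last by apply: mx_empty; rewrite /= (negPf h).
  rewrite (const_mx1_bool k (b := D l i)) //; congr const_mx.
  by rewrite /= (DU _ _ h).
- apply: mx_empty => /=.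
  case h: (D l i) => //; case h': (D l' i) => //.
  by move: ne; rewrite (dis _ _ _ h h') eqxx.
have [h|h] := orP (orbN (U i)); last by apply: mx_empty; rewrite /= (negPf h).
have [l dl] := UD _ h; rewrite (bigD1 l) //= big1 ?addr0 => [|l' ne].
  rewrite uE vE const_mxM mulr1 (const_mx1_bool k (b := U i)) //; congr const_mx.
  by rewrite /= dl.
apply: mulmx_empty => /=; case h': (D l' i) => //.
by move: ne; rewrite (dis _ _ _ h' dl) eqxx.
Qed.

Variables (a b c d e : nat) (M0 : rep k Q).
Hypotheses (be : (b < e)%N) (ec : (e < c)%N) (dn : (d <= n)%N).
Hypothesis hM0 : is_ivl e d M0.
(** Successive intervals with a gap between them. Only [ivl c d] succeeds the
    interval [e, d), as [b < e < c]. *)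
Definition two_ivl (i : nat) : bool := ivl a b i || ivl c d i.
Local Notation U := two_ivl.

Lemma rsplit_ex :
  rsplit (rsucc M0) (thin U) (thin (ivl c d)) (thin (ivl a b)).
Proof.
pose Dc (z : bool) := if z then ivl a b else ivl c d.
pose P : pred bool := fun z => if z then (a < b)%N else (c < d)%N.
pose N (l : 'I_#|P|) := thin (Dc (enum_val l)).
have ed : (e < d)%N by case: hM0 => /andP[].
have PN z i : Dc z i -> z \in P by rewrite unfold_in /P; case: z; rewrite /Dc /ivl; lia.
have ivlN z : z \in P -> is_ivl (if z then a else c) (if z then b else d) (thin (Dc z)).
  rewrite unfold_in /P => h; split; first by case: z h; lia.
  by case: z h => _; apply: rep_iso_refl.
have rank z i : Dc z i -> exists l : 'I_#|P|, enum_val l = z.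
  by move=> /PN h; exists (enum_rank_in h z); rewrite enum_rankK_in.
exists #|P|, N, (fun l => ~~ enum_val l); split=> [l|].
  exact: ivl_rindec (ivlN _ (enum_valP l)).
split=> [l|].
  have := ivlN _ (enum_valP l); rewrite /N; case: (enum_val l) (enum_valP l) => /= hP hN.
    split=> // /rsucc_order/(_ hM0 hN)[]; move: hP; rewrite unfold_in /P; lia.
  split=> // _; apply: t_step; apply: (rstep_ivl hM0 hN).
    by move: hP; rewrite unfold_in /P; split; lia.
  by case; lia.
have dis z z' i : Dc z i -> Dc z' i -> z = z'.
  by case: z; case: z' => //; rewrite /Dc /ivl; lia.
have adj z z' i : Dc z i.+1 -> Dc z' i -> z = z'.
  by case: z; case: z' => //; rewrite /Dc /ivl; lia.
split.
- apply: rdsum_thin => [l i|i|l l' i h h'|l l' i h h'].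
  + by rewrite /Dc /two_ivl; case: (enum_val l) => ->; rewrite ?orbT.
  + move=> h; have [z hz] : exists z, Dc z i by case/orP: h; [exists true|exists false].
    by have [l el] := rank _ _ hz; exists l; rewrite el.
  + exact/enum_val_inj/dis/h'.
  + exact/enum_val_inj/adj/h'.
- apply: (@rdsum_thin _ (fun l : {l : 'I_#|P| | ~~ enum_val l} => Dc (enum_val (val l)))) => [l i|i|l l' i h h'|l l' i h h'].
  + by rewrite /Dc; case: l => l /= /negPf->.
  + move=> h; have [l el] := rank false i h; have nl : ~~ enum_val l by rewrite el.
    by exists (Sub l nl); rewrite SubK el.
  + exact/val_inj/enum_val_inj/dis/h'.
  + exact/val_inj/enum_val_inj/adj/h'.
apply: (@rdsum_thin _ (fun l : {l : 'I_#|P| | ~~ ~~ enum_val l} => Dc (enum_val (val l)))) => [l i|i|l l' i h h'|l l' i h h'].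
- by rewrite /Dc; case: l => l /=; rewrite negbK => ->.
- move=> h; have [l el] := rank true i h; have nl : ~~ ~~ enum_val l by rewrite el.
  by exists (Sub l nl); rewrite SubK el.
- exact/val_inj/enum_val_inj/dis/h'.
exact/val_inj/enum_val_inj/adj/h'.
Qed.

Lemma sum_sig (m : nat) (P : pred 'I_m) (F : 'I_m -> nat) :
  (\sum_(l : {l | P l}) F (val l) = \sum_(l | P l) F l)%N.
Proof.
rewrite [RHS](reindex_omap (val : {l | P l} -> 'I_m) insub) => [|l hl]; last first.
  by rewrite insubT.
by apply: eq_bigl => -[l hl] /=; rewrite insubT hl /= eqxx.
Qed.

(** A decomposition into indecomposables is not unique, but each summand is an
    interval inside [ivl a b] or inside [ivl c d]. A summand in [ivl c d] reaches up
    to [d], so that it succeeds [M0]. *)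
Lemma rsplit_dims H B1 B2 : rep_iso (thin U) H -> rsplit (rsucc M0) H B1 B2 ->
  forall j : 'I_n, rdim B1 j = ivl c d j /\ rdim B2 j = ivl a b j.
Proof.
move=> iH [m [N [bb [iN [bS [sH s1 s2]]]]]].
have ed : (e < d)%N by case: hM0 => /andP[].
have sU := rdsum_iso sH (rep_iso_sym iH).
have dU (j : 'I_n) : nat_of_bool (U j) = (\sum_l rdim (N l) j)%N := rdsum_dim (j : vert Q) sU.
have NU l (j : 'I_n) : (0 < rdim (N l) j)%N -> U j.
  by move=> h; have := dU j; rewrite (bigD1 l) //=; case: (U j) => //; lia.
have N1 l l' (j : 'I_n) : (0 < rdim (N l) j)%N -> l' != l -> rdim (N l') j = 0%N.
  move=> h ne; have := dU j; rewrite (bigD1 l) //= (bigD1 l') //=.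
  by case: (U j) => /=; lia.
have in1 l (j : 'I_n) : bb l -> (0 < rdim (N l) j)%N -> ivl c d j.
  move=> /bS s h; have [x [y hN]] := rindec_ivl (iN l).
  have [h1 _ _] := rsucc_order s hM0 hN.
  by have := NU _ _ h; move: h; rewrite (is_ivl_dim j hN) /two_ivl /ivl; lia.
have in2 l (j : 'I_n) : ~~ bb l -> (0 < rdim (N l) j)%N -> ivl a b j.
  move=> nb h; apply: contraR nb => nab; apply/bS.
  have [x [y hN]] := rindec_ivl (iN l); have [/andP[xy yn] _] := hN.
  have xyU i : (x <= i < y)%N -> U i.
    move=> hi; have ilt : (i < n)%N by lia.
    by apply: (NU l (Ordinal ilt)); rewrite (is_ivl_dim _ hN) /ivl /= hi.
  have hj : (x <= j < y)%N.
    by move: h; rewrite (is_ivl_dim _ hN) /ivl; case: (_ && _).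
  have cx : (c <= x)%N.
    rewrite leqNgt; apply/negP => xc.
    have : (c <= j)%N by have := xyU j hj; move: nab; rewrite /two_ivl /ivl; lia.
    move=> cj; have := xyU c.-1 ltac:(lia); rewrite /two_ivl /ivl; lia.
  (* otherwise the map at the arrow from [y] to [y - 1] has no component in any summand *)
  have yd : y = d.
    have : (y <= d)%N by have := xyU y.-1 ltac:(lia); rewrite /two_ivl /ivl; lia.
    rewrite leq_eqVlt => /orP[/eqP//|yd].
    have yln : (y < n)%N by lia.
    have [aa ea] := arrow_into (o := Ordinal yln) ltac:(rewrite /=; lia).
    have ey : (aa : nat).+1 = y := esym (congr1 (@nat_of_ord n) ea).
    have Ht : U (tgt aa) by apply: xyU => /=; lia.
    have Hs : U (src aa) by rewrite /two_ivl /ivl /=; lia.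
    have nl : (0 < rdim (N l) (tgt aa))%N.
      by rewrite (is_ivl_dim _ hN) /ivl /=; lia.
    have nl' : rdim (N l) (src aa) = 0%N.
      by rewrite (is_ivl_dim _ hN) /ivl /=; lia.
    have [u [v uv]] := sU; have [_ _ e3] := uv (tgt aa).
    have : rmap (thin U) aa = 0.
      rewrite -[LHS]mulmx1 -e3 mulmx_sumr big1 // => l' _.
      rewrite mulmxA rhomP.
      have [->|ne] := eqVneq l' l.
        by rewrite (mulmx_empty (v l (src aa))) // mul0mx.
      by rewrite mulmx_empty //; apply: N1 nl ne.
    move=> e0; have : (1 : k) = 0.
      by apply: (@const_mx_inj k (U (src aa)) (U (tgt aa)) 1 0 _ _ e0); rewrite ?Ht ?Hs.
    by move/eqP; rewrite oner_eq0.
  subst y; apply: t_step; apply: (rstep_ivl hM0 hN); first by split; lia.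
  by case; lia.
move=> j; have eB1 : rdim B1 j = (\sum_(l | bb l) rdim (N l) j)%N.
  by rewrite (rdsum_dim (j : vert Q) s1) (sum_sig bb (fun l => rdim (N l) j)).
have eB2 : rdim B2 j = (\sum_(l | ~~ bb l) rdim (N l) j)%N.
  by rewrite (rdsum_dim (j : vert Q) s2) (sum_sig (fun l => ~~ bb l) (fun l => rdim (N l) j)).
have := dU j; rewrite (bigID bb) /= -eB1 -eB2.
have z1 : ~~ ivl c d j -> rdim B1 j = 0%N.
  move=> h; rewrite eB1 big1 // => l hl; apply/eqP; rewrite -leqn0 leqNgt.
  by apply: contra h => /(in1 _ _ hl).
have z2 : ~~ ivl a b j -> rdim B2 j = 0%N.
  move=> h; rewrite eB2 big1 // => l hl; apply/eqP; rewrite -leqn0 leqNgt.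
  by apply: contra h => /(in2 _ _ hl).
move: z1 z2; rewrite /two_ivl.
have : ~~ (ivl c d j && ivl a b j) by rewrite /ivl; lia.
case: (ivl c d j); case: (ivl a b j) => //= _ z1 z2.
- by rewrite (z2 isT) addn0 => <-.
- by rewrite (z1 isT) add0n => <-.
by rewrite (z1 isT) (z2 isT).
Qed.

End ThinSums.

(** * Modules and shifted projectives in the cluster category *)

Section Stalks.
Local Open Scope ring_scope.
Variables (k : fieldType) (n : nat).
Local Notation Q := (linear_An n).
Local Notation rp := (rep k Q).
Local Notation cx := (cplx k Q).
Local Notation thin := (@thin_rep k n).
Implicit Types (M N P : rp) (X Y : cx).
Variable C : cluster_category k Q.
Local Notation D := (cl_der C).
Local Notation DC := (der_cat (cl_der C)).
Local Notation CC := (cl_cat C).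
Local Notation pi := (orb_proj (cl_orb C)).
Local Notation seg_obj := (@seg_obj k n).
Local Notation labelled := (@labelled k n C).
Local Notation is_ivl := (@is_ivl k n).

(** On complexes without differential the localisation is faithful, because a
    quasi-isomorphism is surjective on cycles. *)
Lemma loc_faithful X Y (f : chain X Y) : (forall p i, diff X p i = 0) ->
  (forall p i, diff Y p i = 0) -> loc D f = 0 -> forall p i, f (p + 1) i = 0.
Proof.
move=> dX dY /loc_eq0[Z [s [qs [h hh]]]] p i; apply/row_matrixP => j.
rewrite row0 rowE; set x := delta_mx _ _.
have [_ /(_ x)] := qs p i; rewrite dX mulmx0 => /(_ erefl)[z [y [zd ->]]].
rewrite dX mulmx0 addr0 -mulmxA; have := hh p i => /= ->.
by rewrite dY mulmx0 addr0 mulmxA zd mul0mx.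
Qed.

Lemma stalk_ext M N (f g : rhom M N) : (forall i, f i = g i) ->
  forall p i, stalk_chain f p i = stalk_chain g p i.
Proof. by move=> e p i /=; rewrite /stalk_rhom /stalk_term; case: (p == 0). Qed.

Lemma stalk_lin M N c (f g h : rhom M N) : (forall i, h i = c *: f i + g i) ->
  forall p i, stalk_chain h p i = c *: stalk_chain f p i + stalk_chain g p i.
Proof.
move=> e p i /=; rewrite /stalk_rhom /stalk_term; case: (p == 0) => //.
exact: mx_empty.
Qed.

Lemma stalk_mul M N P (f : rhom M N) (g : rhom N P) p i :
  stalk_chain (rhom_mul f g) p i = chain_mul (stalk_chain f) (stalk_chain g) p i.
Proof.
rewrite /= /stalk_rhom /stalk_term; case: (p == 0) => //=; exact: mx_empty.
Qed.

Lemma stalk_one M p i : stalk_chain (rhom1 M) p i = chain1 (stalk M) p i.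
Proof. by rewrite /= /stalk_rhom /stalk_term; case: (p == 0). Qed.

Lemma cl_mod_ext M N (f g : rhom M N) : (forall i, f i = g i) -> cl_mod C f = cl_mod C g.
Proof. by move=> e; rewrite /cl_mod (loc_ext D (stalk_ext e)). Qed.

Lemma cl_mod_comp M N P (f : rhom M N) (g : rhom N P) :
  cl_mod C g \oc cl_mod C f = cl_mod C (rhom_mul f g).
Proof.
by rewrite /cl_mod pi_comp -loc_mul (loc_ext D (stalk_mul f g)).
Qed.

Lemma cl_mod_eq0 M N (f : rhom M N) : cl_mod C f = 0 -> forall i, f i = 0.
Proof.
move=> /c_pi_eq0 f0 i; exact: (@loc_faithful (stalk M) (stalk N) _ _ _ f0 (-1)%R i).
Qed.

Lemma rep_iso_stalk M N : rep_iso M N -> isomorphic DC (stalk M) (stalk N).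
Proof.
move=> [f [g fg]]; exists (loc D (stalk_chain f)), (loc D (stalk_chain g)).
split; rewrite -loc_mul -loc1; apply: loc_ext => p i; rewrite -stalk_mul -stalk_one;
  by apply: stalk_ext => {}i; have [] := fg i.
Qed.

(** A decomposition of a module is carried over to the derived category, from where
    it can be sent to the cluster category, before or after a shift. *)
Lemma stalk_sum2 (N : bool -> rp) M : rdsum N M ->
  exists S : dsum DC bool, (forall b, S b = stalk (N b)) /\ total S = stalk M.
Proof.
move=> [u [v uv]]; pose l M N (f : rhom M N) := loc D (stalk_chain f).
have lM M1 M2 M3 (f : rhom M1 M2) (g : rhom M2 M3) : l _ _ g \oc l _ _ f = l _ _ (rhom_mul f g).
  by rewrite /l -loc_mul (loc_ext D (stalk_mul f g)).
have l1 M1 (f : rhom M1 M1) : (forall i, f i = 1%:M) -> l _ _ f = idm (stalk M1).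
  move=> e; rewrite -loc1; apply: loc_ext => p i; rewrite -stalk_one.
  exact: stalk_ext.
have l0 M1 M2 (f : rhom M1 M2) : (forall i, f i = 0) -> l _ _ f = 0.
  move=> e; apply: loc_0 => p i /=; rewrite /stalk_rhom /stalk_term; case: (p == 0) => //.
  exact: mx_empty.
have [|||||S [e1 e2 e3]] := @mk_sum2 _ _ DC _ _ _ (l _ _ (u true)) (l _ _ (u false))
    (l _ _ (v true)) (l _ _ (v false)).
- by rewrite lM l1 // => i; have [h _ _] := uv i; rewrite /= h.
- by rewrite lM l1 // => i; have [h _ _] := uv i; rewrite /= h.
- by rewrite lM l0 // => i; have [_ h _] := uv i; rewrite /= h.
- by rewrite lM l0 // => i; have [_ h _] := uv i; rewrite /= h.
- rewrite !lM -(l1 _ (rhom1 M)) // -[X in X + _]scale1r; apply/esym/loc_lin.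
  by apply: stalk_lin => i; have [_ _ h] := uv i; rewrite /= scale1r -h big_bool.
by exists S; split=> // -[].
Qed.

Lemma stalk_zero M : zero_obj DC (stalk M) -> rzero M.
Proof.
rewrite /zero_obj -loc1 => h i.
have := @loc_faithful (stalk M) (stalk M) _ _ _ h (-1)%R i => /=.
by move=> e; have := mxrank1 k (rdim M i); rewrite e // mxrank0.
Qed.

Lemma shift_stalk_zero M : zero_obj DC (shift (stalk M)) -> rzero M.
Proof.
rewrite /zero_obj -loc1 => h i.
have z p j : diff (shift (stalk M)) p j = 0 by rewrite /= oppr0.
have := @loc_faithful (shift (stalk M)) (shift (stalk M)) _ z z h (-2)%R i => /=.
by move=> e; have := mxrank1 k (rdim M i); rewrite e // mxrank0.
Qed.

Lemma zero_stalk M : rzero M -> zero_obj DC (stalk M).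
Proof.
move=> z; rewrite /zero_obj -loc1; apply: loc_0 => p i; apply: mx_empty => /=.
by rewrite /stalk_term; case: (p == 0) => //; rewrite z.
Qed.

Lemma indec_stalk M : indecomposable CC (stalk M) -> rindec M.
Proof.
move=> [nz h]; split=> [/zero_stalk z|N /stalk_sum2[S [eS tS]]].
  by apply: nz; exact: (fmap_zero pi z).
have [S' [tS' eS']] := fmap_dsum pi S.
have [|b] := h S'; first by rewrite tS' tS; exact: (iso_refl CC (stalk M)).
by rewrite eS' eS => z; exists b; apply: stalk_zero; apply: orb_zero z.
Qed.

Lemma indec_shift_stalk M : indecomposable CC (shift (stalk M)) -> rindec M.
Proof.
move=> [nz h]; split=> [/zero_stalk z|N /stalk_sum2[S [eS tS]]].
  by apply: nz; exact: (fmap_zero pi (fmap_zero (sh (cl_shift C)) z)).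
have [S1 [tS1 eS1]] := fmap_dsum (sh (cl_shift C)) S.
have [S' [tS' eS']] := fmap_dsum pi S1.
have [|b] := h S'; first by rewrite tS' tS1 tS; exact: (iso_refl CC (shift (stalk M))).
by rewrite eS' eS1 eS => z; exists b; apply: shift_stalk_zero; apply: orb_zero z.
Qed.

Lemma stalk_thin (S : nat -> bool) :
  is_thin_cx (fun q j => (q == 0) && S j) (stalk (thin S)).
Proof.
split=> [q|q i].
  rewrite /= /stalk_term; case: (q == 0); split=> //= a; exact: mx_empty.
apply: mx_empty; rewrite /= /stalk_term; have [->|//] := eqVneq q 0.
by rewrite orbT.
Qed.

Lemma Pcx_stalk l : lp l = (-2)%R -> isomorphic DC (Pcx k l) (stalk (thin (ivl (lc l) (ld l)))).
Proof.
move=> el; have ln := lP l.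
have [||f fE] := @thin_chain k n _ _ _ _ 1 (Pcx_thin k l) (stalk_thin (ivl (lc l) (ld l))).
- by move=> q j _; rewrite /Pset /ivl el; lia.
- by move=> q j; rewrite /Pset /ivl el; lia.
have qf : quasi_iso f.
  apply: (thin_qis (Pcx_thin k l) (stalk_thin _) (oner_neq0 _) fE) => q j.
  by have := lP l; rewrite /Pset /ivl el; lia.
by exists (loc D f); apply: loc_qis.
Qed.

Lemma ivl_stalk c d M : is_ivl c d M -> exists l : label n,
  [/\ lc l = c, ld l = d, lp l = (-2)%R & isomorphic DC (Pcx k l) (stalk M)].
Proof.
move=> [cd iM]; have cd' : (c <= d <= n)%N by lia.
exists (Label (-2) cd'); split=> //.
exact: (iso_trans (Pcx_stalk (l := Label (-2) cd') erefl) (rep_iso_stalk iM)).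
Qed.

Lemma lab_ivl c d M : is_ivl c d M -> labelled (stalk M) (c, d.+1).
Proof.
move=> h; have [l [ec ed ep i]] := ivl_stalk h; have [/andP[cd dn] _] := h.
have -> : (c, d.+1) = (lc l, (ld l).+1) by rewrite ec ed.
rewrite -[labelled _ _]/(isomorphic CC _ (Pcx k (seg_lab n (lc l, (ld l).+1)))).
have -> : seg_lab n (lc l, (ld l).+1) = l.
  have dn' : (ld l < n.+1)%N by rewrite ed.
  by apply: label_eq; rewrite /= dn' ?ep //; have := lP l; lia.
exact/iso_sym/pi_iso.
Qed.

Lemma lab_shift_ivl d M : is_ivl 0 d M -> labelled (shift (stalk M)) (d, n.+2).
Proof.
move=> h; have [l [ec ed ep i]] := ivl_stalk h; have [/andP[cd dn] _] := h.
rewrite -[labelled _ _]/(isomorphic CC _ (Pcx k (seg_lab n (d, n.+2)))).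
have <- : shift_lab l = seg_lab n (d, n.+2).
  by apply: label_eq; rewrite /= ltnn ?dn ?ep //; have := lP l; lia.
apply: pi_iso; apply: iso_trans (shift_Pcx D l).
exact: (fmap_iso (sh (cl_shift C)) (iso_sym i)).
Qed.

Lemma is_ivl_thin c d : (c < d <= n)%N -> is_ivl c d (thin (ivl c d)).
Proof. by split=> //; apply: rep_iso_refl. Qed.

(** A module isomorphic to an indecomposable object is indecomposable, thus an
    interval, and labels are unique. *)
Lemma is_mod_lab X y M : labelled X y -> is_diag n y -> is_mod C X M ->
  (y.2 <= n.+1)%N /\ is_ivl y.1 y.2.-1 M.
Proof.
move=> lX dy h; have iX := brick_indec (lab_brick lX dy).
have iM : indecomposable CC (stalk M) by apply/brick_indec/(brick_iso h)/(lab_brick lX dy).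
have [c [d hM]] := rindec_ivl (indec_stalk iM).
have [/andP[cd dn] _] := hM.
have lX' : labelled X (c, d.+1) := iso_trans h (lab_ivl hM).
have dg' : is_diag n (c, d.+1) by rewrite /is_diag /=; lia.
by rewrite (lab_inj lX lX' dy dg') /=; split.
Qed.

Lemma lab_is_mod X y : labelled X y -> is_diag n y -> (y.2 <= n.+1)%N ->
  is_mod C X (thin (ivl y.1 y.2.-1)).
Proof.
move=> lX dy y2; have h : is_ivl y.1 y.2.-1 (thin (ivl y.1 y.2.-1)).
  by apply: is_ivl_thin; move: dy; rewrite /is_diag; lia.
apply: iso_trans lX _; have := lab_ivl h.
have -> : (y.1, y.2.-1.+1) = y by case: (y) dy => ? [|?] //=; rewrite /is_diag /=; lia.
by move=> L; exact: iso_sym L.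
Qed.

Lemma thin_iso (S S' : nat -> bool) M M' : is_thin S M -> is_thin S' M' ->
  (forall j : 'I_n, S j = S' j) -> rep_iso M M'.
Proof.
move=> tM tM' e.
have ok (S1 S2 : nat -> bool) : (forall j : 'I_n, S1 j = S2 j) -> thin_ok n S1 S2.
  move=> e' j jn h1 h2; have j' : (j < n)%N by lia.
  by have := e' (Ordinal jn); have := e' (Ordinal j'); rewrite /= h1 h2 => -> <-.
pose f : rhom M M' := @RHom _ _ M M' (fun=> const_mx 1) (thin_okP 1 tM tM' (ok _ _ e)).
have e' j : S' j = S j -> S j = S' j by [].
pose g : rhom M' M := @RHom _ _ M' M (fun=> const_mx 1)
  (thin_okP 1 tM' tM (ok _ _ (fun j => esym (e j)))).
exists f, g => i; have [d _] := tM; have [d' _] := tM'.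
rewrite /= !const_mxM !mulr1 (const_mx1_bool k (d i)) (const_mx1_bool k (d' i)).
have [h|h] := orP (orbN (S i)).
  by rewrite d d' -e h.
by split; apply: mx_empty; rewrite ?d ?d' -?e (negPf h).
Qed.

Lemma P_ivl (i : 'I_n) : is_ivl 0 i.+1 (P_An k i).
Proof.
split; first by rewrite ltn_ord.
by apply: (thin_iso (thin_repP k n _) (S' := ivl 0 i.+1)).
Qed.

Lemma ivl_projective d : (d <= n)%N -> rprojective (thin (ivl 0 d)).
Proof.
move=> dn M N g f gfull; have [d0|d0] := posnP d.
  have z (i : 'I_n) : rdim (thin (ivl 0 d)) i = 0%N by rewrite /= d0.
  by exists (rhom0 _ _) => i; apply: mx_empty; rewrite z.
pose I := ivl 0 d; pose fr (i : 'I_n) : 'rV[k]_(rdim N i) := (const_mx 1 : 'M_(1, I i)) *m f i.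
have sf : is_sec d fr.
  move=> a ha; rewrite /fr -mulmxA -(rhomP f a) mulmxA; congr (_ *m _).
  rewrite [rmap _ _]/(const_mx 1) const_mxM mulr1; congr const_mx.
  by have -> : I (src a) by rewrite /I /ivl /=.
have fE i : f i = (const_mx 1 : 'M_(I i, 1)) *m fr i.
  rewrite /fr mulmxA const_mxM mulr1 mulr1n -(const_mx1_bool k (b := I i)) //.
  by rewrite mul1mx.
have [y0 ey0] : exists y0, fr (top_vertex d0 dn) = y0 *m g (top_vertex d0 dn).
  by apply/submxP; apply: submx_full.
have [y [yt sy]] := sec_top y0.
have yE (j : 'I_n) : (j < d)%N -> y j *m g j = fr j.
  move=> jd; apply: (@down_ind n (fun j => y j *m g j = fr j) (top_vertex d0 dn)).
  - by rewrite yt.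
  - move=> a h e; rewrite sy ?sf -?mulmxA ?rhomP ?mulmxA ?e //; move: h => /=; lia.
  by rewrite /=; lia.
have hP := @fam_hom k n M (thin I) y I (thin_repP k n I) _.
have {}hP a : rmap (thin I) a *m (const_mx 1 *m y (tgt a)) = (const_mx 1 *m y (src a)) *m rmap M a.
  apply: hP => {}a ha; rewrite -sy; last by move: ha; rewrite /I /ivl /=.
  by have -> : I (tgt a) by move: ha; rewrite /I /ivl /=; lia.
exists (@RHom _ _ (thin I) M (fun i => const_mx 1 *m y i) hP) => i /=.
have [h|h] := orP (orbN (I i)).
  by rewrite -mulmxA yE // -fE.
by apply: mx_empty; rewrite /= -/(I i) (negPf h).
Qed.

(** The projective [0, d) maps onto the interval; a splitting is a map back, which
    forces [c = 0]. *)
Lemma projective_ivl c d P : is_ivl c d P -> rprojective P -> c = 0%N.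
Proof.
move=> hP pP; have [/andP[cd dn] _] := hP; have [f [f' ff']] := hP.2.
have [g gE] : exists g : rhom (thin (ivl 0 d)) (thin (ivl c d)), forall i, g i = const_mx 1.
  by apply/thin_hom/ivl_ok.
have [|h hh] := @pP (thin (ivl 0 d)) P (rhom_mul g f) (rhom1 P).
  move=> i /=; have [f1 f2] := ff' i.
  apply/row_fullP; exists (f' i *m const_mx 1); rewrite gE.
  rewrite mulmxA -(mulmxA (f' i)) const_mxM mulr1.
  have [z|z] := orP (orbN (ivl c d i)).
    have -> : (1 : k) *+ rdim (thin (ivl 0 d)) i = 1.
      by rewrite /=; have -> : ivl 0 d i by move: z; rewrite /ivl; lia.
    by rewrite -(const_mx1_bool k (b := ivl c d i)) // mulmx1.
  by apply: mx_empty; rewrite (is_ivl_dim i hP) (negPf z).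
have h0 : exists i, h i != 0.
  have cn : (c < n)%N by lia.
  exists (Ordinal cn); apply/eqP => e0; have := hh (Ordinal cn); rewrite e0 mul0mx /=.
  by move=> /esym e; have := mxrank1 k (rdim P (Ordinal cn));
     rewrite e mxrank0 (is_ivl_dim _ hP) /ivl /=; lia.
have [] := is_ivl_hom hP (is_ivl_thin _) h0; first by lia.
by rewrite leqn0 => /eqP.
Qed.

Lemma shifted_proj_lab X y : labelled X y -> is_diag n y -> is_shifted_proj C X -> y.2 = n.+2.
Proof.
move=> lX dy [P [pP h]].
have iP : indecomposable CC (shift (stalk P)) by apply/brick_indec/(brick_iso h)/(lab_brick lX dy).
have [c [d hP]] := rindec_ivl (indec_shift_stalk iP).
have c0 := projective_ivl hP pP; subst c; have [/andP[cd dn] _] := hP.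
have lX' : labelled X (d, n.+2) := iso_trans h (lab_shift_ivl hP).
by rewrite (lab_inj lX lX' dy) // /is_diag /=; lia.
Qed.

Lemma lab_shifted_proj X y : labelled X y -> is_diag n y -> y.2 = n.+2 -> is_shifted_proj C X.
Proof.
move=> lX dy y2; exists (thin (ivl 0 y.1)); split.
  by apply: ivl_projective; move: dy; rewrite /is_diag; lia.
apply: iso_trans lX _.
have h : is_ivl 0 y.1 (thin (ivl 0 y.1)) by apply: is_ivl_thin; move: dy; rewrite /is_diag; lia.
have := lab_shift_ivl h; rewrite -y2 -surjective_pairing.
by move=> L; exact: iso_sym L.
Qed.

End Stalks.

(** * The functor [H^0] *)

Section HZero.
Local Open Scope ring_scope.
Variables (k : fieldType) (n : nat).
Local Notation Q := (linear_An n).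
Local Notation rp := (rep k Q).
Local Notation cx := (cplx k Q).
Local Notation thin := (@thin_rep k n).
Implicit Types (M N P : rp) (X Y : cx).
Variable C : cluster_category k Q.
Local Notation CC := (cl_cat C).
Local Notation seg_obj := (@seg_obj k n).
Local Notation labelled := (@labelled k n C).
Local Notation is_ivl := (@is_ivl k n).

Lemma H0_iso X X' H : is_H0 C X H -> isomorphic CC X X' -> is_H0 C X' H.
Proof.
move=> [t [tl tb tn]] [u [v [vu uv]]]; exists (fun i g => t i (v \oc g)); split.
- by move=> i c f g; rewrite compDr compZr tl.
- move=> i; have [s st ts] := tb i; exists (fun x => u \oc s x) => g.
    by rewrite st compmA uv comp1m.
  by rewrite compmA vu comp1m ts.
by move=> a g; rewrite compmA tn.
Qed.

(** [H^0] is given by coordinates on the spaces of homomorphisms; two systems of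
    coordinates differ by an isomorphism of representations. *)
Lemma H0_unique X H H' : is_H0 C X H -> is_H0 C X H' -> rep_iso H H'.
Proof.
have key (G G' : rp) (t : forall i : 'I_n, Hom CC (stalk (P_An k i)) X -> 'rV[k]_(rdim G i))
    (t' : forall i : 'I_n, Hom CC (stalk (P_An k i)) X -> 'rV[k]_(rdim G' i))
    (s : forall i : 'I_n, 'rV[k]_(rdim G i) -> Hom CC (stalk (P_An k i)) X) :
   (forall i c f g, t i (c *: f + g) = c *: t i f + t i g) ->
   (forall i c f g, t' i (c *: f + g) = c *: t' i f + t' i g) ->
   (forall i, cancel (t i) (s i)) -> (forall i, cancel (s i) (t i)) ->
   (forall (a : arrow Q) g, t (tgt a) (g \oc cl_mod C (P_incl k a)) = t (src a) g *m rmap G a) ->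
   (forall (a : arrow Q) g, t' (tgt a) (g \oc cl_mod C (P_incl k a)) = t' (src a) g *m rmap G' a) ->
   exists f : rhom G G', forall i (x : 'rV_(rdim G i)), x *m f i = t' i (s i x).
  move=> tl tl' ts st tn tn'.
  have shift_lab i c x y : s i (c *: x + y) = c *: s i x + s i y.
    by rewrite -[RHS]ts tl !st.
  have s0 i : s i 0 = 0 by have := shift_lab i (-1) 0 0; rewrite scaler0 addr0 scaleN1r addNr.
  have t0 i : t' i 0 = 0 by have := tl' i (-1) 0 0; rewrite scaler0 addr0 scaleN1r addNr.
  pose F (i : 'I_n) : 'M[k]_(rdim G i, rdim G' i) :=
    \matrix_j t' i (s i (delta_mx 0 j)).
  have FE i (x : 'rV_(rdim G i)) : x *m F i = t' i (s i x).
    rewrite mulmx_sum_row [in RHS](row_sum_delta x).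
    elim/big_rec2: _ => [|j y z _ ->]; first by rewrite s0 t0.
    by rewrite shift_lab tl' rowK.
  have FP (a : arrow Q) : rmap G a *m F (tgt a) = F (src a) *m rmap G' a.
    apply/row_matrixP => j; rewrite !rowE !mulmxA !FE -tn'; congr (t' _ _).
    by apply: (can_inj (ts (tgt a))); rewrite st tn st.
  by exists (@RHom _ _ G G' F FP).
move=> [t [tl tb tn]] [t' [tl' tb' tn']].
have inv (G : rp) (u : forall i : 'I_n, Hom CC (stalk (P_An k i)) X -> 'rV[k]_(rdim G i)) :
   (forall i, bijective (u i)) -> exists s : forall i : 'I_n, 'rV[k]_(rdim G i) -> Hom CC (stalk (P_An k i)) X,
     forall i, cancel (u i) (s i) /\ cancel (s i) (u i).
  move=> b; apply: (@fin_all_exists _ (fun i : 'I_n => 'rV[k]_(rdim G i) -> Hom CC (stalk (P_An k i)) X)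
    (fun i s => cancel (u i) s /\ cancel s (u i))) => i.
  by have [s h1 h2] := b i; exists s.
have [s sP] := inv H t tb; have [s' sP'] := inv H' t' tb'.
have [f fE] := key H H' t t' s tl tl' (fun i => (sP i).1) (fun i => (sP i).2) tn tn'.
have [g gE] := key H' H t' t s' tl' tl (fun i => (sP' i).1) (fun i => (sP' i).2) tn' tn.
exists f, g => i; split; apply/row_matrixP => j.
  by rewrite !rowE mulmxA fE gE (sP' i).1 (sP i).2 mulmx1.
by rewrite !rowE mulmxA gE fE (sP i).1 (sP' i).2 mulmx1.
Qed.

Lemma H0_dsum (S : dsum CC bool) (H : bool -> rp) M :
  (forall c, is_H0 C (S c) (H c)) -> rdsum H M -> is_H0 C (total S) M.
Proof.
move=> h [u [v uv]].
have [t0 P0] := h false; have [t1 P1] := h true.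
pose t c (i : 'I_n) : Hom CC (stalk (P_An k i)) (S c) -> 'rV[k]_(rdim (H c) i) :=
  match c return Hom CC (stalk (P_An k i)) (S c) -> 'rV[k]_(rdim (H c) i)
  with true => t1 i | false => t0 i end.
have tP c : [/\ forall i a f g, t c i (a *: f + g) = a *: t c i f + t c i g,
        forall i, bijective (t c i)
      & forall (a : arrow Q) g,
          t c (tgt a) (g \oc cl_mod C (P_incl k a)) = t c (src a) g *m rmap (H c) a].
  by case: c; [exact: P1 | exact: P0].
have tD c i f g : t c i (f + g) = t c i f + t c i g.
  by have [l _ _] := tP c; have := l i 1 f g; rewrite !scale1r.
have tz c i : t c i 0 = 0.
  by have := tD c i 0 0; rewrite addr0 => /eqP; rewrite -subr_eq subrr => /eqP <-.
exists (fun i g => \sum_c t c i (prj S c \oc g) *m u c i); split.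
- move=> i a f g; rewrite scaler_sumr -big_split; apply: eq_bigr => c _ /=.
  by have [l _ _] := tP c; rewrite compDr compZr l mulmxDl scalemxAl.
- move=> i; have [s1 s1K K1s] : bijective (t true i) by have [_ b _] := tP true.
  have [s0 s0K K0s] : bijective (t false i) by have [_ b _] := tP false.
  pose s c : 'rV[k]_(rdim (H c) i) -> Hom CC (stalk (P_An k i)) (S c) :=
    match c return 'rV[k]_(rdim (H c) i) -> Hom CC (stalk (P_An k i)) (S c)
    with true => s1 | false => s0 end.
  have sK c : cancel (t c i) (s c) by case: c.
  have Ks c : cancel (s c) (t c i) by case: c.
  have [e1 e2 e3] := uv i.
  exists (fun x => \sum_c inj S c \oc s c (x *m v c i)) => [g|x].
    rewrite -[RHS]comp1m -(inj_prj S) comp_suml; apply: eq_bigr => c _.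
    rewrite -compmA; congr (_ \oc _); rewrite mulmx_suml (bigD1 c) //= big1 ?addr0 => [|d ne].
      by rewrite -mulmxA e1 mulmx1 sK.
    by rewrite -mulmxA e2 ?mulmx0.
  rewrite -[RHS]mulmx1 -e3 mulmx_sumr; apply: eq_bigr => c _.
  rewrite mulmxA; congr (_ *m _); rewrite comp_sumr (bigD1 c) //= big1 ?addr0 => [|d ne].
    by rewrite compmA prj_inj comp1m Ks.
  by rewrite compmA prj_inj0 ?comp0l.
move=> a g; rewrite mulmx_suml; apply: eq_bigr => c _.
by have [_ _ nt] := tP c; rewrite compmA nt -!mulmxA rhomP.
Qed.

Lemma H0_none X (H : rp) : (forall (i : 'I_n) (f : Hom CC (stalk (P_An k i)) X), f = 0) ->
  (forall i : 'I_n, rdim H i = 0%N) -> is_H0 C X H.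
Proof.
move=> z d; exists (fun i _ => 0); split.
- by move=> i c f g; rewrite scaler0 addr0.
- move=> i; exists (fun=> 0) => [f|x]; first by rewrite (z i f).
  by apply: mx_empty; rewrite d eqxx orbT.
by move=> a g; rewrite mul0mx.
Qed.

(** The canonical maps [P_i -> M] span the homomorphisms into an interval [M] and
    are compatible with the inclusions of the projectives. *)
Lemma H0_ivl c d : (c < d <= n)%N -> is_H0 C (stalk (thin (ivl c d))) (thin (ivl c d)).
Proof.
move=> cd; pose I := ivl c d; pose X := stalk (thin I); have [c1 dn] := andP cd.
have lX : labelled X (c, d.+1) := lab_ivl C (is_ivl_thin k cd).
have lP i : labelled (stalk (P_An k i)) (0%N, i.+2) := lab_ivl C (P_ivl k i).
have sX : is_seg n (c, d.+1) by rewrite /is_seg /=; lia.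
have sP (i : 'I_n) : is_seg n (0%N, i.+2) by have := ltn_ord i; rewrite /is_seg /=; lia.
have Iout (i : 'I_n) : ~~ I i -> forall f : Hom CC (stalk (P_An k i)) X, f = 0.
  move=> h; apply: (lab_none (lP i) lX (sP i) sX).
  by move: h; rewrite /I /ivl /hom_seg /hom_seg0 /hom_seg1 /=; lia.
have [ep epE] : exists ep : forall i : 'I_n, rhom (P_An k i) (thin I),
    forall i : 'I_n, I i -> forall j, ep i j = const_mx 1.
  apply: (@fin_all_exists _ (fun i : 'I_n => rhom (P_An k i) (thin I))
    (fun i ep => I i -> forall j, ep j = const_mx 1)) => i.
  have [h|h] := boolP (I i); last by exists (rhom0 _ _).
  have tP : is_thin (ivl 0 i.+1) (P_An k i) by split=> // j; rewrite /= /Pdim /ivl.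
  have ok : thin_ok n (ivl 0 i.+1) I by move: h; rewrite /thin_ok /I /ivl => h j; lia.
  by exists (@RHom _ _ (P_An k i) (thin I) (fun=> const_mx 1) (thin_okP 1 tP (thin_repP k n I) ok)).
pose e (i : 'I_n) := cl_mod C (ep i).
have e0 (i : 'I_n) : I i -> e i <> 0.
  move=> h /cl_mod_eq0/(_ i); rewrite epE // => z.
  have : (1 : k) = 0 by apply: (const_mx_inj _ _ z); rewrite /= ?/Pdim ?leqnn // h.
  by move/eqP; rewrite oner_eq0.
have [t tP] : exists t : forall i : 'I_n, Hom CC (stalk (P_An k i)) X -> 'rV[k]_(I i),
   forall i : 'I_n, [/\ forall a f g, t i (a *: f + g) = a *: t i f + t i g, bijective (t i)
     & I i -> t i (e i) = const_mx 1].
  apply: (@fin_all_exists _ (fun i : 'I_n => Hom CC (stalk (P_An k i)) X -> 'rV[k]_(I i))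
   (fun i t => [/\ forall a f g, t (a *: f + g) = a *: t f + t g, bijective t
     & I i -> t (e i) = const_mx 1])) => i.
  have [h|h] := orP (orbN (I i)); last first.
    exists (fun=> 0); split=> [a f g||h']; last by rewrite h' in h.
      by rewrite scaler0 addr0.
    exists (fun=> 0) => [f|x]; first by rewrite (Iout i h f).
    by apply: mx_empty; rewrite (negPf h) orbT.
  have hc : hom_seg n (0%N, i.+2) (c, d.+1) by move: h; rewrite /I /ivl /hom_seg /hom_seg0 /hom_seg1 /=; lia.
  have sp (f : Hom CC (stalk (P_An k i)) X) : exists s, f == s *: e i.
    have [f0 _ fS] := lab_span (lP i) lX (sP i) sX hc.
    have [x ex] := fS (e i); have [y ey] := fS f.
    have x0 : x != 0 by apply: contra_not_neq (e0 i h) => x0; rewrite ex x0 scale0r.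
    by exists (y / x); rewrite ex scalerA divfK // ey.
  pose rho f := xchoose (sp f); have rhoE f : f = rho f *: e i by apply/eqP/(xchooseP (sp f)).
  have rho1 s : rho (s *: e i) = s.
    apply/eqP; rewrite -subr_eq0; have /eqP : (rho (s *: e i) - s) *: e i = 0.
      by rewrite scalerBl -rhoE subrr.
    by rewrite scaler_eq0 => /orP[//|/eqP/(e0 i h)].
  exists (fun f => const_mx (rho f)); split=> [a f g||_].
  - rewrite {1}(rhoE f) {1}(rhoE g) scalerA -scalerDl rho1.
    by apply/matrixP => p q; rewrite !mxE.
  - exists (fun x : 'rV[k]_(I i) => (\sum_j x 0 j) *: e i) => [f|x].
      rewrite [RHS]rhoE; congr (_ *: _); under eq_bigr => j _ do rewrite mxE.
      by rewrite sumr_const card_ord h mulr1n.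
    rewrite rho1; apply/matrixP => p q; rewrite mxE ord1.
    have sub (j : 'I_(I i)) : j = q by apply: val_inj; case: j q => [j hj] [q hq] /=; move: hj hq; rewrite h; lia.
    rewrite (bigD1 q) //= big1 ?addr0 // => j; rewrite (sub j) eqxx //.
  by rewrite -[e i]scale1r rho1.
exists t; split=> [i|i|a g]; [by have [] := tP i|by have [] := tP i|].
have [h|h] := orP (orbN (I (tgt a))); last first.
  by apply: mx_empty; rewrite /= -/I (negPf h).
have [l1 b1 t1] := tP (tgt a); have [l2 b2 t2] := tP (src a).
have z1 : t (tgt a) 0 = 0 by have := l1 (-1) 0 0; rewrite scaler0 addr0 scaleN1r addNr.
have [h'|h'] := orP (orbN (I (src a))); last first.
  by rewrite (Iout _ h' g) comp0l z1 mulmx_empty // /= -/I (negPf h').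
have ea : e (src a) \oc cl_mod C (P_incl k a) = e (tgt a).
  rewrite /e cl_mod_comp; apply: cl_mod_ext => j; rewrite /= !epE // const_mxM mulr1.
  have [hj|hj] := leqP j (tgt a); last first.
    by apply: mx_empty; rewrite /= /Pdim leqNgt hj.
  by have -> : Pdim (src a) j = 1%N by rewrite /Pdim; move: hj => /=; lia.
have lin1 (i : 'I_n) (w : 'rV[k]_(I i)) : I i -> exists s, w = s *: const_mx 1.
  move=> hi; exists (\sum_j w 0 j); apply/matrixP => p q; rewrite !mxE ord1 mulr1.
  have sub (j : 'I_(I i)) : j = q by apply: val_inj; case: j q => [j hj] [q hq] /=; move: hj hq; rewrite hi; lia.
  by rewrite (bigD1 q) //= big1 ?addr0 // => j; rewrite (sub j) eqxx.
have [x ex] := lin1 _ (t (src a) g) h'.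
have z2 : t (src a) 0 = 0 by have := l2 (-1) 0 0; rewrite scaler0 addr0 scaleN1r addNr.
have eg : g = x *: e (src a).
  apply: (bij_inj b2); rewrite ex -[x *: e _]addr0 l2 z2 addr0 t2 //.
rewrite eg -[x *: e _]addr0 l2 z2 addr0 t2 // addr0 compZl ea -[x *: _]addr0 l1 z1 addr0 t1 //.
rewrite -scalemxAl; congr (_ *: _); rewrite [rmap _ _]/(const_mx 1) const_mxM mulr1.
by rewrite /= -/I h'.
Qed.

End HZero.

(** * The frozen arrows at a diagonal *)

Section FrozenNumbers.
Variable n : nat.
Implicit Types (b : bool) (p q s t j : nat).

(** The support of the module of [z]; it is empty for an edge and for a shifted
    projective. *)
Definition seg_supp (z : nat * nat) (i : nat) : bool :=
  [&& z.1 <= i, i.+1 < z.2 & z.2 <= n.+1].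

(** The frozen vertices [n + j] and [2n + j] stand for arcs that join two edges of
    the polygon: the edges starting at [j] and [n + 1], respectively at [j + 1] and
    [n + 2]. Such an arc is joined by an arrow to the diagonal of a quadrilateral
    when it crosses two opposite sides of it, and the direction of the arrow
    depends on which two. *)
Definition out1 b p q s t j : bool :=
  if t <= n.+1 then b && (q <= j < s) else ~~ b && (p <= j < q).
Definition out2 b p q s t j : bool := b && (q <= j.+1 < s).

End FrozenNumbers.

Section Frozen.
Local Open Scope ring_scope.
Variables (k : fieldType) (n : nat).
Local Notation Q := (linear_An n).
Local Notation rp := (rep k Q).
Local Notation cx := (cplx k Q).
Local Notation thin := (@thin_rep k n).
Implicit Types (M N P : rp) (X Y : cx).
Variable C : cluster_category k Q.
Local Notation CC := (cl_cat C).
Local Notation seg_obj := (@seg_obj k n).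
Local Notation labelled := (@labelled k n C).
Local Notation is_ivl := (@is_ivl k n).

Lemma H0_rep_iso X H H' : is_H0 C X H -> rep_iso H H' -> is_H0 C X H'.
Proof.
move=> [t [tl tb tn]] [f [g fg]]; exists (fun i u => t i u *m f i); split.
- by move=> i c u v; rewrite tl mulmxDl scalemxAl.
- move=> i; have [s st ts] := tb i; have [e1 e2] := fg i.
  exists (fun x : 'rV_(rdim H' i) => s (x *m g i)) => [u|x].
    by rewrite -mulmxA e1 mulmx1 st.
  by rewrite ts -mulmxA e2 mulmx1.
by move=> a u; rewrite tn -!mulmxA rhomP.
Qed.

Lemma H0_seg_obj z : is_seg n z -> is_H0 C (seg_obj z) (thin (seg_supp n z)).
Proof.
move=> sz; have [/andP[dz z2]|h] := boolP (is_diag n z && (z.2 <= n.+1)%N).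
  have zz : (z.1 < z.2.-1 <= n)%N by move: dz; rewrite /is_diag; lia.
  apply: (@H0_rep_iso _ (thin (ivl z.1 z.2.-1))); last first.
    apply: (thin_iso (thin_repP k n _) (thin_repP k n _)) => j.
    by rewrite /ivl /seg_supp; lia.
  apply: H0_iso (H0_ivl C zz) _; have := lab_ivl C (is_ivl_thin k zz).
  by have -> : (z.1, z.2.-1.+1) = z by case: (z) zz => ? [|?].
apply: H0_none => [i|i]; last first.
  rewrite -[rdim _ _]/(nat_of_bool (seg_supp n z i)); apply/eqP; rewrite eqb0.
  by move: h sz; rewrite /seg_supp /is_diag /is_seg; lia.
have s0 : is_seg n (0%N, i.+2) by have := ltn_ord i; rewrite /is_seg /=; lia.
have lZ : labelled (seg_obj z) z := iso_refl CC (seg_obj z).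
apply: (lab_none (lab_ivl C (P_ivl k i)) lZ s0 sz).
apply: contra h => hc; have [_ ->] := hom_seg_diag s0 sz hc.
by move: hc; rewrite /hom_seg /hom_seg0 /hom_seg1 /=; lia.
Qed.

Definition sides b p q s t (i : nat) : bool :=
  seg_supp n (in_side b p q s t true) i || seg_supp n (in_side b p q s t false) i.

(** The two sides have separated supports, except for the sides [(q, s)] and [(p, t)]
    with [(p, t)] a module, which are nested. *)
Lemma H0_sides b p q s t (S : dsum CC bool) Y :
  (p < q < s)%N -> (s < t <= n + 2)%N -> b || (t == n.+2) ->
  (forall c, S c = seg_obj (in_side b p q s t c)) -> isomorphic CC (total S) Y ->
  is_H0 C Y (thin (sides b p q s t)).
Proof.
move=> h1 h2 h3 eS iY; apply: H0_iso iY.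
apply: (@H0_dsum _ _ C S (fun c => thin (seg_supp n (in_side b p q s t c)))) => [c|].
  by rewrite eS; apply: H0_seg_obj; apply: in_side_seg.
apply: rdsum_thin => [c i h|i /orP[h|h]|c c' i|c c' i]; rewrite /sides.
- by case: c h => ->; rewrite ?orbT.
- by exists true.
- by exists false.
- by clear eS; case: c; case: c' => //; case: b h3; rewrite /seg_supp /in_side /=; lia.
- by clear eS; case: c; case: c' => //; case: b h3; rewrite /seg_supp /in_side /=; lia.
Qed.

Lemma H0_dim X (S : nat -> bool) H (j : 'I_n) : is_H0 C X (thin S) -> is_H0 C X H ->
  rdim H j = S j.
Proof. by move=> h h'; rewrite -(rep_iso_dim (j : vert Q) (H0_unique h h')). Qed.

(** All modules involved are intervals, and the rules subtract intervals with a common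
    end. If [t <= n + 1], both diagonals are modules and [(p, s)] precedes [(q, t)],
    via [(p, t)]; otherwise [(q, t)] is a shifted projective. In each case exactly one
    of the four rules applies. *)
Lemma frozen_iff (q0 : 'M[nat]_(n + (n + n))) r b p q s t X X' B B'
    (S S' : dsum CC bool) :
  (p < q < s)%N -> (s < t <= n + 2)%N -> is_diag n (quad_diag b p q s t) ->
  is_diag n (quad_diag (~~ b) p q s t) ->
  labelled X (quad_diag b p q s t) -> labelled X' (quad_diag (~~ b) p q s t) ->
  (forall c, S c = seg_obj (in_side (~~ b) p q s t c)) -> isomorphic CC (total S) B ->
  (forall c, S' c = seg_obj (in_side b p q s t c)) -> isomorphic CC (total S') B' ->
  frozen_rule C q0 r X X' B B' <->
  frozen_arrows q0 r (fun j => out1 n (~~ b) p q s t j : nat)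
    (fun j => out1 n b p q s t j : nat)
    (fun j => out2 (~~ b) p q s t j : nat) (fun j => out2 b p q s t j : nat).
Proof.
move=> h1 h2 d1 d2 lX lX' eS iB eS' iB'.
have hB := @H0_sides _ _ _ _ _ _ _ h1 h2 _ eS iB.
have hB' := @H0_sides _ _ _ _ _ _ _ h1 h2 _ eS' iB'.
have eqU : (t <= n.+1)%N -> rep_iso (thin (sides true p q s t)) (thin (two_ivl p q.-1 s t.-1)).
  move=> tn; apply: (thin_iso (thin_repP k n _) (thin_repP k n _)) => j.
  by rewrite /sides /two_ivl /seg_supp /ivl /in_side /=; lia.
split.
- case=> [M M' H' B1' B2' m1 m2 sc hH sp fa|M M' H B1 B2 m1 m2 sc hH sp fa
         |M H H' m1 m2 hH hH' fa|M' H H' m1 m2 hH hH' fa] j.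
  + have [y1 iM] := is_mod_lab lX d1 m1; have [y2 iM'] := is_mod_lab lX' d2 m2.
    have [o1 o2 _] := rsucc_order sc iM iM'.
    case: b d1 d2 lX lX' eS eS' hB hB' y1 y2 iM iM' o1 o2 => /= d1 d2 lX lX' eS eS' hB hB' y1 y2 iM iM' o1 o2; last by lia.
    have iU := rep_iso_trans (rep_iso_sym (eqU y2)) (H0_unique (hB' isT) hH).
    have [|||e1 e2] := rsplit_dims _ _ _ iM' iU sp j; [lia|lia|lia|].
    have [f1 f2 f3 f4] := fa j; split.
    * by rewrite f1 /out1 y2.
    * rewrite f2 /dimv e1 (is_ivl_dim j iM') /out1 y2 /ivl; lia.
    * by rewrite f3.
    * rewrite f4 /dimv e2 (is_ivl_dim j iM) /out2 /ivl; lia.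
  + have [y1 iM] := is_mod_lab lX d1 m1; have [y2 iM'] := is_mod_lab lX' d2 m2.
    have [o1 o2 _] := rsucc_order sc iM' iM.
    case: b d1 d2 lX lX' eS eS' hB hB' y1 y2 iM iM' o1 o2 => /= d1 d2 lX lX' eS eS' hB hB' y1 y2 iM iM' o1 o2; first by lia.
    have iU := rep_iso_trans (rep_iso_sym (eqU y1)) (H0_unique (hB isT) hH).
    have [|||e1 e2] := rsplit_dims _ _ _ iM iU sp j; [lia|lia|lia|].
    have [f1 f2 f3 f4] := fa j; split.
    * rewrite f1 /dimv e1 (is_ivl_dim j iM) /out1 y1 /ivl; lia.
    * by rewrite f2 /out1 y1.
    * rewrite f3 /dimv e2 (is_ivl_dim j iM') /out2 /ivl; lia.
    * by rewrite f4.
  + have [y1 iM] := is_mod_lab lX d1 m1; have y2 := shifted_proj_lab lX' d2 m2.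
    case: b d1 d2 lX lX' eS eS' hB hB' y1 y2 iM => /= d1 d2 lX lX' eS eS' hB hB' y1 y2 iM; last by lia.
    subst t; have [f1 f2 f3 f4] := fa j.
    have e1 := H0_dim j (hB (eqxx _)) hH; have e2 := H0_dim j (hB' isT) hH'.
    split.
    * rewrite f1 /dimv e1 (is_ivl_dim j iM) /out1 ltnn /sides /seg_supp /ivl /in_side /=; lia.
    * by rewrite f2 /out1 ltnn.
    * by rewrite f3.
    * rewrite f4 /dimv e2 (is_ivl_dim j iM) /out2 /sides /seg_supp /ivl /in_side /=; lia.
  have y1 := shifted_proj_lab lX d1 m1; have [y2 iM] := is_mod_lab lX' d2 m2.
  case: b d1 d2 lX lX' eS eS' hB hB' y1 y2 iM => /= d1 d2 lX lX' eS eS' hB hB' y1 y2 iM; first by lia.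
  subst t; have [f1 f2 f3 f4] := fa j.
  have e1 := H0_dim j (hB isT) hH; have e2 := H0_dim j (hB' (eqxx _)) hH'.
  split.
  * by rewrite f1 /out1 ltnn.
  * rewrite f2 /dimv e2 (is_ivl_dim j iM) /out1 ltnn /sides /seg_supp /ivl /in_side /=; lia.
  * rewrite f3 /dimv e1 (is_ivl_dim j iM) /out2 /sides /seg_supp /ivl /in_side /=; lia.
  * by rewrite f4.
move=> fa; have [tn|tn] := leqP t n.+1.
  have b1 : (q.-1 < q)%N by lia.
  have b2 : (t.-1 <= n)%N by lia.
  have iqt : is_ivl q t.-1 (thin (ivl q t.-1)).
    by apply: is_ivl_thin; clear -d1 d2 h1 h2 tn; case: b d1 d2; rewrite /is_diag /quad_diag /=; lia.
  have ips : is_ivl p s.-1 (thin (ivl p s.-1)) by apply: is_ivl_thin; lia.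
  have b3 : (q < s)%N by lia.
  have ipt : is_ivl p t.-1 (thin (ivl p t.-1)) by apply: is_ivl_thin; lia.
  have sc : rsucc (thin (ivl p s.-1)) (thin (ivl q t.-1)).
    apply: (t_trans _ _ _ (thin (ivl p t.-1))); apply: t_step.
      by apply: (rstep_ivl ips ipt); [split; lia | case; lia].
    by apply: (rstep_ivl ipt iqt); [have [? _] := iqt; split; lia | case; lia].
  have sp := rsplit_ex p b1 b3 b2 iqt.
  case: b d1 d2 lX lX' eS eS' hB hB' fa => /= d1 d2 lX lX' eS eS' hB hB' fa.
    apply: (@RuleModPred _ _ C q0 r X X' B B' (thin (ivl p s.-1)) (thin (ivl q t.-1))
      _ (thin (ivl s t.-1)) (thin (ivl p q.-1)) _ _ sc _ sp).
    - by apply: (lab_is_mod lX d1) => /=; lia.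
    - exact: (lab_is_mod lX' d2).
    - exact: H0_rep_iso (hB' isT) (eqU tn).
    move=> j; have [f1 f2 f3 f4] := fa j.
    rewrite /dimv; split; rewrite ?f1 ?f2 ?f3 ?f4 /out1 /out2 ?tn //=; rewrite /ivl; lia.
  apply: (@RuleModSucc _ _ C q0 r X X' B B' (thin (ivl q t.-1)) (thin (ivl p s.-1))
      _ (thin (ivl s t.-1)) (thin (ivl p q.-1)) _ _ sc _ sp).
  - exact: (lab_is_mod lX d1).
  - by apply: (lab_is_mod lX' d2) => /=; lia.
  - exact: H0_rep_iso (hB isT) (eqU tn).
  move=> j; have [f1 f2 f3 f4] := fa j.
  rewrite /dimv; split; rewrite ?f1 ?f2 ?f3 ?f4 /out1 /out2 ?tn //=; rewrite /ivl; lia.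
have et : t = n.+2 by lia.
subst t.
case: b d1 d2 lX lX' eS eS' hB hB' fa => /= d1 d2 lX lX' eS eS' hB hB' fa.
  have lM := lab_is_mod lX d1 ltac:(rewrite /=; lia).
  apply: (@RuleShiftX' _ _ C q0 r X X' B B' _ _ _ lM (lab_shifted_proj lX' d2 erefl)
    (hB (eqxx _)) (hB' isT)).
  move=> j; have [f1 f2 f3 f4] := fa j.
  rewrite /dimv; split; rewrite ?f1 ?f2 ?f3 ?f4 /out1 /out2 ?ltnn //=;
    rewrite /sides /seg_supp /in_side /ivl /=; lia.
have lM := lab_is_mod lX' d2 ltac:(rewrite /=; lia).
apply: (@RuleShiftX _ _ C q0 r X X' B B' _ _ _ (lab_shifted_proj lX d1 erefl) lM
    (hB isT) (hB' (eqxx _))).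
move=> j; have [f1 f2 f3 f4] := fa j.
rewrite /dimv; split; rewrite ?f1 ?f2 ?f3 ?f4 /out1 /out2 ?ltnn //=;
  rewrite /sides /seg_supp /in_side /ivl /=; lia.
Qed.

End Frozen.

(** * Quadrilaterals and numbers of arrows under a flip *)

Section Flips.
Variable n : nat.
Implicit Types (x : 'I_n -> nat * nat) (b : bool) (p q s t e : nat) (z : nat * nat).

Lemma flip_diagE b p q s t : flip_diag b p q s t = quad_diag (~~ b) p q s t.
Proof. by case: b. Qed.

Lemma sideT_flip x r y z : sideT x z -> z <> x r -> sideT (flip x r y) z.
Proof.
move=> [sz [dz|[i ei]]] ne; split=> //; [by left | right; exists i].
by rewrite /flip; case: eqP => // e; rewrite -ei e in ne.
Qed.

Lemma sideT_self x r : tri x -> sideT x (x r).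
Proof. by move=> [dx _ _]; split; [exact: diag_seg | right; exists r]. Qed.

Lemma flip_quad x r b p q s t : quad x r b p q s t ->
  quad (flip x r (flip_diag b p q s t)) r (~~ b) p q s t.
Proof.
move=> [h1 h2 e [s1 s2] [s3 s4]]; split=> //.
- by rewrite /flip eqxx flip_diagE.
- by split; apply: sideT_flip => //; rewrite e; case: (b) => -[]; lia.
by split; apply: sideT_flip => //; rewrite e; case: (b) => -[]; lia.
Qed.

(** The side number [m] of the quadrilateral, and the quadrilateral around that
    side, with [e] its vertex away from the diagonal; the side [(p, t)] appears
    twice, as [e] may lie on either end. *)
Definition side_nth (m : 'I_5) p q s t : nat * nat :=
  match val m with 0 => (p, q) | 1 => (q, s) | 2 => (s, t) | _ => (p, t) end.
Definition side_apex (m : 'I_5) p q s t e : bool :=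
  match val m with
  | 0 => p < e < q | 1 => q < e < s | 2 => s < e < t | 3 => e < p | _ => t < e <= n + 2
  end.
Definition side_quad (m : 'I_5) b p q s t e : bool * nat * nat * nat * nat :=
  match val m with
  | 0 => (true, p, e, q, if b then s else t)
  | 1 => if b then (false, p, q, e, s) else (true, q, e, s, t)
  | 2 => (false, if b then p else q, s, e, t)
  | 3 => (false, e, p, if b then s else q, t)
  | _ => (true, p, if b then s else q, t, e)
  end.
Definition side_new (m : 'I_5) p q s t e (c : bool) : nat * nat :=
  match val m with
  | 0 => if c then (p, e) else (e, q) | 1 => if c then (q, e) else (e, s)
  | 2 => if c then (s, e) else (e, t) | 3 => if c then (e, p) else (e, t)
  | _ => if c then (p, e) else (t, e) end.
Definition is_quad x l (c : bool * nat * nat * nat * nat) :=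
  let: (b, p, q, s, t) := c in quad x l b p q s t.

Lemma ord5 (P : 'I_5 -> Prop) : P (@Ordinal 5 0 isT) -> P (@Ordinal 5 1 isT) ->
  P (@Ordinal 5 2 isT) -> P (@Ordinal 5 3 isT) -> P (@Ordinal 5 4 isT) -> forall m, P m.
Proof.
move=> h0 h1 h2 h3 h4 [[|[|[|[|[|m]]]]] hm] //; [move: h0|move: h1|move: h2|move: h3|move: h4];
  by congr P; apply: val_inj.
Qed.

Lemma side_quadP m x r l b p q s t e : tri x -> quad x r b p q s t ->
  x l = side_nth m p q s t -> side_apex m p q s t e ->
  (forall c, sideT x (side_new m p q s t e c)) -> is_quad x l (side_quad m b p q s t e).
Proof.
move=> tx [h1 h2 er [s1 s2] [s3 s4]]; have := sideT_self r tx; rewrite er => sr.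
move: m; apply: ord5; rewrite /side_nth /side_apex /side_new /side_quad /= => el he hs;
  have t1 := hs true; have t2 := hs false; simpl in t1, t2; case: b er sr => /= er sr;
  split=> //; lia.
Qed.

Lemma sideT_le x z : tri x -> sideT x z -> z.1 < z.2 <= n + 2.
Proof. by move=> _ []. Qed.

(** [side_quadP] is used for the triangulation and for its flip: the vertex [e] and the
    two sides at it are the same for both. *)
Lemma side_quad_ex x r l b p q s t m' : tri x -> quad x r b p q s t -> x l = side_nth m' p q s t ->
  l != r -> exists m e, [/\ side_nth m p q s t = side_nth m' p q s t,
    side_apex m p q s t e, is_quad x l (side_quad m b p q s t e)
  & is_quad (flip x r (flip_diag b p q s t)) l (side_quad m (~~ b) p q s t e)].
Proof.
move=> tx qx el lr.
suff [m [e [em he hs]]] : exists m e, [/\ side_nth m p q s t = side_nth m' p q s t,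
    side_apex m p q s t e & forall c, sideT x (side_new m p q s t e c)].
  have [h1 h2 er [s1 s2] [s3 s4]] := qx.
  exists m, e; split=> //; first by apply: (side_quadP tx qx) => //; rewrite em.
  apply: (side_quadP (flip_tri tx qx) (flip_quad qx)) => // [|c].
    by rewrite /flip (negPf lr) em.
  apply: sideT_flip => //; rewrite er; clear -h1 h2 he.
  by case: c; case: b; move: m he; apply: ord5; rewrite /side_apex /side_new /= => he []; lia.
have [dx _ _] := tx; have dl := dx l; have shift_lab := sideT_self l tx.
rewrite el in dl shift_lab.
have inner (m : 'I_5) : val m < 3 -> side_nth m p q s t = side_nth m' p q s t ->
   exists m e, [/\ side_nth m p q s t = side_nth m' p q s t,
    side_apex m p q s t e & forall c, sideT x (side_new m p q s t e c)].
  move=> m3 em; rewrite -em in dl shift_lab.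
  have [e [he t1 t2]] : exists e, [/\ (side_nth m p q s t).1 < e < (side_nth m p q s t).2,
      sideT x ((side_nth m p q s t).1, e) & sideT x (e, (side_nth m p q s t).2)].
    apply: apex => //; last by rewrite -surjective_pairing.
    by move: dl; rewrite /is_diag; lia.
  exists m, e; split=> // [|c]; move: m m3 em dl shift_lab he t1 t2; apply: ord5 => //=;
    by case: c.
move: m' el dl shift_lab inner; apply: ord5; rewrite /side_nth /= => el dl shift_lab inner.
- by apply: (inner (@Ordinal 5 0 isT)).
- by apply: (inner (@Ordinal 5 1 isT)).
- by apply: (inner (@Ordinal 5 2 isT)).
- have := outer l tx; rewrite el => -[[e [he t1 t2]]|[e [he t1 t2]]].
    by exists (@Ordinal 5 3 isT), e; split=> // -[].
  exists (@Ordinal 5 4 isT), e; split=> [//||[]//].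
  by have := sideT_le tx t1; rewrite /side_apex /=; lia.
have := outer l tx; rewrite el => -[[e [he t1 t2]]|[e [he t1 t2]]].
  by exists (@Ordinal 5 3 isT), e; split=> // -[].
exists (@Ordinal 5 4 isT), e; split=> [//||[]//].
by have := sideT_le tx t1; rewrite /side_apex /=; lia.
Qed.

(** At most one of these sides is the diagonal that an arrow may point to. *)
Lemma side_new_uniq m p q s t e : p < q < s -> s < t <= n + 2 -> side_apex m p q s t e ->
  uniq [:: side_new m p q s t e true; side_new m p q s t e false; (p, q); (q, s); (s, t); (p, t)].
Proof.
move=> h1 h2; move: m; apply: ord5; rewrite /side_apex /side_new /= => he;
  rewrite !inE !negb_or !xpair_eqE; do ?[apply/andP; split => //]; lia.
Qed.

(** The vertices of the ice quiver, the mutable ones replaced by their diagonals so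
    that they can be compared with sides. *)
Definition target := ((nat * nat) + (nat + nat))%type.

(** The number of arrows from the diagonal of the quadrilateral to [v]. *)
Definition arrows_out (v : target) b p q s t : bool :=
  match v with
  | inl z => (z == in_side b p q s t true) || (z == in_side b p q s t false)
  | inr (inl j) => out1 n b p q s t j
  | inr (inr j) => out2 b p q s t j
  end.
(** Both directions at once: the incoming arrows are the outgoing ones with the roles
    of the two diagonals exchanged. *)
Definition arrow_in_or_out (v : target) (neg : bool) (c : bool * nat * nat * nat * nat) : bool :=
  let: (b, p, q, s, t) := c in arrows_out v (neg (+) b) p q s t.

Definition in_side_nth (m : 'I_5) : bool := (val m == 0) || (val m == 2).

(** Flipping a diagonal changes the numbers of arrows at a side of its
    quadrilateral as prescribed by quiver mutation. A diagonal [v] is at most one of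
    the segments involved ([side_new_uniq]), which leaves a few boolean cases; an arc
    is arithmetic. *)
Lemma arrows_flip m v b p q s t e : p < q < s -> s < t <= n + 2 -> side_apex m p q s t e ->
  (forall z, v = inl z -> [/\ z <> (p, s), z <> (q, t) & z <> side_nth m p q s t]) ->
  let o := arrow_in_or_out v false (side_quad m b p q s t e) in
  let i := arrow_in_or_out v true (side_quad m b p q s t e) in
  let w := if in_side_nth m == b then arrows_out v (~~ b) p q s t else arrows_out v b p q s t in
  nat_of_bool (arrow_in_or_out v false (side_quad m (~~ b) p q s t e)) =
    (if in_side_nth m == b then o - (i + w) else (o + w) - i) /\
  nat_of_bool (arrow_in_or_out v true (side_quad m (~~ b) p q s t e)) =
    (if in_side_nth m == b then (i + w) - o else i - (o + w)).
Proof.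
move=> h1 h2 he hv.
case: v hv => [z hv|[j _|j _]].
- have [/eqP/negPf n1 /eqP/negPf n2 /eqP/negPf n3] := hv _ erefl.
  have := count_uniq_mem z (side_new_uniq h1 h2 he).
  rewrite /= !(eq_sym _ z) => ct.
  have {}ct : (z == side_new m p q s t e true) + ((z == side_new m p q s t e false) +
     ((z == (p, q)) + ((z == (q, s)) + ((z == (s, t)) + (z == (p, t)))))) <= 1.
    by rewrite -[X in X <= _]addn0 -!addnA ct; case: (_ \in _).
  clear hv he h1 h2; move: m n3 ct; apply: ord5;
  rewrite /side_nth /side_new /side_quad /arrow_in_or_out /arrows_out /in_side_nth /in_side /= => n3;
  case: b => /=; rewrite ?n1 ?n2 ?n3 /=; clear n1 n2 n3;
  repeat match goal with |- context [z == ?y] => move: (z == y) => ? end; lia.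
- move: m he; apply: ord5; rewrite /side_apex /side_quad /arrow_in_or_out /arrows_out /in_side_nth /out1 /= => he;
  case: b => /=; split; do ?case: ifP => ? /=; lia.
- move: m he; apply: ord5; rewrite /side_apex /side_quad /arrow_in_or_out /arrows_out /in_side_nth /out2 /= => he;
  case: b => /=; split; lia.
Qed.

End Flips.

(** * The ice quiver of a triangulation *)

Section QuiverOfTriangulation.
Variable n : nat.
Local Notation V := 'I_(n + (n + n)).
Implicit Types (x : 'I_n -> nat * nat) (v w : V) (b neg : bool).

Local Arguments arrow_in_or_out : simpl never.
Local Arguments arrows_out : simpl never.

Lemma arrowsE (u : target) neg b p q s t :
  arrow_in_or_out n u neg (b, p, q, s, t) = arrows_out n u (neg (+) b) p q s t.
Proof. by []. Qed.

Definition target_of x v : target :=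
  match split v with
  | inl j => inl (x j)
  | inr u => inr match split u with inl j => inl (val j) | inr j => inr (val j) end
  end.

Lemma vcase (P : V -> Prop) : (forall j, P (vmut j)) -> (forall j, P (vfr1 j)) ->
  (forall j, P (vfr2 j)) -> forall v, P v.
Proof.
move=> h1 h2 h3 v; case: (split_ordP v) => [j ->|u ->]; first exact: h1.
by case: (split_ordP u) => j ->; [exact: h2 | exact: h3].
Qed.

Lemma target_vmut x (j : 'I_n) : target_of x (vmut j) = inl (x j).
Proof. by rewrite /target_of /vmut (unsplitK (inl j)). Qed.
Lemma target_vfr1 x (j : 'I_n) : target_of x (vfr1 j) = inr (inl (val j)).
Proof. by rewrite /target_of /vfr1 (unsplitK (inr (lshift n j))) (unsplitK (inl j)). Qed.
Lemma target_vfr2 x (j : 'I_n) : target_of x (vfr2 j) = inr (inr (val j)).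
Proof. by rewrite /target_of /vfr2 (unsplitK (inr (rshift n j))) (unsplitK (inr j)). Qed.

Lemma vmut_inj : injective (@vmut n).
Proof. exact: lshift_inj. Qed.
Lemma vmut_lt (j : 'I_n) : (n <= vmut j) = false.
Proof. by rewrite /= leqNgt ltn_ord. Qed.

(** The arrows between [r] and the other vertices read off from a quadrilateral. *)
Definition row x (q : 'M[nat]_(n + (n + n))) r c : Prop := forall v,
  q (vmut r) v = arrow_in_or_out n (target_of x v) false c /\ q v (vmut r) = arrow_in_or_out n (target_of x v) true c.

Definition is_QT x (q : 'M[nat]_(n + (n + n))) : Prop :=
  (forall v w, n <= v -> n <= w -> q v w = 0) /\
  forall r, exists2 c, is_quad x r c & row x q r c.

Lemma quad_exc x r : tri x -> exists c, is_quad x r c.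
Proof. by move=> tx; have [b [p [q [s [t h]]]]] := quad_ex r tx; exists (b, p, q, s, t). Qed.

Lemma arrows_self x r c neg : is_quad x r c -> arrow_in_or_out n (inl (x r)) neg c = false.
Proof.
case: c => [[[[b p] q] s] t] [h1 h2 e _ _]; rewrite e /arrow_in_or_out /arrows_out.
have [n1 n2] := in_side_ne b true h1 h2; have [n3 n4] := in_side_ne b false h1 h2.
rewrite -/(quad_diag b p q s t); case: neg => /=.
  by apply/negbTE; rewrite negb_or; apply/andP; split; apply/eqP => /esym.
by apply/negbTE; rewrite negb_or; apply/andP; split; apply/eqP => /esym.
Qed.

Lemma arrows_excl x r c (v : target) : is_quad x r c -> arrow_in_or_out n v false c -> arrow_in_or_out n v true c -> False.
Proof.
case: c => [[[[b p] q] s] t] [h1 h2 _ _ _]; rewrite /arrow_in_or_out /arrows_out; case: v => [z|[j|j]] /=.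
- case: b; rewrite /in_side /= => /orP[]/eqP-> /orP[] /eqP[]; lia.
- by rewrite /out1; case: b; case: ifP => _ /=; lia.
by rewrite /out2; case: b => /=; lia.
Qed.

(** The two descriptions of an arrow between diagonals, from the quadrilateral of
    either, agree: both count irreducible maps. *)
Lemma irred_arrows x r c i neg : tri x -> is_quad x r c ->
  arrow_in_or_out n (inl (x i)) neg c = if neg then irredx x r i else irredx x i r.
Proof.
move=> tx; case: c => [[[[b p] q] s] t] h; rewrite /arrow_in_or_out /arrows_out; case: neg => /=.
  by rewrite (irred_out i tx h).
by rewrite (irred_in i tx h).
Qed.

(** There are no 2-cycles because the two pairs of opposite sides are disjoint. *)
Lemma is_QT_ice x q : is_QT x q -> ice_quiver n q.
Proof.
move=> [z h]; split=> [|v w|v w]; last exact: z.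
  apply: vcase => [r|j|j]; [|by apply: z; rewrite /= leq_addr..].
  by have [c qc /(_ (vmut r))[-> _]] := h r; rewrite target_vmut arrows_self.
have mut r u : q (vmut r) u = 0 \/ q u (vmut r) = 0.
  have [c qc /(_ u)[-> ->]] := h r.
  case e1: (arrow_in_or_out _ _ false _); case e2: (arrow_in_or_out _ _ true _); [|by right|by left|by left].
  by have := arrows_excl qc e1 e2.
have [vn|vn] := leqP n v; last first.
  have -> : v = vmut (Ordinal vn) by apply: val_inj.
  exact: mut.
have [wn|wn] := leqP n w; first by left; apply: z.
have -> : w = vmut (Ordinal wn) by apply: val_inj.
by case: (mut (Ordinal wn) v); [right|left].
Qed.

Lemma QT_exists x : tri x -> exists q, is_QT x q.
Proof.
move=> tx; have [c hc] : exists c : 'I_n -> bool * nat * nat * nat * nat, forall r, is_quad x r (c r).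
  by apply: (@fin_all_exists _ _ (fun r c => is_quad x r c)) => r; apply: quad_exc.
pose f v w : nat := match split v, split w with
  | inl r, _ => arrow_in_or_out n (target_of x w) false (c r)
  | _, inl r => arrow_in_or_out n (target_of x v) true (c r)
  | _, _ => 0
  end.
pose q : 'M[nat]_(n + (n + n)) := (\matrix_(v, w) f v w)%R.
exists q; split=> [|r].
  apply: vcase => j; [move=> w; by rewrite vmut_lt|..]; apply: vcase => l; rewrite ?vmut_lt // !mxE /f.
  - by rewrite /vfr1 (unsplitK (inr (lshift n j))) (unsplitK (inr (lshift n l))).
  - by rewrite /vfr1 /vfr2 (unsplitK (inr (lshift n j))) (unsplitK (inr (rshift n l))).
  - by rewrite /vfr1 /vfr2 (unsplitK (inr (rshift n j))) (unsplitK (inr (lshift n l))).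
  by rewrite /vfr2 (unsplitK (inr (rshift n j))) (unsplitK (inr (rshift n l))).
exists (c r) => // v; rewrite !mxE /f /vmut (unsplitK (inl r)); split=> //.
move: v; apply: vcase => j; rewrite /vmut /vfr1 /vfr2.
- rewrite (unsplitK (inl j)) -!/(vmut _) !target_vmut.
  by rewrite (irred_arrows r false tx (hc j)) (irred_arrows j true tx (hc r)).
- by rewrite (unsplitK (inr (lshift n j))).
by rewrite (unsplitK (inr (rshift n j))).
Qed.

Lemma mutateE r q v w : ~~ ((n <= v) && (n <= w)) -> mutate n r q v w =
  let a i j := q i j + q i r * q r j in
  if (v == r) || (w == r) then a w v - a v w else a v w - a w v.
Proof.
by move=> /negPf h; rewrite !mxE h [(w == r) || _]orbC; case: ifP.
Qed.

Lemma arrows_side m b p q s t : p < q < s -> s < t <= n + 2 ->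
  arrows_out n (inl (side_nth m p q s t)) b p q s t = (in_side_nth m == b).
Proof.
by move=> h1 h2; move: m; apply: ord5; rewrite /arrows_out /side_nth /in_side /in_side_nth /=;
  case: b => /=; rewrite !xpair_eqE; lia.
Qed.

Lemma side_nth_ex x l b p q s t : on_side x b p q s t l -> exists m, x l = side_nth m p q s t.
Proof.
move=> /on_sideP[c ->]; case: b; case: c.
- by exists (@Ordinal 5 0 isT).
- by exists (@Ordinal 5 2 isT).
- by exists (@Ordinal 5 1 isT).
by exists (@Ordinal 5 3 isT).
Qed.

(** Mutation at [r] reverses the row of [r]. A row [l] changes only if [x l] is a side
    of the quadrilateral of [r]; then it changes as in [arrows_flip]. *)
Lemma mutate_triangulation_quiver x q0 r b p q s t : tri x -> (forall l c, is_quad x l c -> row x q0 l c) ->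
  (forall v w, n <= v -> n <= w -> q0 v w = 0) ->
  quad x r b p q s t -> is_QT (flip x r (flip_diag b p q s t)) (mutate n (vmut r) q0).
Proof.
move=> tx hq z qx; set x' := flip _ _ _; have tx' : tri x' := flip_tri tx qx.
have [h1 h2 er _ _] := qx; have [_ _ ix] := tx; have [_ _ ix'] := tx'.
have rr := hq r (b, p, q, s, t) qx.
have q0rr : q0 (vmut r) (vmut r) = 0.
  by have [-> _] := rr (vmut r); rewrite target_vmut (arrows_self false (c := (b, p, q, s, t)) qx).
have tgE v : v != vmut r -> target_of x' v = target_of x v.
  move: v; apply: vcase => j; rewrite ?target_vmut ?target_vfr1 ?target_vfr2 // (inj_eq vmut_inj).
  by rewrite /x' /flip => /negPf->.
have qx' : quad x' r (~~ b) p q s t := flip_quad qx.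
split=> [v w vn wn|l]; first by rewrite mxE vn wn.
have [->|lr] := eqVneq l r.
  exists (~~ b, p, q, s, t) => // v.
  rewrite !mutateE ?vmut_lt ?andbF // eqxx orbT /= q0rr muln0 mul0n !addn0.
  have [ev|nv] := eqVneq v (vmut r).
    by rewrite ev q0rr target_vmut !(arrows_self _ (c := (~~ b, p, q, s, t)) qx').
  have [e1 e2] := rr v; rewrite tgE // e1 e2 /=.
  have := arrows_excl (v := target_of x v) (c := (b, p, q, s, t)) qx; rewrite /arrow_in_or_out /= negbK.
  by case: (arrows_out _ _ b _ _ _ _) => //=; case: (arrows_out _ _ _ _ _ _ _) => //= /(_ isT isT).
have x'l : x' l = x l by rewrite /x' /flip (negPf lr).
have vl : (vmut l == vmut r) = false by rewrite (inj_eq vmut_inj) (negPf lr).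
suff [c [c' [qc qc' hc]]] : exists c c', [/\ is_quad x l c, is_quad x' l c' &
   forall v, v != vmut r -> v != vmut l ->
    let a i j := q0 i j + q0 i (vmut r) * q0 (vmut r) j in
    arrow_in_or_out n (target_of x v) false c' = a (vmut l) v - a v (vmut l) :> nat /\
    arrow_in_or_out n (target_of x v) true c' = a v (vmut l) - a (vmut l) v :> nat].
  exists c' => // v; rewrite !mutateE ?vmut_lt ?andbF // vl orbF /=.
  have [ev|nv] := eqVneq v (vmut r); last first.
    have [evl|nvl] := eqVneq v (vmut l).
      by rewrite evl subnn target_vmut !(arrows_self _ qc').
    by rewrite tgE //; have [-> ->] := hc v nv nvl.
  rewrite ev q0rr muln0 mul0n !addn0 target_vmut.
  rewrite !(irred_arrows r _ tx' qc') (irred_in l tx' qx') (irred_out l tx' qx') negbK.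
  have o b0 : on_side x' b0 p q s t l = arrows_out n (inl (x l)) b0 p q s t.
    by rewrite /on_side x'l.
  have [e1 e2] := rr (vmut l); rewrite e1 e2 target_vmut !o /arrow_in_or_out /=.
  have := arrows_excl (v := inl (x l)) (c := (b, p, q, s, t)) qx; rewrite /arrow_in_or_out /=.
  by case: (arrows_out _ _ b _ _ _ _); case: (arrows_out _ _ _ _ _ _ _) => //= /(_ isT isT).
have [side|noside] := boolP (on_side x b p q s t l || on_side x (~~ b) p q s t l).
  have [m' em'] : exists m, x l = side_nth m p q s t.
    by case/orP: side => /side_nth_ex.
  have [m [e [em he qc qc']]] := side_quad_ex tx qx em' lr.
  exists (side_quad m b p q s t e), (side_quad m (~~ b) p q s t e); split=> // v nr nl.
  have [e1 e2] := hq l _ qc v; have [e3 e4] := rr v; have [e5 e6] := rr (vmut l).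
  have xl : x l = side_nth m p q s t by rewrite em.
  rewrite /= e1 e2 e3 e4 e5 e6 target_vmut !arrowsE /= xl !arrows_side //.
  have [|i1 i2] := @arrows_flip n m (target_of x v) b p q s t e h1 h2 he.
    move=> y ey; move: v nr nl e1 e2 e3 e4 ey; apply: vcase => j; rewrite ?target_vmut ?target_vfr1 ?target_vfr2 //.
    rewrite !(inj_eq vmut_inj) => jr jl _ _ _ _ [<-].
    have n1 : x j <> x r by move/ix => ej; rewrite ej eqxx in jr.
    have n2 : x j <> flip_diag b p q s t.
      have -> : flip_diag b p q s t = x' r by rewrite /x' /flip eqxx.
      have <- : x' j = x j by rewrite /x' /flip (negPf jr).
      by move/ix' => ej; rewrite ej eqxx in jr.
    have [n3 n4] : x j <> (p, s) /\ x j <> (q, t).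
      by move: n1 n2; rewrite er /flip_diag; case: (b).
    by split=> //; rewrite -xl => /ix ej; rewrite ej eqxx in jl.
  rewrite i1 i2; have [eb|nb] := eqVneq (in_side_nth m) b.
    by rewrite eb; case: (b) => /=; rewrite ?mul0n ?mul1n ?muln1 ?muln0 ?addn0.
  have -> : (in_side_nth m == ~~ b) by case: (in_side_nth m) (b) nb => [] [].
  by rewrite ?mul0n ?mul1n ?muln1 ?muln0 ?addn0.
have [c qc] := quad_exc l tx; exists c, c; move: noside; rewrite negb_or => /andP[ns1 ns2].
have l0 : q0 (vmut l) (vmut r) = 0.
  by have [_ ->] := rr (vmut l); rewrite target_vmut -[arrow_in_or_out _ _ _ _]/(on_side x (~~ b) p q s t l) (negPf ns2).
have r0 : q0 (vmut r) (vmut l) = 0.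
  by have [-> _] := rr (vmut l); rewrite target_vmut -[arrow_in_or_out _ _ _ _]/(on_side x b p q s t l) (negPf ns1).
split=> // [|v nr nl]; last first.
  have [e1 e2] := hq l _ qc v; rewrite /= l0 r0 !(mul0n, muln0) !addn0 e1 e2.
  have := arrows_excl (v := target_of x v) qc.
  by case: (arrow_in_or_out _ _ false _); case: (arrow_in_or_out _ _ true _) => //= /(_ isT isT).
have := irred_arrows r false tx qc; have := irred_arrows r true tx qc.
rewrite (irred_in l tx qx) (irred_out l tx qx) (negPf ns1) (negPf ns2).
case: c qc => [[[[bl pl] ql] shift_lab] tl] qc; rewrite !arrowsE /= => s1 s2.
have ne b' c : in_side b' pl ql shift_lab tl c <> x r.
  move=> e; have : arrows_out n (inl (x r)) b' pl ql shift_lab tl.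
    by rewrite /arrows_out -e; case: (c); rewrite eqxx ?orbT.
  by move: s1 s2; case: (b'); case: (bl) => /= s1 s2; rewrite ?s1 ?s2.
have [k1 k2 k3 [k4 k5] [k6 k7]] := qc; split=> //; first by rewrite x'l.
- by split; apply: sideT_flip => //; [apply: (ne true true) | apply: (ne false true)].
by split; apply: sideT_flip => //; [apply: (ne true false) | apply: (ne false false)].
Qed.

End QuiverOfTriangulation.

(** * The ice quiver of a cluster tilting object *)

Section IceQuiver.
Local Open Scope ring_scope.
Variables (k : fieldType) (n : nat).
Variable C : cluster_category k (linear_An n).
Local Notation CC := (cl_cat C).
Local Notation seg_obj := (@seg_obj k n).
Local Notation labelled := (@labelled k n C).
Implicit Types (T : dsum CC 'I_n) (x : 'I_n -> nat * nat).

Lemma end_quiver_tri T x i j m : tri x -> (forall i, labelled (T i) (x i)) ->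
  end_quiver T i j m <-> m = irredx x i j.
Proof.
move=> [dx nx ix] lT; apply: end_quiver_irred.
- by move=> l; apply: lab_brick (lT l) (dx l).
- by move=> a b nh; apply: (lab_none (lT a) (lT b) (diag_seg (dx a)) (diag_seg (dx b)) nh).
- by move=> a b h; apply: (lab_span (lT a) (lT b) (diag_seg (dx a)) (diag_seg (dx b)) h).
- by move=> a b c f g; apply: (lab_comp (lT a) (lT b) (lT c)).
- by move=> a b c; apply: comp_seg_hom.
move=> a b K; apply: ix; have := dx a; have := dx b; move: K.
rewrite /comp_seg /hom_seg0 /hom_seg1 /is_diag; case: (x a) => u v; case: (x b) => u' v' /= h1 h2 h3.
by congr pair; lia.
Qed.

Lemma mutation_label T T' x r b p q s t : tri x -> (forall i, labelled (T i) (x i)) ->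
  quad x r b p q s t -> is_mutation r T T' ->
  forall i, labelled (T' i) (flip x r (flip_diag b p q s t) i).
Proof.
move=> tx lT qx [eT ne ctT']; have [x' [tx' lT']] := ct_tri ctT'.
have [dx _ _] := tx; have [dx' _ _] := tx'.
have e j : j != r -> x' j = x j.
  by move=> nj; apply: (lab_inj _ (lT j) (dx' j) (dx j)); rewrite -eT.
have xr : x' r = flip_diag b p q s t.
  apply: (flip_unique tx tx' qx e) => er; apply: ne.
  by apply: (iso_trans (lT' r)); rewrite er; apply: iso_sym; apply: lT.
by move=> i; rewrite /flip; case: eqVneq => [->|ni]; [rewrite -xr | rewrite -e].
Qed.

(** All mutations at [r] have the same label at [r] and approximations are unique, so
    that the frozen rule depends on the quadrilateral of [r] only. *)
Lemma frozen_row T T' x r b p q s t B B' (f : Hom CC B (T' r)) (f' : Hom CC B' (T r)) q0 :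
  tri x -> (forall i, labelled (T i) (x i)) -> quad x r b p q s t ->
  is_mutation r T T' -> min_right_approx T r f -> min_right_approx T r f' ->
  frozen_rule C q0 r (T r) (T' r) B B' <->
  frozen_arrows q0 r (fun j => out1 n (~~ b) p q s t j : nat)
    (fun j => out1 n b p q s t j : nat)
    (fun j => out2 (~~ b) p q s t j : nat) (fun j => out2 b p q s t j : nat).
Proof.
move=> tx lT qx mu af af'; have lT' := mutation_label tx lT qx mu.
have tx' := flip_tri tx qx; have qx' := flip_quad qx.
have [S' [g' [eS' ag']]] := approx_ex tx qx (fun j _ => lT j) (lT r).
have lT2 j : j != r -> labelled (T j) (flip x r (flip_diag b p q s t) j).
  by move=> nj; have [eT _ _] := mu; rewrite -eT.
have [S [g [eS ag]]] := approx_ex tx' qx' lT2 (lT' r).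
have [h1 h2 er _ _] := qx; have [dx _ _] := tx; have [dx' _ _] := tx'.
have er' : flip x r (flip_diag b p q s t) r = quad_diag (~~ b) p q s t.
  by rewrite /flip eqxx flip_diagE.
apply: (frozen_iff q0 r h1 h2 _ _ _ _ eS _ eS' _).
- by have := dx r; rewrite er.
- by rewrite -er'.
- by have := lT r; rewrite er.
- by rewrite -er'.
- exact: (min_approx_unique ag af (iso_refl CC _)).
exact: (min_approx_unique ag' af' (iso_refl CC _)).
Qed.

(** The row of [r] is forced by any quadrilateral; this is the uniqueness of the ice
    quiver. *)
Lemma QT_of_ice T x q0 r c : tri x -> (forall i, labelled (T i) (x i)) ->
  is_ice_quiver_of T q0 -> is_quad x r c -> row x q0 r c.
Proof.
move=> tx lT [_ eq0 fr] qc v; move: v; apply: vcase => j.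
- rewrite target_vmut !(irred_arrows j _ tx qc).
  by split; apply/(end_quiver_tri _ _ _ tx lT).
- have [T' [B [B' [f [f' [mu af af' rule]]]]]] := fr r.
  case: c qc => [[[[b p] q] s] t] qc.
  have /(_ j)[e1 e2 _ _] := (frozen_row q0 tx lT qc mu af af').1 rule.
  by rewrite target_vfr1 !arrowsE; split; apply/eqP; rewrite -eqz_nat; apply/eqP.
have [T' [B [B' [f [f' [mu af af' rule]]]]]] := fr r.
case: c qc => [[[[b p] q] s] t] qc.
have /(_ j)[_ _ e1 e2] := (frozen_row q0 tx lT qc mu af af').1 rule.
by rewrite target_vfr2 !arrowsE; split; apply/eqP; rewrite -eqz_nat; apply/eqP.
Qed.

(** The mutation at [r] that the frozen rule requires exists: it is the cluster tilting
    object of the flipped triangulation. *)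
Lemma ice_of_QT T x q0 : cluster_tilting T -> tri x -> (forall i, labelled (T i) (x i)) ->
  is_QT x q0 -> is_ice_quiver_of T q0.
Proof.
move=> ctT tx lT hq; have [_ rows] := hq; split; first exact: is_QT_ice hq.
  move=> r s; apply/(end_quiver_tri _ _ _ tx lT).
  have [c qc rc] := rows r; have [_ ->] := rc (vmut s).
  by rewrite target_vmut (irred_arrows s true tx qc).
move=> r; have [[[[[b p] q] s] t] qc rc] := rows r.
pose z := flip_diag b p q s t; pose x' := flip x r z; have tx' := flip_tri tx qc.
have qx' := flip_quad qc.
have [|T' [eT' ctT']] := @tri_ct k n C x' (fun j => if j == r then seg_obj z else T j) tx'.
  move=> i; rewrite /x' /flip; case: eqP => // _; exact: (iso_refl CC (seg_obj z)).
have [dx _ _] := tx; have [dx' _ ix'] := tx'.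
have lT' i : labelled (T' i) (x' i).
  rewrite eT' /x' /flip; case: eqP => // _; exact: (iso_refl CC (seg_obj z)).
have mu : is_mutation r T T'.
  split=> // [j nj|iso]; first by rewrite eT' (negPf nj).
  have e : x' r = x r := lab_inj (lT' r) (iso_trans iso (lT r) : labelled _ _) (dx' r) (dx r).
  move: e; rewrite /x' /flip eqxx; have [h1 h2 -> _ _] := qc; rewrite /z /flip_diag.
  by case: (b) => -[]; lia.
have [S' [f' [_ af']]] := approx_ex tx qc (fun j _ => lT j) (lT r).
have lT2 j : j != r -> labelled (T j) (x' j).
  by move=> nj; have [eT _ _] := mu; rewrite -eT //; apply: lT'.
have [S [f [_ af]]] := approx_ex tx' qx' lT2 (lT' r).
exists T', (total S), (total S'), f, f'; split=> //.
apply/(frozen_row q0 tx lT qc mu af af') => j.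
have [] := rc (vfr1 j); rewrite target_vfr1 !arrowsE => -> ->.
by have [] := rc (vfr2 j); rewrite target_vfr2 !arrowsE => -> ->.
Qed.

End IceQuiver.

Theorem proposition3p8 (k : closedFieldType) (n : nat)
    (C : cluster_category k (linear_An n))
    (T T' : dsum (cl_cat C) 'I_n) (r : 'I_n) :
  cluster_tilting T -> is_mutation r T T' ->
  exists QT QT' : 'M[nat]_(n + (n + n)),
    [/\ unique (is_ice_quiver_of T) QT,
        unique (is_ice_quiver_of T') QT'
      & mutate n (vmut r) QT = QT'].
Proof.
move=> ctT mu; have [x [tx lT]] := ct_tri ctT; have [_ _ ctT'] := mu.
have [b [p [q [s [t qx]]]]] := quad_ex r tx.
have tx' := flip_tri tx qx; have lT' := mutation_label tx lT qx mu.
have uniq_ice (S : dsum (cl_cat C) 'I_n) y : tri y -> (forall i, labelled C (S i) (y i)) ->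
    forall Q1 Q2, is_ice_quiver_of S Q1 -> is_ice_quiver_of S Q2 -> Q1 = Q2.
  move=> ty lS Q1 Q2 i1 i2; apply/matrixP => v w.
  have key r' u : Q1 (vmut r') u = Q2 (vmut r') u /\ Q1 u (vmut r') = Q2 u (vmut r').
    have [c qc] := quad_exc r' ty.
    have [-> ->] := QT_of_ice ty lS i1 qc u; by have [-> ->] := QT_of_ice ty lS i2 qc u.
  have [vn|vn] := leqP n v; last first.
    have -> : v = vmut (Ordinal vn) by apply: val_inj.
    by have [-> _] := key (Ordinal vn) w.
  have [wn|wn] := leqP n w.
    by have [[_ _ z1] _ _] := i1; have [[_ _ z2] _ _] := i2; rewrite z1 ?z2.
  have -> : w = vmut (Ordinal wn) by apply: val_inj.
  by have [_ ->] := key (Ordinal wn) v.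
have [QT hQ] := QT_exists tx; have iQ := ice_of_QT ctT tx lT hQ.
exists QT, (mutate n (vmut r) QT); split=> //.
  by split=> // Q'; apply: uniq_ice tx lT _ _ iQ.
have hQ' : is_QT (flip x r (flip_diag b p q s t)) (mutate n (vmut r) QT).
  by apply: mutate_triangulation_quiver qx => // [l c qc|]; [exact: QT_of_ice iQ qc | have [] := hQ].
have iQ' := ice_of_QT ctT' tx' lT' hQ'.
by split=> // Q'; apply: uniq_ice tx' lT' _ _ iQ'.
Qed.
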